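(* The set $\mathcal{O}_{RP}\subset\mathbb{C}$ of regular origami numbers is the smallest subfield of $\mathbb{C}$ which contains $\mathbb{Q}_{Ab}$ and is closed under the operations of taking square roots, cubic roots and complex conjugation. Moreover, for $\alpha\in\mathbb{C}$, we have $\alpha\in\mathcal{O}_{RP}$ if and only if there exists a tower of subfields of $\mathbb{C}$ $$\mathbb{Q}=F_0\subset F_1\subset\dots\subset F_n$$ such that $\alpha\in F_n$ and, for each $i=0,\dots,n-1$, either $2\le [F_{i+1}:F_i]\le 3$ or $F_{i+1}=F_i(\zeta_k)$ for some $k\in\mathbb{N}$.
   Context: Notation: $\zeta_k=e^{2\pi i/k}$ for $k\ge 1$. $\mathbb{Q}_{Ab}\subset\mathbb{C}$ is the maximal Abelian extension of $\mathbb{Q}$. A subfield of $\mathbb{C}$ is closed under square (cubic) roots if it contains every complex square (cube) root of each of its elements. Constructions. Identify $\mathbb{C}$ with the Euclidean plane. A construction starts with the points $0,1$ (given) and proceeds by finitely many steps; each step adds a new constructed line or point obtained from previously constructed (''given'') ones by one of the axioms below. Folding along a line $f$ means applying the reflection across $f$; ''folding $f$ places a point $p$ onto a line $\ell$'' means that the reflection of $p$ across $f$ lies on $\ell$. Huzita-Justin axioms (HJAs): (O1) we can fold the line connecting two given distinct points; (O2) we can fold the perpendicular bisector of two given distinct points; (O3) we can fold the bisector of the angle defined by two given lines (either bisector, for intersecting lines); (O4) we can fold, through a given point, the perpendicular to a given line; (O5) we can fold a line passing through a given point that places another given point onto a given line; (O6) we can fold a line that places simultaneously two given points onto two given lines,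 respectively; (O7) we can fold a line perpendicular to a given line that places a given point onto another given line; (LI) the intersection point of two given non-parallel lines is constructible. In O5, O6, O7 the axiom is applied only to inputs for which there are finitely many lines with the required property, and any of these lines may be constructed. Regular Polygon Axioms (RPAs): for each $n\ge 3$, ($\mathrm{RPA}_n$) given the vertices $A_1,\dots,A_{n+1}$ (in counterclockwise order) of a regular $(n+1)$-gon, we can fold the line containing any side of the regular $n$-gon with vertices $B_1,\dots,B_n$ (in counterclockwise order) determined by $B_1=A_1$ and $B_2=A_2$. A number $\alpha\in\mathbb{C}$ is a regular origami number if there is a finite sequence of applications of the HJAs and the RPAs that starts with $\{0,1\}$ and ends in the point $\alpha$. $\mathcal{O}_{RP}$ denotes the set of all regular origami numbers. *)

(* Defs.v *)
From HB Require Import structures.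
From mathcomp Require Import all_boot all_order all_algebra all_fingroup all_field.
From mathcomp Require Import complex.
From mathcomp Require Import all_classical all_reals all_analysis.

Set Implicit Arguments.
Unset Strict Implicit.
Unset Printing Implicit Defensive.

Import Order.TTheory GRing.Theory Num.Theory.

Local Open Scope classical_set_scope.
Local Open Scope ring_scope.

(* The field of complex numbers is R[i], for R a model of the reals; it is also
   the Euclidean plane, so that points are elements of R[i] and lines are
   subsets of R[i]. *)

Definition zeta (R : realType) (k : nat) : R[i] :=
  Complex (cos (2 * pi / k%:R)) (sin (2 * pi / k%:R)).

(** * Subfields of the complex numbers *)

Definition subfield (R : realType) (F : set R[i]) : Prop :=
  GRing.divring_closed (mem F).

Definition rationals (R : realType) : set R[i] := range (@ratr R[i]).

(* The maximal Abelian extension of the rationals, as the union of all the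
   finite Abelian Galois extensions of the rationals inside R[i]. A finite
   extension inside R[i] is the image of an abstract one by an embedding. *)
Definition Q_Ab (R : realType) : set R[i] :=
  [set z | exists (L : splittingFieldType rat) (iota : {rmorphism L -> R[i]}),
     [/\ galois 1%AS {:L}%AS,
         abelian 'Gal({:L}%AS / 1%AS)%g
       & range iota z] ].

Definition closed_under_roots (R : realType) (n : nat) (F : set R[i]) : Prop :=
  forall a z : R[i], F a -> z ^+ n = a -> F z.

Definition closed_under_conj (R : realType) (F : set R[i]) : Prop :=
  forall z : R[i], F z -> F (Num.conj z).

Definition adjoin (R : realType) (F : set R[i]) (z : R[i]) : set R[i] :=
  smallest (@subfield R) (F `|` [set z]).

(* [K : F] = d, i.e., K has a basis of d elements over F. *)
Definition degree_is (R : realType) (F K : set R[i]) (d : nat) : Prop :=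
  exists e : 'I_d -> R[i],
    [/\ forall i, K (e i),
        forall x, K x -> exists c : 'I_d -> R[i],
          (forall i, F (c i)) /\ x = \sum_(i < d) c i * e i
      & forall c : 'I_d -> R[i], (forall i, F (c i)) ->
          \sum_(i < d) c i * e i = 0 -> forall i, c i = 0].

(** * Plane geometry *)

Definition line (R : realType) (p q : R[i]) : set R[i] :=
  [set z | exists t : R, z = p + real_complex R t * (q - p)].

(* The reflection across line p q, for p != q. *)
Definition reflect_across (R : realType) (p q z : R[i]) : R[i] :=
  p + (q - p) * Num.conj ((z - p) / (q - p)).

(* f is a line, and rho is the reflection across f. *)
Definition reflection (R : realType) (f : set R[i]) (rho : R[i] -> R[i]) : Prop :=
  exists p q, [/\ p != q, f = line p q & rho = reflect_across p q].

Definition places (R : realType) (f : set R[i]) (p : R[i]) (l : set R[i]) : Prop :=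
  exists2 rho, reflection f rho & l (rho p).

(* For vectors u and v, u * v^* has real part the inner product of u and v, and
   imaginary part (up to sign) their determinant. *)
Definition perpendicular (R : realType) (l m : set R[i]) : Prop :=
  exists p q r s, [/\ p != q, r != s, l = line p q, m = line r s
                    & 'Re ((q - p) * Num.conj (s - r)) = 0].

Definition parallel (R : realType) (l m : set R[i]) : Prop :=
  exists p q r s, [/\ p != q, r != s, l = line p q, m = line r s
                    & 'Im ((q - p) * Num.conj (s - r)) = 0].

Definition perp_bisector (R : realType) (p q : R[i]) : set R[i] :=
  [set z | `|z - p| = `|z - q| ].

(* f is a bisector of the distinct lines l and m: folding along f places l onto
   m. There are two such f if l and m intersect, and one if they are parallel. *)
Definition bisector (R : realType) (f l m : set R[i]) : Prop :=
  exists2 rho, reflection f rho & rho @` l = m.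

(* A 0, ..., A (n - 1) are the vertices, in counterclockwise order, of a regular
   n-gon with center c; the indices of A are to be read modulo n. *)
Definition regular_polygon (R : realType) (n : nat) (A : nat -> R[i]) : Prop :=
  exists c r : R[i], r != 0 /\ forall k, A k = c + r * zeta R n ^+ k.

(** * Constructions *)

Definition O5_folds (R : realType) (p q : R[i]) (l : set R[i]) : set (set R[i]) :=
  [set f | f p /\ places f q l].

Definition O6_folds (R : realType) (p q : R[i]) (l m : set R[i]) :
    set (set R[i]) :=
  [set f | places f p l /\ places f q m].

Definition O7_folds (R : realType) (l : set R[i]) (p : R[i]) (m : set R[i]) :
    set (set R[i]) :=
  [set f | perpendicular f l /\ places f p m].

Inductive constructible_point (R : realType) : R[i] -> Prop :=
| Given0 : constructible_point 0
| Given1 : constructible_point 1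
| LI (l m : set R[i]) (p : R[i]) :
    constructible_line l -> constructible_line m -> ~ parallel l m ->
    l p -> m p -> constructible_point p
with constructible_line (R : realType) : set R[i] -> Prop :=
| O1 (p q : R[i]) :
    constructible_point p -> constructible_point q -> p != q ->
    constructible_line (line p q)
| O2 (p q : R[i]) :
    constructible_point p -> constructible_point q -> p != q ->
    constructible_line (perp_bisector p q)
| O3 (l m f : set R[i]) :
    constructible_line l -> constructible_line m -> l <> m ->
    bisector f l m -> constructible_line f
| O4 (p : R[i]) (l f : set R[i]) :
    constructible_point p -> constructible_line l ->
    f p -> perpendicular f l -> constructible_line f
| O5 (p q : R[i]) (l f : set R[i]) :
    constructible_point p -> constructible_point q -> p != q ->
    constructible_line l -> finite_set (O5_folds p q l) ->
    O5_folds p q l f -> constructible_line f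
| O6 (p q : R[i]) (l m f : set R[i]) :
    constructible_point p -> constructible_point q ->
    constructible_line l -> constructible_line m ->
    finite_set (O6_folds p q l m) ->
    O6_folds p q l m f -> constructible_line f
| O7 (l : set R[i]) (p : R[i]) (m f : set R[i]) :
    constructible_line l -> constructible_point p -> constructible_line m ->
    finite_set (O7_folds l p m) ->
    O7_folds l p m f -> constructible_line f
| RPA (n : nat) (A B : nat -> R[i]) (k : nat) :
    (3 <= n)%N -> regular_polygon n.+1 A -> regular_polygon n B ->
    (forall j, (j < n.+1)%N -> constructible_point (A j)) ->
    B 0%N = A 0%N -> B 1%N = A 1%N ->
    constructible_line (line (B k) (B k.+1)).

(* The regular origami numbers. *)
Definition O_RP (R : realType) : set R[i] := [set z | constructible_point z].

Arguments rationals R : clear implicits.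
Arguments Q_Ab R : clear implicits.
Arguments O_RP R : clear implicits.

(* F is a subfield containing Q_Ab, and closed under square roots, cubic roots
   and complex conjugation. *)
Definition root_conj_closed_subfield (R : realType) (F : set R[i]) : Prop :=
  [/\ subfield F, Q_Ab R `<=` F, closed_under_roots 2 F, closed_under_roots 3 F
    & closed_under_conj F].

(* F 0 c= F 1 c= ... c= F n *)
Definition origami_tower (R : realType) (n : nat) (F : nat -> set R[i]) : Prop :=
  [/\ F 0%N = rationals R,
      forall i, (i <= n)%N -> subfield (F i),
      forall i, (i < n)%N -> F i `<=` F i.+1
    & forall i, (i < n)%N ->
        (exists d, (2 <= d <= 3)%N /\ degree_is (F i) (F i.+1) d) \/
        (exists k, (1 <= k)%N /\ F i.+1 = adjoin (F i) (zeta R k))].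

(* Main.v *)
(* The reflection across a line has the form z |-> u z^* + c, so that a line is a
   pair (u, c) and each axiom becomes an equation in u and c. For lines and points
   over a subfield F closed under conjugation, square roots and cubic roots, a fold
   has its u among the roots of a polynomial of degree at most 3 over F; this
   polynomial is not zero, as otherwise there would be infinitely many folds.
   Conversely, O5 and O6 provide the real square and cubic roots, O3 and O6 those
   of complex numbers of modulus 1, and the sides of the n-gon yield zeta_n from
   zeta_(n+1), starting from zeta_(2^a), which square roots provide. The numbers in
   towers form such a subfield, since towers can be lifted over one another.

   There remains to show that Q_Ab is contained in the subfield. An element of an
   Abelian extension is a sum of resolvents w attached to characters c of its
   Galois group. If c has order 2^k m with m odd, then c^(2^k) is a Dirichlet
   character by the theorem of Kronecker and Weber, so that w^(2^k) lies in a
   cyclotomic field. For a character of order p^m, p an odd prime, a twist by powers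
   of Teichmuller characters removes the ramification outside p; two characters of
   order p unramified outside p are dependent, as otherwise a product of them would
   be unramified everywhere, against Minkowski's theorem; so induction on m reduces
   the character to the one of the subfield of degree p^m of Q(zeta_(p^(m+1))). *)

Require Import Defs.
From HB Require Import structures.
From mathcomp Require Import all_boot all_order all_algebra all_fingroup all_solvable all_field all_character.
From mathcomp Require Import complex.
From mathcomp Require Import all_classical all_reals all_analysis.
From mathcomp Require Import ring lra zify.

Set Implicit Arguments.
Unset Strict Implicit.
Unset Printing Implicit Defensive.

Import Order.TTheory GRing.Theory Num.Theory.

Local Open Scope classical_set_scope.
Local Open Scope ring_scope.

(** The 2-parts of the orders are left to the square roots, so that the number theory deals with
    characters of odd order. Oddness pays twice more: complex conjugation lies in the kernel, so the
    fields submitted to Minkowski's theorem are totally real and real linear forms suffice; and at p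
    the automorphism squaring the p-th roots of unity is available to normalize resolvents.
    Ramification is not read off inertia groups. Characters live on the automorphisms of [algC], one
    prime of the ring of all algebraic integers is fixed above each l, and a character is unramified
    at l when a resolvent has an integral valuation there. Two facts carry the computations:
    resolvents of the same character differ by a cyclotomic number, whose valuation is explicit;
    and, the character being defined over Q, an automorphism [nu] sends a resolvent [w] to a power
    of [w] times a cyclotomic number. Valuations, then leading coefficients, are compared on both
    sides of this last relation. The resolvents are in [algC], the plane is [R[i]]: abstract number
    fields embedded in both connect the two. *)

Local Notation Aut := {rmorphism algC -> algC}.
Local Notation pQtoC := (map_poly (@ratr algC)).
Local Notation pZtoC := (map_poly (intr : int -> algC)).

(** * Characters of the absolute Galois group of the rationals *)

(** The product of the minimal polynomials of the elements of [s] splits in the field generated by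
    its roots, which is therefore Galois. *)
Lemma galois_num_field (s : seq algC) :
  exists (L : splittingFieldType rat) (iota : {rmorphism L -> algC}),
    galois 1 {:L} /\ forall x, x \in s -> exists y, iota y = x.
Proof.
have [q [q_neq0 sq]] : exists q : {poly rat}, q != 0 /\ forall x, x \in s -> root (pQtoC q) x.
  elim: s => [|x s [q [q0 sq]]]; first by exists 1; split=> [|?]; rewrite ?oner_neq0 ?in_nil.
  have [r [_ mr] dr] := minCpolyP x.
  exists (r * q); split; first by rewrite mulf_neq0 ?q0 ?(monic_neq0 mr).
  move=> y; rewrite inE rmorphM rootM => /predU1P[->|/sq ->]; last by rewrite orbT.
  by rewrite dr dvdpp.
have [rs Drs] := closed_field_poly_normal (pQtoC q).
have [L [iota [rs1 Drs1 gen]]] := num_field_exists rs.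
have iq : map_poly iota (map_poly (in_alg L) q) = pQtoC q.
  by rewrite -map_poly_comp; apply: eq_map_poly => a /=; rewrite rmorphZ_num rmorph1 mulr1.
have split : splittingFieldFor 1 (map_poly (in_alg L) q) {:L}.
  exists rs1; last by rewrite gen.
  rewrite -(eqp_map iota) iq Drs lead_coef_map -Drs1 rmorph_prod big_map /=.
  rewrite [X in _ %= X](eq_bigr (fun x => 'X - (iota x)%:P)).
    by rewrite eqp_scale // fmorph_eq0 lead_coef_eq0.
  by move=> i _; rewrite rmorphB /= map_polyX map_polyC.
have ax : FieldExt_isSplittingField _ L.
  by constructor; exists (map_poly (in_alg L) q) => //; apply/polyOver1P; exists q.
exists (HB.pack_for (splittingFieldType rat) L ax), iota; split.
  apply/and3P; split; rewrite ?sub1v ?normalFieldf //.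
  apply/separableP => y _; apply: pcharf0_separable => p; rewrite -(fmorph_pchar iota); exact: Cpchar.
move=> x /sq rx; have : x \in rs.
  rewrite -root_prod_XsubC; move: rx; rewrite Drs rootZ //.
  by rewrite lead_coef_eq0 map_poly_eq0.
by rewrite -Drs1 => /mapP[y _ ->]; exists y.
Qed.

Section GaloisAut.
Variables (L : splittingFieldType rat) (iota : {rmorphism L -> algC}).

(** With its converse below, this trades the Galois groups of varying fields for the automorphisms
    of [algC]: these restrict to [L] by normality, and automorphisms of [L] extend. *)
Lemma gal_of_aut (nu : Aut) :
  exists2 g : gal_of {:L}, g \in 'Gal({:L} / 1)%g & forall y, iota (g y) = nu (iota y).
Proof.
have [nu0 Dnu0] := restrict_aut_to_normal_num_field iota nu.
have hom_nu: kHom 1 {:L} (linfun nu0).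
  rewrite k1HomE; apply/ahom_inP.
  by split=> [u v | ]; rewrite !lfunE ?rmorphM ?rmorph1.
have [|g Gg Dg] := kHom_to_gal _ (normalFieldf 1) hom_nu; first by rewrite !subvf.
by exists g => // y; rewrite -Dnu0 -Dg ?memvf ?lfunE.
Qed.

Lemma aut_of_gal (g : gal_of {:L}) : exists nu : Aut, forall y, nu (iota y) = iota (g y).
Proof.
by have [nu Dnu] := extend_algC_subfield_aut iota g; exists nu => y; rewrite Dnu.
Qed.

End GaloisAut.

(** Membership in the absolute Galois group of Q(zeta_n). *)
Definition fixU n (nu : Aut) := forall z : algC, z ^+ n = 1 -> nu z = z.

(* By Galois theory, the elements of the n-th cyclotomic field. *)
Definition Cyc n (x : algC) := forall nu : Aut, fixU n nu -> nu x = x.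

Lemma fixU_dvd m n nu : (m %| n)%N -> fixU n nu -> fixU m nu.
Proof. by move=> /dvdnP[k ->] fx z zm; apply: fx; rewrite mulnC exprM zm expr1n. Qed.

Lemma fixU_prim n z (nu : Aut) : n.-primitive_root z -> nu z = z -> fixU n nu.
Proof. by move=> pz nz y /(prim_rootP pz)[i ->]; rewrite rmorphXn nz. Qed.

Lemma aut_root n (nu : Aut) : (0 < n)%N ->
  exists2 k, coprime k n & forall z : algC, z ^+ n = 1 -> nu z = z ^+ k.
Proof.
move=> n0; have [z pz] := C_prim_root_exists n0.
have : nu z ^+ n = 1 by rewrite -rmorphXn (prim_expr_order pz) rmorph1.
move=> /(prim_rootP pz)[k nk]; exists k => [|y /(prim_rootP pz)[i ->]].
  by rewrite -(prim_root_exp_coprime _ pz) -nk fmorph_primitive_root.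
by rewrite rmorphXn nk -!exprM mulnC.
Qed.

(** In a Galois field [L] containing [x] and [z], the Galois group of [L] over Q(z) fixes [x]. *)
Lemma Cyc_poly n z x : n.-primitive_root z -> Cyc n x ->
  exists p : {poly rat}, x = (pQtoC p).[z].
Proof.
move=> pz cx; have [L [iota [galL sL]]] := galois_num_field [:: x; z].
have [y Dy] := sL x (mem_head _ _).
have [w Dw] : exists w, iota w = z by apply: sL; rewrite !inE eqxx orbT.
have : y \in fixedField 'Gal({:L} / <<1; w>>)%g.
  apply/fixedFieldP; rewrite ?memvf // => g Gg.
  have [nu Dnu] := aut_of_gal iota g.
  apply: (fmorph_inj iota); rewrite -Dnu Dy cx //; apply: (fixU_prim pz).
  rewrite -Dw Dnu; congr (iota _); apply: (fixed_gal (subvf <<1; w>>) Gg).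
  exact: memv_adjoin.
have /galois_fixedField -> : galois <<1; w>> {:L} by apply: galoisS galL; rewrite sub1v subvf.
move=> /Fadjoin_polyP[p /polyOver1P[q ->] yq]; exists q.
rewrite -Dy yq -horner_map Dw -map_poly_comp; congr _.[z].
by apply: eq_map_poly => a /=; rewrite rmorphZ_num rmorph1 mulr1.
Qed.

Lemma Cyc_int n z x : n.-primitive_root z -> Cyc n x ->
  exists (q : {poly int}) (N : int), N != 0 /\ x * N%:~R = (pZtoC q).[z].
Proof.
move=> pz /(Cyc_poly pz)[p ->]; have [q [a a0 ->]] := rat_poly_scale p.
exists q, a; split => //; rewrite map_polyZ -map_poly_comp hornerZ fmorphV /= ratr_int.
rewrite (@eq_map_poly _ _ _ intr) => [|i]; last by rewrite /= ratr_int.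
rewrite mulrC mulrA mulfV ?mul1r //.
by rewrite intr_eq0.
Qed.

(** This is [Cyc_poly] at level 1. *)
Lemma Crat_fixed (x : algC) : (forall nu : Aut, nu x = x) -> x \in Crat.
Proof.
move=> fx; have [z pz] := C_prim_root_exists (ltn0Sn 0).
have z1 : z = 1 by rewrite -(prim_expr_order pz) expr1.
have [p ->] : exists p : {poly rat}, x = (pQtoC p).[z] by apply: (Cyc_poly pz) => nu _.
have -> : (pQtoC p).[z] = ratr p.[1] by rewrite -horner_map rmorph1 z1.
exact: Crat_rat.
Qed.

(* A character of the absolute Galois group of order dividing n, of finite level. *)
Definition is_char n (c : Aut -> algC) :=
  [/\ forall nu mu ka : Aut, ka =1 nu \o mu -> c ka = c nu * c mu,
      forall nu, c nu ^+ n = 1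
    & exists t : algC, forall nu : Aut, nu t = t -> c nu = 1].

Section Char.
Variables (n : nat) (c : Aut -> algC).
Hypotheses (n_gt0 : (0 < n)%N) (cc : is_char n c).

Lemma char_neq0 nu : c nu != 0.
Proof.
have [_ cn _] := cc; apply/negP=> /eqP c0; have := cn nu.
by rewrite c0 expr0n gtn_eqF // => /esym/eqP; rewrite oner_eq0.
Qed.

Lemma charM (nu mu : Aut) : c (nu \o mu) = c nu * c mu.
Proof. by have [cM _ _] := cc; apply: cM. Qed.

Lemma char1 : c idfun = 1.
Proof.
have [cM _ _] := cc; have := cM idfun idfun idfun (fun=> erefl).
by move/(congr1 (fun x => x / c idfun)); rewrite mulfK ?char_neq0 // divff ?char_neq0.
Qed.

Lemma char_ext (nu mu : Aut) : nu =1 mu -> c nu = c mu.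
Proof.
by have [cM _ _] := cc => e; rewrite (cM mu idfun nu) ?char1 ?mulr1.
Qed.

Lemma char_fix (nu : Aut) : fixU n nu -> forall mu, nu (c mu) = c mu.
Proof. by have [_ cn _] := cc => fx mu; apply: fx. Qed.

Lemma charX k (nu ka : Aut) : ka =1 iter k nu -> c ka = c nu ^+ k.
Proof.
have [cM _ _] := cc; elim: k ka => [|k IH] ka e.
  by rewrite expr0 -char1; apply: char_ext => x; rewrite e.
pose mu : Aut := (algC_invaut nu) \o ka.
have emu : mu =1 iter k nu by move=> x; rewrite /= e /= algC_autK.
rewrite exprS -(IH mu emu); apply: cM => x.
by rewrite /= algC_invautK.
Qed.

(** The Lagrange resolvent of [a] is the sum of c(g)^-1 g(a) over a Galois group; independence of
    characters gives an [a] for which it is nonzero. Only the [nu] fixing the n-th roots of unity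
    act on it by a factor, since the others move the values of [c]. *)
Lemma Hilbert90 : exists2 w : algC, w != 0 & forall nu, fixU n nu -> nu w = c nu * w.
Proof.
have [cM cn [t ct]] := cc.
have [z pz] := C_prim_root_exists n_gt0.
have [L [iota [galL sL]]] := galois_num_field [:: t; z].
have [t' Dt] := sL t (mem_head _ _).
have [w Dw] : exists w, iota w = z by apply: sL; rewrite !inE eqxx orbT.
(* As [t] lies in [L], the value of [c] depends on the restriction to [L] only. *)
have agree (nu mu : Aut) : (forall y, nu (iota y) = mu (iota y)) -> c nu = c mu.
  move=> e; pose ka : Aut := algC_invaut mu \o nu.
  rewrite (cM mu ka nu) => [|x]; last by rewrite /= algC_invautK.
  by rewrite (ct ka) ?mulr1 // -Dt /= e algC_autK.
have [ext ext_E] := choice (@aut_of_gal L iota).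
have [d Dd] : exists d : gal_of {:L} -> L, forall g, iota (d g) = (c (ext g))^-1.
  suff /choice[d Dd] : forall g, exists y, iota y = (c (ext g))^-1 by exists d.
  move=> g; have /(prim_rootP pz)[i Di] : (c (ext g))^-1 ^+ n = 1 by rewrite exprVn cn invr1.
  by exists (w ^+ i); rewrite rmorphXn Dw Di.
have [a _ nz] : exists2 a, a \in {:L}%VS & \sum_(x | true) d x * (x : gal_of {:L}) a != 0.
  apply: (gal_independent_contra (x := 1%g)) => //.
  by rewrite -(fmorph_eq0 iota) Dd invr_eq0 char_neq0.
exists (iota (\sum_x d x * (x : gal_of {:L}) a)); first by rewrite fmorph_eq0.
move=> nu fx; rewrite !rmorph_sum mulr_sumr.
have [h _ Dh] := gal_of_aut iota nu.
rewrite [RHS](reindex_inj (mulIg h)) /=; apply: eq_bigr => g _.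
rewrite !rmorphM Dd fmorphV char_fix // Dd /= -Dh -galM ?memvf // mulrA; congr (_ * _).
have -> : c (ext (g * h)%g) = c nu * c (ext g).
  rewrite -charM; apply: agree => y; rewrite ext_E galM ?memvf // Dh /=.
  by rewrite -ext_E.
by rewrite invfM mulrA divff ?mul1r // char_neq0.
Qed.
End Char.

Lemma is_charM n c d : is_char n c -> is_char n d -> is_char n (fun nu => c nu * d nu).
Proof.
move=> [cM cn [t ct]] [dM dn [u du]]; split=> [nu mu ka e|nu|].
- by rewrite (cM _ _ _ e) (dM _ _ _ e) mulrACA.
- by rewrite exprMn cn dn mulr1.
(* A primitive element of Q(t, u) serves both characters. *)
have [z _ [ps Dps]] := algC_PET [:: t; u].
case: ps Dps => [|p [|q [|]]] // [Dt Du].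
exists z => nu nz; have fx (r : {poly rat}) : nu (pQtoC r).[z] = (pQtoC r).[z].
  by rewrite -horner_map nz -map_poly_comp (eq_map_poly (fmorph_rat nu)).
by rewrite (ct nu) ?(du nu) ?mulr1 // ?Dt ?Du; apply: fx.
Qed.

Lemma is_charX n c k : is_char n c -> is_char n (fun nu => c nu ^+ k).
Proof.
move=> [cM cn [t ct]]; split=> [nu mu ka e|nu|]; first by rewrite (cM _ _ _ e) exprMn.
  by rewrite exprAC cn expr1n.
by exists t => nu /ct ->; rewrite expr1n.
Qed.

Lemma is_char_dvd n m c : is_char n c -> (forall nu, c nu ^+ m = 1) -> is_char m c.
Proof. by case=> cM _ ct cm; split. Qed.

Definition dirichlet (c : Aut -> algC) :=
  exists2 M, (0 < M)%N & forall nu, fixU M nu -> c nu = 1.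

Lemma dirichletM c d : dirichlet c -> dirichlet d -> dirichlet (fun nu => c nu * d nu).
Proof.
move=> [M M0 cM] [N N0 dN]; exists (M * N)%N => [|nu fx]; first by rewrite muln_gt0 M0.
rewrite cM ?dN ?mulr1 //; apply: fixU_dvd fx; [exact: dvdn_mull|exact: dvdn_mulr].
Qed.

Lemma dirichletX c k : dirichlet c -> dirichlet (fun nu => c nu ^+ k).
Proof. by move=> [M M0 cM]; exists M => // nu /cM ->; rewrite expr1n. Qed.

(** * Prime ideals of the ring of algebraic integers *)

(** An ideal of the ring of all algebraic integers, so that one choice above [l] restricts
    compatibly to every number field. *)
Definition prime_ideal (l : nat) (P : algC -> Prop) :=
  [/\ forall x, P x -> x \in Aint, P l%:R,
      [/\ P 0, forall x y, P x -> P y -> P (x - y)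
        & forall x y, x \in Aint -> P y -> P (x * y)], ~ P 1
    & forall x y, x \in Aint -> y \in Aint -> P (x * y) -> P x \/ P y].

(** An ideal maximal among the proper ones containing [l] is prime. Zorn's lemma starts from the
    multiples of [l], a proper ideal because 1/l is rational but not an integer. *)
Lemma prime_ideal_exists (l : nat) : prime l -> exists P, prime_ideal l P.
Proof.
move=> pl.
have l_neq0 : l%:R != 0 :> algC by rewrite pnatr_eq0 -lt0n prime_gt0.
pose ideal (X : set algC) := [/\ forall x, X x -> x \in Aint, X l%:R,
      [/\ X 0, forall x y, X x -> X y -> X (x - y)
        & forall x y, x \in Aint -> X y -> X (x * y)] & ~ X 1].
pose I0 : set algC := fun x => x / l%:R \in Aint.
have I0_ideal : ideal I0.
  split=> [x x_l||| one_l].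
  - by rewrite -[x](divfK l_neq0) rpredM // Aint_Cnat.
  - by rewrite /I0 divff // Aint1.
  - split=> [|x y Ix Iy|x y Ax Iy]; rewrite /I0 ?mul0r ?Aint0 // ?mulrBl ?rpredB //.
    by rewrite -mulrA rpredM.
  have : (1 / l%:R : algC) \in Num.int.
    by apply: Cint_rat_Aint => //; rewrite rpred_div // ?rpred1 // rpred_nat.
  rewrite mul1r => /intrP[m Dm].
  have : (m * l%:Z)%:~R = 1%:~R :> algC by rewrite intrM -pmulrn -Dm mulVf.
  move/intr_inj/(congr1 absz); rewrite abszM /= => e1.
  by move: (prime_gt1 pl); rewrite ltnNge dvdn_leq // -e1 dvdn_mull.
have [|A [[A0|[AA Al [Az AB AM] A1]] maxA]] :=
    @Zorn_bigcup algC (fun X => X = set0 \/ ideal X).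
- move=> F FP tot.
  have [[X FX [x Xx]]|noX] := pselect (exists2 X, F X & (X !=set0)%classic); last first.
    left; rewrite -subset0 => y [X FX Xy]; apply: noX; exists X => //; by exists y.
  have idX Y : F Y -> Y = set0 \/ ideal Y by exact: FP.
  have iX : ideal X by case: (idX _ FX) => // X0; rewrite X0 in Xx.
  have [XA Xl [Xz XB XM] X1] := iX.
  have idY Y y : F Y -> Y y -> ideal Y by move=> FY Yy; case: (idX _ FY) => // Y0; rewrite Y0 in Yy.
  right; split=> [y [Y FY Yy]||| [Y FY Y1]].
  + by have [YA _ _ _] := idY _ _ FY Yy; apply: YA.
  + by exists X.
  + split=> [|y z [Y FY Yy] [Z FZ Zz]|y z Ay [Z FZ Zz]]; first by exists X.
      have [YZ|ZY] := tot _ _ FY FZ.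
        by exists Z => //; have [_ _ [_ ZB _] _] := idY _ _ FZ Zz; apply: ZB => //; apply: YZ.
      by exists Y => //; have [_ _ [_ YB _] _] := idY _ _ FY Yy; apply: YB => //; apply: ZY.
    by exists Z => //; have [_ _ [_ _ ZM] _] := idY _ _ FZ Zz; apply: ZM.
  by have [_ _ _] := idY _ _ FY Y1.
- case: (maxA I0); last by right.
  rewrite A0; split; first by move=> ?; [].
  by move/(_ l%:R); case: I0_ideal => _ Il _ _ /(_ Il).
exists A; split=> // x y Ax Ay Axy.
have [|nAx] := pselect (A x); [by left|right].
(* The ideal generated by [A] and [x]. If it contains 1 = q + a x, multiplying by [y] shows that [y]
   is in [A]; otherwise it contradicts maximality. *)
pose B : set algC := fun z => exists q a, [/\ A q, a \in Aint & z = q + a * x].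
have BA z : A z -> B z by move=> Az'; exists z, 0; rewrite mul0r addr0 Aint0.
have Bx : B x by exists 0, 1; rewrite mul1r add0r Aint1.
have [B1|nB1] := pselect (B 1).
  have [q [a [Aq Aa e]]] := B1.
  rewrite -[y]mul1r e mulrDl -mulrA; rewrite -[_ * (_ * _)]opprK -mulNr; apply: AB.
    by rewrite mulrC; apply: AM.
  by apply: AM; rewrite // rpredN.
case: (maxA B); first by split=> [z /BA//|/(_ _ Bx)].
right; split=> //.
- by move=> z [q [a [Aq Aa ->]]]; apply: rpredD; [exact: AA|exact: rpredM].
- exact: BA.
split; first exact: BA.
  move=> z1 z2 [q1 [a1 [Aq1 Aa1 ->]]] [q2 [a2 [Aq2 Aa2 ->]]].
  exists (q1 - q2), (a1 - a2); split; [exact: AB|exact: rpredB|].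
  by rewrite mulrBl opprD addrACA.
move=> z1 z2 Az1 [q2 [a2 [Aq2 Aa2 ->]]]; exists (z1 * q2), (z1 * a2).
by split; [exact: AM|exact: rpredM|rewrite mulrDr mulrA].
Qed.

Lemma AintP x : x \in Aint <-> integralOver (intr : int -> algC) x.
Proof.
split=> [Ax|[p mp rp]].
  have /floorpP[p Dp] : minCpoly x \is a polyOver Num.int by [].
  exists p; last by rewrite -Dp root_minCpoly.
  have := minCpoly_monic x; rewrite Dp !monicE lead_coef_map_inj ?rmorph0 //; last exact: intr_inj.
  by rewrite -[1]/(1%:~R) eqr_int.
apply: (root_monic_Aint rp); first exact: monic_map.
by apply/polyOverP=> i; rewrite coef_map /= rpred_int.
Qed.

Lemma Aint_integral (p : {poly algC}) x :
  p \is monic -> p \is a polyOver Aint -> root p x -> x \in Aint.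
Proof.
move=> mp /allP pA rp; apply/AintP; apply: (integral_root_monic mp rp) => c /pA.
by move/AintP.
Qed.

Lemma Aint_root n y : (0 < n)%N -> y ^+ n \in Aint -> y \in Aint.
Proof.
move=> n0 Ay; apply: (@Aint_integral ('X^n - (y ^+ n)%:P)); first exact: monicXnsubC.
  by rewrite rpredB ?polyOverXn ?polyOverC.
by rewrite rootE !hornerE subrr.
Qed.

Section Ideal.
Variables (l : nat) (P : algC -> Prop).
Hypotheses (pl : prime l) (HP : prime_ideal l P).

Lemma P_Aint x : P x -> x \in Aint. Proof. by have [PA _ _ _ _] := HP; apply: PA. Qed.
Lemma P_l : P l%:R. Proof. by have [_ Pl _ _ _] := HP. Qed.
Lemma P_0 : P 0. Proof. by have [_ _ [P0 _ _] _ _] := HP. Qed.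
Lemma P_B x y : P x -> P y -> P (x - y). Proof. by have [_ _ [_ PB _] _ _] := HP; apply: PB. Qed.
Lemma P_Ml x y : x \in Aint -> P y -> P (x * y).
Proof. by have [_ _ [_ _ PM] _ _] := HP; apply: PM. Qed.
Lemma P_Mr x y : y \in Aint -> P x -> P (x * y). Proof. by rewrite mulrC; apply: P_Ml. Qed.
Lemma P_1 : ~ P 1. Proof. by have [_ _ _ P1 _] := HP. Qed.
Lemma P_prime x y : x \in Aint -> y \in Aint -> P (x * y) -> P x \/ P y.
Proof. by have [_ _ _ _ PP] := HP; apply: PP. Qed.
Lemma P_N x : P x -> P (- x). Proof. by rewrite -sub0r; apply: P_B P_0. Qed.
Lemma P_D x y : P x -> P y -> P (x + y). Proof. by move=> Px /P_N Py; rewrite -[y]opprK; apply: P_B. Qed.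
Lemma P_sum I (r : seq I) (Q : pred I) F : (forall i, Q i -> P (F i)) -> P (\sum_(i <- r | Q i) F i).
Proof. by move=> PF; elim/big_rec: _ => [|i x Qi]; [exact: P_0|apply: P_D; exact: PF]. Qed.
Lemma nP_M x y : x \in Aint -> y \in Aint -> ~ P x -> ~ P y -> ~ P (x * y).
Proof. by move=> ax ay nx ny /(P_prime ax ay)[]. Qed.
Lemma nP_X x k : x \in Aint -> ~ P x -> ~ P (x ^+ k).
Proof.
move=> ax nx; elim: k => [|k IH]; first exact: P_1.
by rewrite exprS; apply: nP_M; rewrite ?rpredX.
Qed.
Lemma P_Xinv x k : x \in Aint -> P (x ^+ k) -> P x.
Proof. by move=> ax Pk; have [//|/(nP_X ax (k := k))] := pselect (P x). Qed.
Lemma P_X x k : (0 < k)%N -> P x -> P (x ^+ k).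
Proof. by case: k => // k _ Px; rewrite exprS; apply: P_Mr; rewrite ?rpredX ?P_Aint. Qed.
Lemma nP_prod I (r : seq I) (Q : pred I) F : (forall i, Q i -> F i \in Aint) ->
  (forall i, Q i -> ~ P (F i)) -> ~ P (\prod_(i <- r | Q i) F i).
Proof.
move=> AF PF; suff [] : (\prod_(i <- r | Q i) F i) \in Aint /\ ~ P (\prod_(i <- r | Q i) F i) by [].
elim/big_rec: _ => [|i x Qi [Ax Px]]; first by split; [exact: Aint1|exact: P_1].
by split; [apply: rpredM => //; exact: AF|apply: nP_M => //; [exact: AF|exact: PF]].
Qed.
Lemma P_trans x y : P (x - y) -> P y -> P x. Proof. by move=> a b; rewrite -[x](subrK y); apply: P_D. Qed.
Lemma P_eqMod x y : P (x - y) -> ~ P y -> ~ P x.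
Proof. by move=> a b c; apply: b; rewrite -[y](subKr x); apply: P_B. Qed.

Lemma P_nat m : P m%:R <-> (l %| m)%N.
Proof.
split=> [Pm|/dvdnP[k ->]]; last by rewrite natrM; apply: P_Ml P_l; rewrite Aint_Cnat ?rpred_nat.
apply/negPn; rewrite -prime_coprime //; apply/negP => /(coprimeP _ (prime_gt0 pl))[[a b] /= e].
apply: P_1; have ab : (b * m < a * l)%N by rewrite -subn_gt0 e.
have -> : 1 = a%:R * l%:R - b%:R * m%:R :> algC by rewrite -!natrM -natrB ?e // ltnW.
by apply: P_B; apply: P_Ml => //; rewrite ?Aint_Cnat ?rpred_nat //; exact: P_l.
Qed.

Lemma P_int m : P m%:~R <-> (l %| absz m)%N.
Proof.
rewrite -P_nat; case: (intP m) => [|k|k]; rewrite ?absz0 //= ?pmulrn //.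
by rewrite mulrNz; split => /P_N; rewrite ?opprK.
Qed.

(** * Valuations *)

(* x has valuation j at P, with respect to the uniformizer pi; the subring S keeps
   track of a field of definition of the units involved. *)
Definition hasval (S : algC -> Prop) (pi x : algC) (j : int) :=
  exists s u, [/\ S s /\ ~ P s, S u /\ ~ P u & x * s = pi ^ j * u].

Definition subringP (S : algC -> Prop) :=
  [/\ forall x, S x -> x \in Aint, S 1, forall x y, S x -> S y -> S (x - y)
     & forall x y, S x -> S y -> S (x * y)].

Lemma subring_Aint : subringP (fun x => x \in Aint).
Proof. by split=> //; [exact: rpredB|exact: rpredM]. Qed.

Section Val.
Variables (S : algC -> Prop) (pi : algC).
Hypotheses (RS : subringP S) (pi_neq0 : pi != 0) (P_pi : P pi).

Let S_A x : S x -> x \in Aint. Proof. by have [SA _ _ _] := RS; apply: SA. Qed.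
Let S_1 : S 1. Proof. by have [_ S1 _ _] := RS. Qed.
Let S_M x y : S x -> S y -> S (x * y). Proof. by have [_ _ _ SM] := RS; apply: SM. Qed.
Let SnP_M x y : S x /\ ~ P x -> S y /\ ~ P y -> S (x * y) /\ ~ P (x * y).
Proof. by move=> [Sx Px] [Sy Py]; split; [exact: S_M|apply: nP_M => //; exact: S_A]. Qed.

Lemma nP_neq0 x : ~ P x -> x != 0.
Proof. by move=> nx; apply/eqP => x0; apply: nx; rewrite x0; apply: P_0. Qed.

Lemma val_Aint x j : hasval S pi x j -> hasval (fun x => x \in Aint) pi x j.
Proof. by move=> [s [u [[Ss Ps] [Su Pu] e]]]; exists s, u; split=> //; split=> //; apply: S_A. Qed.

Lemma val_neq0 x j : hasval S pi x j -> x != 0.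
Proof.
move=> [s [u [[Ss Ps] [Su Pu] e]]]; apply/eqP=> x0; move/esym/eqP: e.
by rewrite x0 mul0r mulf_eq0 expfz_eq0 (negPf pi_neq0) andbF (negPf (nP_neq0 Pu)).
Qed.

Lemma val_unit x : S x -> ~ P x -> hasval S pi x 0.
Proof. by move=> Sx Px; exists 1, x; split=> //; rewrite ?mulr1 ?expr0z ?mul1r //; split=> //; apply: P_1. Qed.

Lemma val_pi j : hasval S pi (pi ^ j) j.
Proof. by exists 1, 1; split=> //; split=> //; apply: P_1. Qed.

Lemma valM x y j k : hasval S pi x j -> hasval S pi y k -> hasval S pi (x * y) (j + k).
Proof.
move=> [s [u [Ss Su e]]] [s' [u' [Ss' Su' e']]].
by exists (s * s'), (u * u'); split; [exact: SnP_M|exact: SnP_M|rewrite mulrACA e e' mulrACA expfzDr].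
Qed.

Lemma valV x j : hasval S pi x j -> hasval S pi x^-1 (- j).
Proof.
move=> vx; have x0 := val_neq0 vx; have [s [u [Ss Su e]]] := vx.
exists u, s; split=> //; apply: (mulfI x0); rewrite mulrA divff // mul1r mulrCA e mulrA.
by rewrite -expfzDr // addNr expr0z mul1r.
Qed.

Lemma valXn x j k : hasval S pi x j -> hasval S pi (x ^+ k) (j * k%:Z).
Proof.
move=> vx; elim: k => [|k IH]; first by rewrite mulr0 expr0; apply: val_unit => //; apply: P_1.
by rewrite exprS intS mulrDr mulr1; apply: valM.
Qed.

Lemma valz x j k : hasval S pi x j -> hasval S pi (x ^ k) (j * k).
Proof.
move=> vx; case: (intP k) => [|m|m]; first by rewrite mulr0 expr0z; apply: val_unit => //; apply: P_1.
  by rewrite -exprnP; apply: valXn.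
by rewrite -invr_expz mulrN -exprnP; apply: valV; apply: valXn.
Qed.

Lemma val_ext_unit x y j : hasval S pi x j -> hasval S pi y 0 -> hasval S pi (x * y) j.
Proof. by move=> vx vy; rewrite -[j]addr0; apply: valM. Qed.

Lemma val_uniq x j k : hasval S pi x j -> hasval S pi x k -> j = k.
Proof.
wlog jk : j k / j <= k => [H vj vk|].
  by case: (leP j k) => [/H|/ltW/H/(_ vk vj)]; [apply|].
move=> [s [u [[Ss Ps] [Su Pu] e]]] [s' [u' [[Ss' Ps'] [Su' Pu'] e']]].
apply/eqP; rewrite eq_le jk /= leNgt; apply/negP=> lt.
have [m Dm] : exists m : nat, k = j + m.+1%:Z.
  by case: (intP (k - j)) (subrK j k) lt => [|m|m] <-; rewrite ?add0r ?ltxx // => lt;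
    [exists m; rewrite addrC|move: lt; rewrite -subr_gt0 addrK oppr_gt0].
have : pi ^ j * (u * s') = pi ^ j * (pi ^+ m.+1 * u' * s).
  by rewrite mulrA -e mulrAC e' Dm expfzDr // -exprnP !mulrA.
move/(mulfI (expfz_neq0 _ pi_neq0)) => e2; apply: (nP_M _ _ Pu Ps'); rewrite ?S_A // e2.
by apply: P_Mr; rewrite ?S_A //; apply: P_Mr; rewrite ?S_A //; apply: P_X.
Qed.

End Val.

(** The candidate unit x s / pi^j is integral, its n-th power being s^(n-1) u. It need not lie in a
    given ring of definition, whence the valuation over all of [Aint]. *)
Lemma val_root pi n x j : pi != 0 -> (0 < n)%N -> hasval (fun x => x \in Aint) pi (x ^+ n) (j * n%:Z) ->
  hasval (fun x => x \in Aint) pi x j.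
Proof.
move=> pi0 n0 [s [u [[Ss Ps] [Su Pu] e]]].
pose y := x * s / pi ^ j.
have pj0 : pi ^ j != 0 by rewrite expfz_neq0.
have yn : y ^+ n = s ^+ n.-1 * u.
  apply: (mulIf (expf_neq0 n pj0)); rewrite /y expr_div_n divfK ?expf_neq0 //.
  rewrite exprMn; have -> : s ^+ n = s * s ^+ n.-1 by rewrite -exprS prednK.
  by rewrite mulrA e -exprz_exp -exprnP -mulrA mulrC (mulrC u).
have nPy : ~ P (y ^+ n) by rewrite yn; apply: nP_M; rewrite ?rpredX //; apply: nP_X.
have Ay : y \in Aint by apply: (Aint_root n0); rewrite yn rpredM ?rpredX.
exists s, y; split=> //; last by rewrite /y mulrCA divff ?mulr1.
by split=> // Py; apply: nPy; apply: P_X.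
Qed.
End Ideal.

(** * The rings Z[z] and their subring calculus *)

Definition Zring (z x : algC) := exists p : {poly int}, x = (pZtoC p).[z].

Lemma Zring_sub n z : (0 < n)%N -> z ^+ n = 1 -> subringP (Zring z).
Proof.
move=> n0 zn; have Az : z \in Aint by apply: (Aint_unity_root n0); apply/unity_rootP.
split.
- move=> _ [p ->]; rewrite horner_coef rpred_sum // => i _.
  by rewrite rpredM ?rpredX // coef_map Aint_int.
- by exists 1; rewrite rmorph1 hornerC.
- by move=> _ _ [p ->] [q ->]; exists (p - q); rewrite rmorphB hornerD hornerN.
by move=> _ _ [p ->] [q ->]; exists (p * q); rewrite rmorphM hornerM.
Qed.

Lemma Zring_gen z : Zring z z.
Proof. by exists 'X; rewrite map_polyX hornerX. Qed.

Lemma Zring_horner z y (p : {poly int}) : Zring z y -> Zring z (pZtoC p).[y].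
Proof.
move=> [q ->]; exists (p \Po q).
by rewrite map_comp_poly horner_comp.
Qed.

Section SubringTheory.
Variables (S : algC -> Prop) (RS : subringP S).
Lemma SA x : S x -> x \in Aint. Proof. by have [H _ _ _] := RS; apply: H. Qed.
Lemma S1 : S 1. Proof. by have [_ H _ _] := RS. Qed.
Lemma SB x y : S x -> S y -> S (x - y). Proof. by have [_ _ H _] := RS; apply: H. Qed.
Lemma SM x y : S x -> S y -> S (x * y). Proof. by have [_ _ _ H] := RS; apply: H. Qed.
Lemma S0 : S 0. Proof. by rewrite -[0](subrr 1); apply: SB; apply: S1. Qed.
Lemma SN x : S x -> S (- x). Proof. by rewrite -sub0r; apply: SB S0. Qed.
Lemma SD x y : S x -> S y -> S (x + y).
Proof. by move=> Sx /SN Sy; rewrite -[y]opprK; apply: SB. Qed.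
Lemma SX x k : S x -> S (x ^+ k).
Proof. by move=> Sx; elim: k => [|k IH]; rewrite ?expr0 ?exprS; [exact: S1|exact: SM]. Qed.
Lemma Snat k : S k%:R.
Proof. by elim: k => [|k IH]; [exact: S0|rewrite -addn1 natrD; apply: SD S1]. Qed.
Lemma Sint k : S k%:~R.
Proof. by case: (intP k) => [|m|m]; [exact: S0|exact: Snat|rewrite mulrNz; apply: SN; exact: Snat]. Qed.
Lemma Ssum I (r : seq I) (Q : pred I) F : (forall i, Q i -> S (F i)) -> S (\sum_(i <- r | Q i) F i).
Proof. by move=> PF; elim/big_rec: _ => [|i x Qi]; [exact: S0|apply: SD; exact: PF]. Qed.
Lemma Sprod I (r : seq I) (Q : pred I) F : (forall i, Q i -> S (F i)) -> S (\prod_(i <- r | Q i) F i).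
Proof. by move=> PF; elim/big_rec: _ => [|i x Qi]; [exact: S1|apply: SM; exact: PF]. Qed.
Lemma Shorner y (p : {poly int}) : S y -> S (pZtoC p).[y].
Proof.
by move=> Sy; rewrite horner_coef; apply: Ssum => i _; rewrite coef_map; apply: SM (Sint _) (SX _ Sy).
Qed.

(** A substitute for the norm: in the minimal equation of [x], all terms but the constant one are
    multiples of [x], and the constant term is nonzero by minimality. *)
Lemma S_norm x : S x -> x != 0 -> exists y (N : int), [/\ S y, N != 0 & x * y = N%:~R].
Proof.
move=> Sx x0; have : minCpoly x \is a polyOver Num.int by exact: (SA Sx).
move=> /floorpP[p Dp]; have rx := root_minCpoly x.
have p0 : p`_0 != 0.
  apply: contra_neq x0 => p0.
  have [r [Dr mr] dr] := minCpolyP x.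
  have r0 : root r 0.
    by rewrite -(fmorph_root (@ratr algC)) -Dr rmorph0 Dp rootE -[0]/(0%:~R) horner_map intr_eq0 horner_coef0 p0.
  have [q Dq] := factor_theorem _ _ r0.
  move: Dq; rewrite subr0 => Dq.
  have : root (pQtoC r) x by rewrite dr.
  rewrite Dq rmorphM /= map_polyX rootM => /orP[|/rootP]; last by rewrite hornerX.
  rewrite dr => /dvdp_leq.
  have q0 : q != 0 by apply: contraTneq mr => q0; rewrite Dq q0 mul0r monicE lead_coef0 eq_sym oner_eq0.
  by move=> /(_ q0); rewrite Dq size_mulX // ltnn.
exists (- (pZtoC (\poly_(i < size p) p`_i.+1)).[x]), p`_0; split=> //.
  by apply: SN; apply: Shorner.
have Ep : p = \poly_(i < size p) p`_i.+1 * 'X + (p`_0)%:P.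
  apply/polyP=> i; rewrite coefD coefMX coefC coef_poly; case: i => [|i] /=; first by rewrite add0r.
  by rewrite addr0; case: ltnP => // ?; rewrite nth_default // leqW.
have : (pZtoC p).[x] = 0 by apply/rootP; rewrite -Dp.
rewrite {1}Ep rmorphD rmorphM /= map_polyX map_polyC hornerD hornerMX hornerC /= => /eqP.
by rewrite addr_eq0 mulrN mulrC => /eqP ->; rewrite opprK.
Qed.
End SubringTheory.

(** * Existence of valuations from a local uniformizer *)

Section Uniformizer.
Variables (l : nat) (P : algC -> Prop).
Hypotheses (pl : prime l) (HP : prime_ideal l P).
Variables (S : algC -> Prop) (pi : algC).
Hypotheses (RS : subringP S) (pi_neq0 : pi != 0) (P_pi : P pi) (S_pi : S pi).
Hypothesis Hloc : forall x, S x -> P x -> exists s t, [/\ S s, S t, ~ P s & x * s = pi * t].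
Hypothesis Hl : exists e : nat, hasval P S pi l%:R e%:Z.

(** [Hloc] says that [pi] generates the maximal ideal of [S] localized at [P]. A divisor of pi^i
    times a unit can be divided by [pi] at most i times, so the descent stops. By [S_norm] every
    nonzero element divides a nonzero integer, hence is of this kind. *)
Lemma decomp i x y s : S x -> S y -> S s -> ~ P s -> x * y = pi ^+ i * s ->
  exists j : nat, hasval P S pi x j%:Z.
Proof.
elim: i x y s => [|i IH] x y s Sx Sy Ss Ps e;
  (have [Px|nPx] := pselect (P x); last by exists 0%N; apply: (val_unit HP _ RS)).
  case: Ps; rewrite -[s]mul1r -[1](expr0 pi) -e; apply: (P_Mr HP) Px; exact: (SA RS).
have [s' [t [Ss' St nPs' e']]] := Hloc Sx Px.
have Sss : S (s * s') by apply: (SM RS).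
have Pss : ~ P (s * s') by apply: (nP_M HP) => //; apply: (SA RS).
have ee : t * y = pi ^+ i * (s * s').
  by apply: (mulfI pi_neq0); rewrite [LHS]mulrA -e' [LHS]mulrAC e exprS !mulrA.
have [j [a [b [Sa Sb ab]]]] := IH _ _ _ St Sy Sss Pss ee.
exists j.+1, (s' * a), b; split=> //.
  by case: Sa => Sa Pa; split; [exact: (SM RS)|apply: (nP_M HP); rewrite ?(SA RS)].
by rewrite mulrA e' -mulrA ab intS expfzDr // expr1z mulrA.
Qed.

Lemma val_int (N : int) : N != 0 -> exists j : nat, hasval P S pi N%:~R j%:Z.
Proof.
move=> N0; have [e ve] := Hl.
have N1 : (0 < `|N|)%N by rewrite absz_gt0.
have [k co Dk] := pfactor_coprime pl N1.
have vk : hasval P S pi k%:R 0.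
  apply: (val_unit HP _ RS); first exact: (Snat RS).
  by move/(P_nat pl HP); apply/negP; rewrite -prime_coprime.
have vN : hasval P S pi `|N|%N%:R (e * logn l `|N|)%N%:Z.
  rewrite [in X in hasval _ _ _ X _]Dk natrM natrX -[Posz _]add0r PoszM.
  by apply: (valM HP RS pi_neq0) => //; apply: (valXn HP RS).
exists (e * logn l `|N|)%N; case: (intP N) vN => //= m [s [u [Ss [Su Pu] eq]]].
exists s, (- u); split=> //; last by rewrite mulrNz mulNr eq mulrN.
by split; [exact: (SN RS)|move/(P_N HP); rewrite opprK].
Qed.

Lemma val_exists_S x : S x -> x != 0 -> exists j : nat, hasval P S pi x j%:Z.
Proof.
move=> Sx x0; have [y [N [Sy N0 e]]] := S_norm RS Sx x0.
have [j [s [u [[Ss Ps] [Su Pu] e2]]]] := val_int N0.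
apply: (@decomp j x (y * s) u) => //; first exact: (SM RS).
by rewrite mulrA e e2 exprnP.
Qed.

Lemma val_exists x (N : int) : x != 0 -> N != 0 -> S (x * N%:~R) -> exists j : int, hasval P S pi x j.
Proof.
move=> x0 N0 SxN; have [j vj] : exists j : nat, hasval P S pi (x * N%:~R) j%:Z.
  by apply: val_exists_S => //; rewrite mulf_neq0 // intr_eq0.
have [k vk] := val_int N0; exists (j%:Z - k%:Z).
rewrite -[x](@mulfK _ N%:~R) ?intr_eq0 //.
by apply: (valM HP RS) => //; apply: (valV HP).
Qed.
End Uniformizer.

(** * Frobenius congruences *)

Section Frobenius.
Variables (l : nat) (S : algC -> Prop).
Hypotheses (pl : prime l) (RS : subringP S).

(** The error is in l S, not merely in P. This precision is what makes [l] itself a uniformizer in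
    [unram_loc]. *)
Lemma Frob_add x y : S x -> S y -> exists2 t, S t & (x + y) ^+ l = x ^+ l + y ^+ l + l%:R * t.
Proof.
move=> Sx Sy.
case: l pl => [|[|m]] // plm; pose L := m.+2.
pose t := \sum_(i < m.+1) (x ^+ (m.+1 - i) * y ^+ i.+1) *+ ('C(L, i.+1) %/ L).
exists t.
  apply: (Ssum RS) => i _; rewrite -mulr_natr.
  by do ?[apply: (SM RS)|apply: (SX RS)|apply: (Snat RS)].
rewrite exprDn big_ord_recl big_ord_recr /= subn0 subnn bin0 binn !mulr1n !expr0 mulr1 mul1r.
rewrite -!addrA; congr (_ + _); rewrite addrC; congr (_ + _).
rewrite mulr_sumr; apply: eq_bigr => i _.
rewrite /= /bump /= add1n subSS mulr_natl -mulrnA divnK //.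
by rewrite prime_dvd_bin //= ltnS ltn_ord.
Qed.

Lemma Frob_int (c : int) : exists2 t, S t & c%:~R ^+ l = c%:~R + l%:R * t :> algC.
Proof.
have fnat m : exists2 t, S t & m%:R ^+ l = m%:R + l%:R * t :> algC.
  elim: m => [|m [t St e]].
    by exists 0; rewrite ?mulr0 ?addr0 ?expr0n ?gtn_eqF ?prime_gt0 //; apply: (S0 RS).
  have [t' St' e'] := Frob_add (Snat RS m) (S1 RS).
  exists (t + t'); first exact: (SD RS).
  by rewrite -natr1 e' e expr1n mulrDr !addrA [in LHS](addrAC m%:R).
case: (intP c) => [|m|m]; try exact: fnat.
have [t St e] := fnat m.+1; have [t' St' e'] := Frob_add (Sint RS (- m.+1%:Z)) (Snat RS m.+1).
exists (- t - t'); first by apply: (SB RS) => //; apply: (SN RS).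
move: e'; rewrite e mulrNz addrC subrr expr0n gtn_eqF ?prime_gt0 //= => e'.
by rewrite -[LHS]subr0 [X in _ - X = _]e' -pmulrn; ring.
Qed.

Lemma Frob_horner y (p : {poly int}) : S y ->
  exists2 t, S t & (pZtoC p).[y] ^+ l = (pZtoC p).[y ^+ l] + l%:R * t.
Proof.
move=> Sy; elim/poly_ind: p => [|p c [t St e]].
  by exists 0; rewrite ?rmorph0 ?horner0 ?mulr0 ?addr0 ?expr0n ?gtn_eqF ?prime_gt0 //; apply: (S0 RS).
rewrite rmorphD rmorphM /= map_polyX map_polyC /= !hornerMXaddC.
have [t1 St1 e1] := Frob_add (SM RS (Shorner RS p Sy) Sy) (Sint RS c).
have [t2 St2 e2] := Frob_int c.
exists (t * y ^+ l + t2 + t1).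
  by do ?[apply: (SD RS)|apply: (SM RS)|apply: (SX RS)].
by rewrite e1 exprMn e e2 !mulrDr mulrDl !mulrA !addrA [in LHS](addrAC (_ * _)).
Qed.

Lemma Frob_iter z (p : {poly int}) k : S z ->
  exists2 t, S t & (pZtoC p).[z] ^+ (l ^ k) = (pZtoC p).[z ^+ (l ^ k)] + l%:R * t.
Proof.
move=> Sz; elim: k => [|k [t St e]].
  by exists 0; rewrite ?expn0 ?expr1 ?mulr0 ?addr0 //; apply: (S0 RS).
have [t1 St1 e1] := Frob_add (Shorner RS p (SX RS (l ^ k) Sz)) (SM RS (Snat RS l) St).
have [t2 St2 e2] := Frob_horner p (SX RS (l ^ k) Sz).
exists (t2 + l%:R ^+ l.-1 * t ^+ l + t1).
  by do ?[apply: (SD RS)|apply: (SM RS)|apply: (SX RS)|apply: (Snat RS)].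
rewrite expnSr exprM e e1 e2 -exprM exprMn !mulrDr !addrA; congr (_ + _ + _).
by rewrite mulrA -exprS prednK ?prime_gt0.
Qed.
End Frobenius.

(** * Valuations on cyclotomic fields of level n and n l *)

Section Unramified.
Variables (l : nat) (P : algC -> Prop).
Hypotheses (pl : prime l) (HP : prime_ideal l P).
Variables (n : nat) (z : algC).
Hypotheses (pz : n.-primitive_root z) (ln : coprime l n).

Let n0 : (0 < n)%N. Proof. exact: prim_order_gt0 pz. Qed.
Let RS : subringP (Zring z). Proof. exact: Zring_sub n0 (prim_expr_order pz). Qed.

(** With f the totient of n, raising to the power l^f fixes [z], so x^(l^f) = x + l t. Hence x (1 -
    x^(l^f - 1)) is a multiple of l, and the second factor is a unit at P because [x] is in P. *)
Lemma unram_loc x : Zring z x -> P x ->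
  exists s t, [/\ Zring z s, Zring z t, ~ P s & x * s = l%:R * t].
Proof.
move=> Sx Px; have [p Dx] := Sx; pose f := totient n.
have [t St e] := Frob_iter pl RS p f (Zring_gen z).
have zf : z ^+ (l ^ f) = z.
  apply/eqP; rewrite -{2}[z]expr1 (eq_prim_root_expr pz); apply/eqP.
  exact: Euler_exp_totient.
have q1 : (1 < l ^ f)%N by rewrite -{1}(expn0 l) ltn_exp2l ?prime_gt1 // totient_gt0.
have {}e : x ^+ (l ^ f).-1 * x = x + l%:R * t by rewrite -exprSr prednK ?Dx ?e ?zf // ltnW.
exists (1 - x ^+ (l ^ f).-1), (- t); split.
- by apply: (SB RS); [exact: (S1 RS)|apply: (SX RS)].
- exact: (SN RS).
- move=> Ps; apply: (P_1 HP); rewrite -[1](subrK (x ^+ (l ^ f).-1)); apply: (P_D HP) => //.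
  by apply: (P_X HP); rewrite // -ltnS prednK // ltnW.
by rewrite mulrBr mulr1 mulrC e opprD addNKr mulrN.
Qed.

Let l_neq0 : l%:R != 0 :> algC. Proof. by rewrite pnatr_eq0 -lt0n prime_gt0. Qed.

Lemma unram_val x : x != 0 -> Cyc n x -> exists j : int, hasval P (Zring z) l%:R x j.
Proof.
move=> x0 /(Cyc_int pz)[q [N [N0 e]]].
apply: (val_exists pl HP RS l_neq0 unram_loc _ x0 N0).
  by exists 1%N; have := val_pi HP l%:R RS 1; rewrite expr1z.
by exists q.
Qed.
End Unramified.

(** Both sides are the value at 1 of (X^l - 1) / (X - 1). *)
Lemma prod_one_sub_root l (r : algC) : l.-primitive_root r -> (1 < l)%N ->
  l%:R = \prod_(1 <= k < l) (1 - r ^+ k).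
Proof.
move=> pr l1; have := factor_Xn_sub_1 pr; rewrite big_ltn; last exact: ltnW.
rewrite expr0 subrX1 => /(mulfI (negbT (polyXsubC_eq0 1))).
move/(congr1 (fun p => p.[1])); rewrite horner_prod horner_sum.
have -> : \sum_(i < l) ('X^i).[1] = l%:R :> algC.
  under eq_bigr do rewrite hornerXn expr1n.
  by rewrite sumr_const card_ord.
by move=> <-; apply: eq_bigr => k _; rewrite hornerXsubC.
Qed.

Lemma horner_diff (S : algC -> Prop) (p : {poly int}) u v : subringP S -> S u -> S v ->
  exists2 t, S t & (pZtoC p).[u] = (pZtoC p).[v] + (u - v) * t.
Proof.
move=> RS Su Sv; elim/poly_ind: p => [|p c [t St e]].
  by exists 0; rewrite ?rmorph0 ?horner0 ?mulr0 ?addr0 //; apply: (S0 RS).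
rewrite rmorphD rmorphM /= map_polyX map_polyC /= !hornerMXaddC.
exists ((pZtoC p).[v] + t * u); last by rewrite e; ring.
by apply: (SD RS); [exact: (Shorner RS)|apply: (SM RS)].
Qed.

Section Ramified.
Variables (l : nat) (P : algC -> Prop).
Hypotheses (pl : prime l) (HP : prime_ideal l P).
Variables (n : nat) (z : algC).
Hypotheses (pz : (n * l).-primitive_root z) (ln : coprime l n).
Let r := z ^+ n.
Let y := z ^+ l.
Let pi := 1 - r.

Let nl0 : (0 < n * l)%N. Proof. exact: prim_order_gt0 pz. Qed.
Let RS : subringP (Zring z). Proof. exact: Zring_sub nl0 (prim_expr_order pz). Qed.
Let l0 : (0 < l)%N. Proof. exact: prime_gt0. Qed.
Let l1 : (1 < l)%N. Proof. exact: prime_gt1. Qed.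
Let n0 : (0 < n)%N. Proof. by move: nl0; rewrite muln_gt0 => /andP[]. Qed.
Let pr : l.-primitive_root r.
Proof. by have := exp_prim_root pz n; rewrite gcdnMr mulKn. Qed.
Let py : n.-primitive_root y.
Proof. by have := exp_prim_root pz l; rewrite gcdnMl mulnK. Qed.
Let Sz : Zring z z. Proof. exact: Zring_gen. Qed.
Let Sr : Zring z r. Proof. exact: (SX RS). Qed.
Let Sy : Zring z y. Proof. exact: (SX RS). Qed.
Let r_l : r ^+ l = 1. Proof. exact: prim_expr_order pr. Qed.

Lemma ram_pi_S : Zring z pi. Proof. by apply: (SB RS) => //; apply: (S1 RS). Qed.

Lemma ram_pi_neq0 : pi != 0.
Proof.
by rewrite subr_eq0 eq_sym -[r]expr1 -(prim_order_dvd pr) dvdn1 gtn_eqF.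
Qed.

(** The sums on the right relate the conjugates of [pi] to [pi]. Being congruent to k modulo P, they
    are units at P for k prime to l. *)
Lemma ram_g k : 1 - r ^+ k = pi * \sum_(i < k) r ^+ i.
Proof. by rewrite -opprB subrX1 -mulNr opprB. Qed.

(** Some factor 1 - r^k of l is in P, and it divides 1 - r since r is a power of r^k. *)
Lemma ram_P_pi : P pi.
Proof.
have Pl := P_l HP; rewrite (prod_one_sub_root pr l1) in Pl.
have A1 k : 1 - r ^+ k \in Aint.
  by apply: (SA RS); apply: (SB RS); [exact: (S1 RS)|apply: (SX RS)].
have [k /andP[k0 kl] Pk] : exists2 k, (0 < k < l)%N & P (1 - r ^+ k).
  apply: contrapT => no; move: Pl; rewrite big_nat; apply: (nP_prod HP) => [k _|k kl Pk]; first exact: A1.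
  by apply: no; exists k.
have ck : coprime k l by rewrite coprime_sym prime_coprime // gtnNdvd.
have [[u v] /= e] := coprimeP l k0 ck.
have : P (1 - (r ^+ k) ^+ u).
  have -> : 1 - (r ^+ k) ^+ u = (1 - r ^+ k) * \sum_(i < u) (r ^+ k) ^+ i.
    by rewrite -opprB subrX1 -mulNr opprB.
  apply: (P_Mr HP) => //; apply: (SA RS); apply: (Ssum RS) => i _.
  by do ?apply: (SX RS).
have -> : (r ^+ k) ^+ u = r.
  rewrite -exprM mulnC; have -> : (u * k = 1 + v * l)%N by rewrite -e subnK // ltnW // -subn_gt0 e.
  by rewrite exprD expr1 mulnC exprM r_l expr1n mulr1.
by [].
Qed.

Lemma ram_g_mod k : P (\sum_(i < k) r ^+ i - k%:R).
Proof.
have -> : k%:R = \sum_(i < k) 1 :> algC by rewrite sumr_const card_ord.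
rewrite -sumrB; apply: (P_sum HP) => i _.
rewrite -opprB; apply: (P_N HP); rewrite ram_g; apply: (P_Mr HP) ram_P_pi.
by apply: (SA RS); apply: (Ssum RS) => j _; apply: (SX RS).
Qed.

Lemma ram_g_unit k : coprime k l -> ~ P (\sum_(i < k) r ^+ i).
Proof.
move=> ck; apply: (P_eqMod HP (ram_g_mod k)) => /(P_nat pl HP).
by apply/negP; rewrite -prime_coprime // coprime_sym.
Qed.

Lemma ram_g_S k : Zring z (\sum_(i < k) r ^+ i).
Proof. by apply: (Ssum RS) => j _; apply: (SX RS). Qed.

Lemma ram_l : hasval P (Zring z) pi l%:R l.-1%:Z.
Proof.
exists 1, (\prod_(1 <= k < l) \sum_(i < k) r ^+ i); split.
- by split; [exact: (S1 RS)|exact: (P_1 HP)].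
- split; first by apply: (Sprod RS) => k _; exact: ram_g_S.
  rewrite big_nat; apply: (nP_prod HP) => k /andP[k0 kl]; first exact: (SA RS (ram_g_S k)).
  by apply: ram_g_unit; rewrite coprime_sym prime_coprime // gtnNdvd.
rewrite mulr1 {1}(prod_one_sub_root pr l1) (eq_bigr _ (fun k _ => ram_g k)) big_split /=.
by rewrite big_const_nat iter_mulr_1 subn1.
Qed.

(** Modulo [pi], the root [z] may be replaced by a power [w] of [y]. This moves [x] into Z[y], where
    [l] is a uniformizer, and [l] is a multiple of [pi] up to a unit. *)
Lemma ram_loc x : Zring z x -> P x ->
  exists s t, [/\ Zring z s, Zring z t, ~ P s & x * s = pi * t].
Proof.
move=> [p ->] Px.
have [[u v] /= e] := coprimeP n l0 ln.
have e' : (u * l = 1 + v * n)%N by rewrite -e subnK // ltnW // -subn_gt0 e.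
(* As u l = 1 + v n, this is z r^v, and r is 1 modulo [pi]. *)
pose w := y ^+ u.
have Sw : Zring z w by apply: (SX RS).
have Dz : z = w * r ^+ (l.-1 * v).
  rewrite /w -exprM mulnC e' exprD expr1 -mulrA mulnC exprM -/r -exprD.
  by rewrite -[X in (X + _)%N]mul1n -mulnDl add1n prednK // exprM r_l expr1n mulr1.
have [t St et] := horner_diff p RS Sz Sw.
have [t' St' et'] : exists2 t', Zring z t' & z - w = pi * t'.
  exists (- (w * \sum_(i < l.-1 * v) r ^+ i)).
    by apply: (SN RS); apply: (SM RS) => //; apply: ram_g_S.
  by rewrite mulrN mulrCA -ram_g {1}Dz; ring.
have PA : P (pZtoC p).[w].
  rewrite -[(pZtoC p).[w]](addrK ((z - w) * t)) -et; apply: (P_B HP) => //.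
  rewrite et' -mulrA; apply: (P_Mr HP) ram_P_pi; apply: (SA RS); exact: (SM RS).
have Zyw : Zring y w by apply: (SX (Zring_sub n0 (prim_expr_order py))); apply: Zring_gen.
have [s [t2 [Ss St2 nPs e2]]] := unram_loc pl HP py ln (Zring_horner p Zyw) PA.
have sub x' : Zring y x' -> Zring z x' by move=> [q ->]; apply: Zring_horner.
have [a [b [[Sa Pa] [Sb Pb] eab]]] := ram_l.
exists (s * a), (pi ^+ l.-2 * b * t2 + t' * t * (s * a)).
have Ssa : Zring z (s * a) by apply: (SM RS) => //; apply: sub.
split=> //.
- apply: (SD RS); last by apply: (SM RS) Ssa; apply: (SM RS).
  by apply: (SM RS); [apply: (SM RS) => //; apply: (SX RS _ ram_pi_S)|exact: sub].
- by apply: (nP_M HP) => //; apply: (SA RS) => //; apply: sub.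
rewrite et mulrDl (mulrA _ s a) e2 et' mulrAC eab mulrDr !mulrA -exprnP.
by rewrite -exprS prednK // -ltnS prednK.
Qed.

Lemma ram_val x : x != 0 -> Cyc (n * l) x -> exists j : int, hasval P (Zring z) pi x j.
Proof.
move=> x0 /(Cyc_int pz)[q [N [N0 e]]].
apply: (val_exists pl HP RS ram_pi_neq0 ram_loc _ x0 N0).
  by exists l.-1; exact: ram_l.
by exists q.
Qed.
End Ramified.

(** Here [e] is the ramification index: only the valuations at [pi] that are multiples of it come
    from valuations at [l]. *)
Lemma val_change (l : nat) P S pi x j (e k : int) : prime_ideal l P -> subringP S ->
  pi != 0 -> l%:R != 0 :> algC -> hasval P S pi l%:R e ->
  (hasval P S l%:R x j -> hasval P S pi x (e * j)) /\
  (hasval P S pi x (e * k) -> hasval P S l%:R x k).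
Proof.
move=> HP RS pi0 l0 vl; have vlk i := valz HP RS pi0 i vl; split=> [[s [u [Ss Su e1]]]|vx].
  have Ds : x = l%:R ^ j * (u / s).
    by rewrite mulrA -e1 mulfK // (nP_neq0 HP) //; case: Ss.
  rewrite Ds; apply: (val_ext_unit HP RS pi0) => //.
  rewrite -[0]add0r -{2}[0]oppr0; apply: (valM HP RS pi0).
    by case: Su => Su nPu; apply: (val_unit HP _ RS).
  by apply: (valV HP pi0); case: Ss => Ss1 nPs; apply: (val_unit HP _ RS).
have lk0 : l%:R ^ k != 0 :> algC by rewrite expfz_neq0.
have [s [u [Ss Su e1]]] : hasval P S pi (x / l%:R ^ k) 0.
  by rewrite -[0](subrr (e * k)); apply: (valM HP RS pi0) => //; apply: (valV HP pi0).
exists s, u; split=> //; apply: (mulIf (invr_neq0 lk0)).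
by rewrite mulrAC e1 expr0z mul1r mulrAC divff ?mul1r.
Qed.

(** Otherwise 1 - x/y would be one of the factors of N = prod (1 - z^k), and N is prime to l. *)
Lemma root_uniq l P N (x y : algC) : prime l -> prime_ideal l P -> coprime l N -> (0 < N)%N ->
  x ^+ N = 1 -> y ^+ N = 1 -> P (x - y) -> x = y.
Proof.
move=> pl HP co N0 xN yN Pxy; have [z pz] := C_prim_root_exists N0.
have Az : z \in Aint by exact: Aint_prim_root pz.
have Ay : y \in Aint by apply: (Aint_unity_root N0); apply/unity_rootP.
have x0 : y != 0 by apply: contra_eq_neq yN => ->; rewrite expr0n gtn_eqF // eq_sym oner_eq0.
have /(prim_rootP pz)[i Di] : (x / y) ^+ N = 1 by rewrite expr_div_n xN yN divr1.
have Dx : x = z ^+ i * y by rewrite -Di divfK.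
have [i0|i0] := posnP i; first by rewrite Dx i0 expr0 mul1r.
case: (P_1 HP); have N1 : (1 < N)%N by apply: leq_ltn_trans (ltn_ord i); rewrite i0.
have : P (N%:R * y).
  rewrite (prod_one_sub_root pz N1) (big_rem (i : nat)) /=; last by rewrite mem_index_iota i0 ltn_ord.
  rewrite -mulrA mulrCA -[X in P X]opprK; apply: (P_N HP); rewrite -mulrN.
  apply: (P_Ml HP); last by rewrite mulrBl mul1r opprB -Dx.
  by rewrite big_seq rpred_prod // => k _; rewrite rpredB ?rpred1 ?rpredX.
move=> /(P_prime HP _ Ay)[|/(P_nat pl HP)|Py].
- by rewrite Aint_Cnat ?rpred_nat.
- by move=> d; move: co; rewrite prime_coprime // d.
rewrite -yN; apply: (P_X HP) => //.
Qed.

(* The resolvents of c, over the n-th cyclotomic field. *)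
Definition attached n (c : Aut -> algC) w := w != 0 /\ forall nu, fixU n nu -> nu w = c nu * w.

Lemma attachedM n c d w v : attached n c w -> attached n d v -> attached n (fun nu => c nu * d nu) (w * v).
Proof.
move=> [w0 cw] [v0 dv]; split=> [|nu fx]; first by rewrite mulf_neq0.
by rewrite rmorphM cw // dv // mulrACA.
Qed.

Lemma attached_dvd m n c w : (m %| n)%N -> attached m c w -> attached n c w.
Proof. by move=> mn [w0 cw]; split=> // nu /(fixU_dvd mn)/cw. Qed.

Lemma attached_ratio n N c w v : is_char N c -> (0 < N)%N -> attached n c w -> attached n c v -> Cyc n (w / v).
Proof.
move=> cc N0 [w0 cw] [v0 dv] nu fx; rewrite fmorph_div cw // dv // -mulf_div divff ?mul1r //.
exact: (char_neq0 _ cc).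
Qed.

(** Both [nu w] and w^a are resolvents of c^a. The point is that [c] is defined over Q, hence takes
    the same value at [ka] and at its conjugate by [nu]; commutativity over Q, rather than over the
    cyclotomic field, enters here. *)
Lemma attached_pow n c w (nu : Aut) a : is_char n c -> (0 < n)%N -> attached n c w ->
  (forall z : algC, z ^+ n = 1 -> nu z = z ^+ a) -> Cyc n (nu w / w ^+ a).
Proof.
move=> cc n0 [w0 cw] na ka fx; have [cM cn _] := cc.
pose ka' : Aut := algC_invaut nu \o (ka \o nu).
have ka'E x : nu (ka' x) = ka (nu x) by rewrite /= algC_invautK.
have fx' : fixU n ka'.
  move=> z zn; apply: (fmorph_inj nu); rewrite ka'E fx // -rmorphXn zn rmorph1 //.
have cka : c ka' = c ka.
  apply: (mulfI (char_neq0 n0 cc nu)).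
  rewrite -(cM nu ka' (ka \o nu : Aut)) => [|x]; last by rewrite /= algC_invautK.
  by rewrite (cM ka nu) // mulrC.
have c0 : c ka != 0 by exact: (char_neq0 _ cc).
rewrite fmorph_div rmorphXn (cw ka) // -ka'E cw // rmorphM cka na // exprMn -mulf_div divff ?mul1r //.
by rewrite expf_neq0.
Qed.

(** * Characters unramified at a prime *)

Section UR.
Variable PI : nat -> algC -> Prop.
Hypothesis HPI : forall l, prime l -> prime_ideal l (PI l).

Definition URw l w := exists j, hasval (PI l) (fun x => x \in Aint) l%:R w j.

(* c is unramified at l: over a cyclotomic field unramified at l, it has a resolvent
   whose valuation is an integral multiple of that of l. *)
Definition UR l c := exists n w, [/\ coprime l n, attached n c w & URw l w].

Section OnePrime.
Variable l : nat.
Hypothesis pl : prime l.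
Let HP := HPI pl.
Let l0 : l%:R != 0 :> algC. Proof. by rewrite pnatr_eq0 -lt0n prime_gt0. Qed.

Lemma coprime_gt0 n : coprime l n -> (0 < n)%N.
Proof. by case: n => [|n] //; rewrite /coprime gcdn0 => /eqP l1; move: (prime_gt1 pl); rewrite l1. Qed.

Lemma URw_Cyc n x : coprime l n -> x != 0 -> Cyc n x -> URw l x.
Proof.
move=> co x0 cx; have n0 := coprime_gt0 co; have [z pz] := C_prim_root_exists n0.
have [j vj] := unram_val pl HP pz co x0 cx; exists j; apply: val_Aint vj.
exact: Zring_sub n0 (prim_expr_order pz).
Qed.

Lemma URwM w v : URw l w -> URw l v -> URw l (w * v).
Proof. by move=> [j vj] [k vk]; exists (j + k); apply: (valM HP subring_Aint l0). Qed.

(** Two resolvents of [c] differ by a number in a cyclotomic field unramified at l, so the choice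
    made in [UR] is immaterial. *)
Lemma UR_any n N c w : is_char N c -> (0 < N)%N -> UR l c -> coprime l n -> attached n c w -> URw l w.
Proof.
move=> cc N0 [m [v [com av uv]]] co aw; have [v0 _] := av; have [w0 _] := aw.
rewrite -(divfK v0 w); apply: URwM => //.
apply: (@URw_Cyc (m * n)); first by rewrite coprimeMr com.
  by rewrite mulf_neq0 ?invr_neq0.
apply: (attached_ratio cc) => //; [apply: attached_dvd aw|apply: attached_dvd av];
  [exact: dvdn_mull|exact: dvdn_mulr].
Qed.

Lemma UR_M c d : UR l c -> UR l d -> UR l (fun nu => c nu * d nu).
Proof.
move=> [n [w [co aw uw]]] [m [v [com av uv]]]; exists (n * m)%N, (w * v); split.
- by rewrite coprimeMr co.
- by apply: attachedM; [apply: attached_dvd aw; exact: dvdn_mulr|apply: attached_dvd av; exact: dvdn_mull].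
exact: URwM.
Qed.

Lemma UR_dirichlet n M c : is_char n c -> coprime l n -> coprime l M ->
  (forall nu, fixU M nu -> c nu = 1) -> UR l c.
Proof.
move=> cc con coM cM; have n0 := coprime_gt0 con.
have [w w0 cw] := Hilbert90 n0 cc; exists n, w; split=> //.
apply: (@URw_Cyc (n * M)) => //; first by rewrite coprimeMr con.
move=> nu fx; rewrite cw ?cM ?mul1r //; apply: fixU_dvd fx; [exact: dvdn_mull|exact: dvdn_mulr].
Qed.
End OnePrime.

Lemma UR_X l c k : prime l -> UR l c -> UR l (fun nu => c nu ^+ k).
Proof.
move=> pl uc; elim: k => [|k IH]; last by under eq_fun do rewrite exprS; apply: UR_M.
exists 1%N, 1; split; first exact: coprimen1.
  by split=> [|nu _]; rewrite ?oner_eq0 // rmorph1 expr0 mulr1.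
by exists 0; apply: (val_unit (HPI pl) _ subring_Aint); [exact: Aint1|exact: P_1 (HPI pl)].
Qed.

Lemma attached_Cyc n c w : is_char n c -> attached n c w -> Cyc n (w ^+ n).
Proof. by move=> [_ cn _] [w0 cw] nu fx; rewrite rmorphXn cw // exprMn cn mul1r. Qed.

(** The cyclotomic number w^n is a unit at each prime dividing neither its denominator [N] nor the
    integer multiple [M] of its numerator. *)
Lemma UR_finite n c : is_char n c -> (0 < n)%N ->
  exists2 B, (0 < B)%N & forall l, prime l -> ~~ (l %| B)%N -> coprime l n -> UR l c.
Proof.
move=> cc n0; have [w w0 cw] := Hilbert90 n0 cc.
have [z pz] := C_prim_root_exists n0.
have RS := Zring_sub n0 (prim_expr_order pz).
have [q [N [N0 e]]] := Cyc_int pz (attached_Cyc cc (conj w0 cw)).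
have q0 : (pZtoC q).[z] != 0 by rewrite -e mulf_neq0 ?expf_neq0 ?intr_eq0.
have [|y [M [Sy M0 e2]]] := S_norm RS _ q0; first by exists q.
exists (`|N| * `|M|)%N; first by rewrite muln_gt0 !absz_gt0 N0.
move=> l pl; rewrite Euclid_dvdM // negb_or => /andP[lN lM] co; have HP := HPI pl.
exists n, w; split=> //; exists 0.
apply: (val_root HP _ n0); first by rewrite pnatr_eq0 -lt0n prime_gt0.
exists N%:~R, (pZtoC q).[z]; rewrite mul0r expr0z mul1r; split=> //; split.
- exact: Aint_int.
- by move/(P_int pl HP); apply/negP.
- by apply: (SA RS); exists q.
move=> Pq; have : PI l M%:~R by rewrite -e2; apply: (P_Mr HP) Pq; exact: (SA RS).
by move/(P_int pl HP); apply/negP.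
Qed.
End UR.

Lemma aut_crt l n a : coprime l n -> coprime a l -> (0 < l)%N -> (0 < n)%N ->
  exists nu : Aut, fixU n nu /\ forall z, z ^+ l = 1 -> nu z = z ^+ a.
Proof.
move=> co ca l0 n0; pose k := chinese l n a 1.
have kl : k = a %[mod l] by exact: chinese_modl.
have kn : k = 1 %[mod n] by exact: chinese_modr.
have ck : coprime k (l * n).
  by rewrite coprimeMr -coprime_modl kl coprime_modl ca -coprime_modl kn coprime_modl coprime1n.
have [nu Dnu] := Qn_aut_exists ck.
exists nu; split=> z zn.
  rewrite Dnu; last by rewrite mulnC exprM zn expr1n.
  by rewrite -(expr_mod k zn) kn expr_mod // expr1.
rewrite Dnu; last by rewrite exprM zn expr1n.
by rewrite -(expr_mod k zn) kl expr_mod.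
Qed.

(** * Teichmuller characters *)

Section Teichmuller.
Variables (l : nat) (P : algC -> Prop).
Hypotheses (pl : prime l) (HP : prime_ideal l P).
Let l0 : (0 < l)%N. Proof. exact: prime_gt0. Qed.
Let l1 : (0 < l.-1)%N. Proof. by rewrite -ltnS prednK ?prime_gt1. Qed.
Let co : coprime l l.-1. Proof. by rewrite prime_coprime // gtnNdvd // prednK. Qed.

(** By Fermat's little theorem, a^(l-1) - 1, the product of the a - z^i, is in P. *)
Lemma teich_exists a : coprime a l -> exists2 x : algC, x ^+ l.-1 = 1 & P (a%:R - x).
Proof.
move=> ca; have [z pz] := C_prim_root_exists l1.
have e := factor_Xn_sub_1 pz.
move/(congr1 (fun p => p.[a%:R])): e; rewrite horner_prod hornerD hornerN hornerXn hornerC => e.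
have Pa : P (\prod_(0 <= i < l.-1) (a%:R - z ^+ i)).
  rewrite (eq_bigr (fun i => ('X - (z ^+ i)%:P).[a%:R])); last by move=> i _; rewrite hornerXsubC.
  have a0 : (0 < a ^ l.-1)%N.
    rewrite expn_gt0 lt0n; apply/orP; left.
    by apply: contraTneq ca => ->; rewrite /coprime gcd0n gtn_eqF // prime_gt1.
  rewrite e -natrX -[X in _ - X]/(1%:R) -natrB //.
  apply/(P_nat pl HP); rewrite -eqn_mod_dvd //.
  have := Euler_exp_totient ca; rewrite totient_prime // => ->; exact: eqxx.
apply: contrapT => no; move: Pa; apply: (nP_prod HP) => [i _|i _ Pi].
  by rewrite rpredB ?rpredX ?rpred_nat // (Aint_prim_root pz).
by apply: no; exists (z ^+ i) => //; rewrite exprAC (prim_expr_order pz) expr1n.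
Qed.

Lemma teich_uniq x y : x ^+ l.-1 = 1 -> y ^+ l.-1 = 1 -> P (x - y) -> x = y.
Proof. exact: root_uniq pl HP co l1. Qed.

Lemma P_expB x y k : x \in Aint -> y \in Aint -> P (x - y) -> P (x ^+ k - y ^+ k).
Proof.
move=> Ax Ay Pxy; rewrite subrXX; apply: (P_Mr HP) => //.
by apply: rpred_sum => i _; rewrite rpredM ?rpredX.
Qed.

Lemma P_mulB x y x' y' : x \in Aint -> y' \in Aint -> P (x - x') -> P (y - y') -> P (x * y - x' * y').
Proof.
move=> Ax Ay Px Py.
have -> : x * y - x' * y' = x * (y - y') + (x - x') * y' by ring.
by apply: (P_D HP); [exact: (P_Ml HP)|exact: (P_Mr HP)].
Qed.

Variable r : algC.
Hypothesis pr : l.-primitive_root r.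

(** The cyclotomic character modulo l, lifted to roots of unity of order dividing l - 1;
    multiplicativity holds because the lift is unique. *)
Lemma teich_char : exists W : Aut -> algC, is_char l.-1 W /\
  forall (nu : Aut) a, nu r = r ^+ a -> P (a%:R - W nu).
Proof.
have ex (nu : Aut) : exists x : algC, x ^+ l.-1 = 1 /\ forall a, nu r = r ^+ a -> P (a%:R - x).
  have [a ca na] := aut_root nu l0; have nra := na _ (prim_expr_order pr).
  have [x xl Px] := teich_exists ca; exists x; split=> // b nrb.
  have /eqP e : r ^+ b == r ^+ a by rewrite -nrb nra.
  have eab : (b == a %[mod l])%N by rewrite -(eq_prim_root_expr pr) e.
  rewrite -[b%:R](subrK a%:R) -addrA; apply: (P_D HP) => //.
  wlog: / (a <= b)%N => [H|ab]; last by rewrite -natrB //; apply/(P_nat pl HP); rewrite -eqn_mod_dvd.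
  have [/H//|/ltnW ba] := leqP a b; rewrite -opprB -natrB //; apply: (P_N HP).
  by apply/(P_nat pl HP); rewrite -eqn_mod_dvd // eq_sym.
have [W HW] := choice ex.
have Wl nu : W nu ^+ l.-1 = 1 by have [] := HW nu.
have AW nu : W nu \in Aint by apply: (Aint_unity_root l1); apply/unity_rootP.
have Wa (nu : Aut) a : nu r = r ^+ a -> P (a%:R - W nu) by move=> e; have [_] := HW nu; apply.
exists W; split=> //; split=> // [nu mu ka e|].
  have [a _ na] := aut_root nu l0; have [b _ nb] := aut_root mu l0.
  have nra := na _ (prim_expr_order pr); have nrb := nb _ (prim_expr_order pr).
  apply: teich_uniq => //; first by rewrite exprMn !Wl mulr1.
  have kr : ka r = r ^+ (a * b) by rewrite e /= nrb rmorphXn nra exprM.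
  rewrite -opprB; apply: (P_N HP).
  rewrite -[W nu * W mu](addrNK ((a * b)%:R)) -addrA; apply: (P_D HP); last exact: Wa.
  rewrite natrM -opprB; apply: (P_N HP).
  by apply: P_mulB; rewrite ?rpred_nat //; apply: Wa.
exists r => nu nr; apply: teich_uniq => //; first exact: expr1n.
by rewrite -opprB; apply: (P_N HP); apply: (Wa nu 1%N); rewrite expr1.
Qed.

(** This stands in for a primitive root modulo l: the lifts of 1, ..., l - 1 are distinct roots of
    X^d - 1, for d the gcd of e and l - 1, so that d is at least l - 1. *)
Lemma teich_order (e : nat) : (forall a, coprime a l -> P (a%:R ^+ e - 1)) -> (l.-1 %| e)%N.
Proof.
move=> He; pose d := gcdn e l.-1.
have d0 : (0 < d)%N by rewrite gcdn_gt0 l1 orbT.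
have ex (i : 'I_l.-1) : exists x : algC, x ^+ l.-1 = 1 /\ P (i.+1%:R - x).
  have [|x xl Px] := @teich_exists i.+1; last by exists x.
  rewrite coprime_sym prime_coprime // gtnNdvd //.
  by rewrite -[X in (_ < X)%N](prednK l0) ltnS.
have [f Hf] := choice ex.
have Af i : f i \in Aint by apply: (Aint_unity_root l1); apply/unity_rootP; have [] := Hf i.
have f_inj : injective f.
  move=> i j fij; have [[_ Pi] [_ Pj]] := (Hf i, Hf j).
  have : P (i.+1%:R - j.+1%:R).
    by rewrite -[i.+1%:R](subrK (f i)) -addrA fij; apply: (P_D HP); rewrite -?fij // -opprB; apply: (P_N HP); rewrite fij.
  wlog ij : i j fij Pi Pj / (i <= j)%N => [H|].
    have [/H|/ltnW/H H'] := leqP i j; first by apply.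
    by move=> Pij; apply/esym/H' => //; rewrite -opprB; apply: (P_N HP).
  rewrite -opprB => /(P_N HP); rewrite opprK -natrB ?ltnS // subSS => /(P_nat pl HP) d1.
  apply: val_inj; apply/eqP; rewrite eqn_leq ij /= -subn_eq0; apply/negPn/negP.
  rewrite -lt0n => ji; move: (dvdn_leq ji d1); rewrite leqNgt => /negP; apply.
  by apply: leq_ltn_trans (leq_subr _ _) _; apply: leq_trans (ltn_ord j) _; exact: leq_pred.
have fd i : f i ^+ d = 1.
  have [fl Pi] := Hf i.
  have fe : f i ^+ e = 1.
    apply: teich_uniq; rewrite ?expr1n //; first by rewrite exprAC fl expr1n.
    rewrite -[f i ^+ e](subrK (i.+1%:R ^+ e)) -addrA; apply: (P_D HP).
      apply: P_expB => //; rewrite ?rpred_nat // -opprB; exact: (P_N HP).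
    apply: He; rewrite coprime_sym prime_coprime // gtnNdvd //.
    by rewrite -[X in (_ < X)%N](prednK l0) ltnS.
  have [e0|e0] := posnP e; first by rewrite /d e0 gcd0n.
  have [u v Du _] := egcdnP l.-1 e0.
  have : f i ^+ (u * e) = f i ^+ d by rewrite Du exprD mulnC exprM fl expr1n mul1r.
  by rewrite mulnC exprM fe expr1n => <-.
have : (size (codom f) <= d)%N.
  apply: max_unity_roots => //; last by rewrite map_inj_uniq ?enum_uniq.
  by apply/allP => _ /codomP[i ->]; apply/unity_rootP.
rewrite size_codom card_ord => ld.
have : d == l.-1 by rewrite eqn_leq ld dvdn_leq // dvdn_gcdr.
by move/eqP <-; rewrite dvdn_gcdl.
Qed.
End Teichmuller.

(** * Tame ramification and its removal *)

Section Tame.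
Variables (l : nat) (P : algC -> Prop).
Hypotheses (pl : prime l) (HP : prime_ideal l P).
Variables (n : nat).
Hypothesis (ln : coprime l n).
Let n0 : (0 < n)%N.
Proof. by case: n ln => //; rewrite /coprime gcdn0 => /eqP l1; move: (prime_gt1 pl); rewrite l1. Qed.
Let l0 : (0 < l)%N. Proof. exact: prime_gt0. Qed.
Let l_neq0 : l%:R != 0 :> algC. Proof. by rewrite pnatr_eq0 -lt0n. Qed.

Lemma aut_Zring y (nu : Aut) k (x : algC) : nu y = y ^+ k -> Zring y x ->
  exists p : {poly int}, x = (pZtoC p).[y] /\ nu x = (pZtoC p).[y ^+ k].
Proof.
move=> ny [p Dx]; exists p; split=> //; rewrite Dx -ny -horner_map -map_poly_comp; congr _.[_].
by apply: eq_map_poly => c /=; rewrite rmorph_int.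
Qed.

(* Comparing the valuations of [nu w] and [w ^+ l] for a Frobenius [nu] at [l]. *)
Lemma frobenius_val c w y j : is_char n c -> attached n c w -> n.-primitive_root y ->
  hasval P (Zring y) l%:R (w ^+ n) j -> exists i : int, l.-1%:Z * j = n%:Z * i.
Proof.
move=> cc aw py [s [u [[Ss Ps] [Su Pu] e]]]; have [w0 cw] := aw.
have RS := Zring_sub n0 (prim_expr_order py).
have [nu Dnu] := Qn_aut_exists ln.
have ny : nu y = y ^+ l by apply: Dnu; exact: prim_expr_order.
have cg := attached_pow cc n0 aw Dnu; set g := nu w / w ^+ l in cg.
have g0 : g != 0 by rewrite mulf_neq0 ?invr_neq0 ?expf_neq0 ?fmorph_eq0.
have [k vk] := unram_val pl HP py ln g0 cg.
have nuS x : Zring y x -> ~ P x -> Zring y (nu x) /\ ~ P (nu x).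
  move=> Sx Px; have [p [Dx Dnx]] := aut_Zring ny Sx.
  split; first by rewrite Dnx; apply: Zring_horner; apply: (SX RS); exact: Zring_gen.
  have [t St et] := Frob_horner pl RS p (Zring_gen y).
  move=> Pn; apply: Px; rewrite Dx; apply: (P_Xinv HP (k := l)).
    by rewrite -Dx; exact: (SA RS).
  by rewrite et -Dnx; apply: (P_D HP) => //; apply: (P_Mr HP); [exact: (SA RS)|exact: P_l HP].
have v1 : hasval P (Zring y) l%:R (nu (w ^+ n)) j.
  exists (nu s), (nu u); split; [exact: nuS|exact: nuS|].
  by rewrite -rmorphM e rmorphM /= fmorphXz rmorph_nat.
have v2 : hasval P (Zring y) l%:R (nu (w ^+ n)) (k * n%:Z + j * l%:Z).
  have -> : nu (w ^+ n) = g ^+ n * (w ^+ n) ^+ l.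
    by rewrite /g expr_div_n -[_ ^+ l ^+ n]exprM mulnC exprM rmorphXn divfK // !expf_neq0.
  apply: (valM HP RS l_neq0); apply: (valXn HP RS l_neq0) => //.
  by exists s, u.
have := val_uniq HP RS l_neq0 (P_l HP) v1 v2 => ejk.
(* The two valuations give j = n k + l j. Thus j / n, the valuation of [w] at l, has a denominator
   dividing l - 1. *)
exists (- k); have -> : l.-1%:Z = l%:Z - 1 by rewrite predn_int.
by rewrite mulrBl mul1r mulrC {2}ejk; ring.
Qed.

Variable (z : algC).
Hypothesis pz : (n * l).-primitive_root z.
Let r := z ^+ n.
Let y := z ^+ l.
Let pi := 1 - r.
Let nl0 : (0 < n * l)%N. Proof. exact: prim_order_gt0 pz. Qed.
Let RS : subringP (Zring z). Proof. exact: Zring_sub nl0 (prim_expr_order pz). Qed.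
Let pr : l.-primitive_root r.
Proof. by have := exp_prim_root pz n; rewrite gcdnMr mulKn. Qed.
Let py : n.-primitive_root y.
Proof. by have := exp_prim_root pz l; rewrite gcdnMl mulnK. Qed.
Let pi0 : pi != 0. Proof. rewrite /pi /r; exact: (ram_pi_neq0 pl pz). Qed.
Let Ppi : P pi. Proof. exact: (ram_P_pi pl HP pz). Qed.
(* An automorphism fixing the n-th roots of unity acts trivially on Z[z] / P. *)
Lemma inertia_Zring (nu : Aut) x : fixU n nu -> Zring z x -> P (nu x - x).
Proof.
move=> fx Sx; have Sz : Zring z z by exact: Zring_gen.
have [k _ Dnu] := aut_root nu nl0.
have nz : nu z = z ^+ k by apply: Dnu; exact: prim_expr_order.
have [p [-> ->]] := aut_Zring nz Sx.
have [t St ->] := horner_diff p RS (SX RS k Sz) Sz.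
rewrite addrC addKr; apply: (P_Mr HP); first exact: (SA RS).
have k1 : k = 1 %[mod n].
  apply/eqP; rewrite -(eq_prim_root_expr py) expr1.
  by rewrite -[X in _ == X](fx y (prim_expr_order py)) /y rmorphXn nz -!exprM mulnC.
have -> : z ^+ k = z ^+ (k + n * l) by rewrite exprD (prim_expr_order pz) mulr1.
have [q Dq] : exists q, (k + n * l = 1 + q * n)%N.
  have k2 : (1 <= k + n * l)%N by rewrite ltn_addl.
  have : (n %| k + n * l - 1)%N.
    by rewrite -eqn_mod_dvd // -modnDmr modnMr addn0 k1.
  by move=> /dvdnP[q Dq]; exists q; rewrite -Dq subnKC.
rewrite Dq mulnC exprD expr1 exprM -/r -{2}[z]mulr1 -mulrBr; apply: (P_Ml HP); first exact: (SA RS).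
rewrite -opprB; apply: (P_N HP); rewrite /r ram_g; apply: (P_Mr HP) => //.
exact: (SA RS (ram_g_S pz _)).
Qed.

(** The tame character: [nu] multiplies [pi] by a unit congruent to a, hence pi^i by a^i modulo P,
    and fixes the unit part of [G] modulo P. *)
Lemma resolvent_congruence c G (i a : nat) (nu : Aut) : is_char n c -> attached n c G ->
  hasval P (Zring z) pi G i%:Z -> fixU n nu -> nu r = r ^+ a -> P (c nu - a%:R ^+ i).
Proof.
move=> cc [G0 cG] [s [u [[Ss Ps] [Su Pu] e]]] fx nr; have [_ cn _] := cc.
have Ac : c nu \in Aint by apply: (Aint_unity_root n0); apply/unity_rootP.
have [As Au] : s \in Aint /\ u \in Aint by split; exact: (SA RS).
pose g := \sum_(k < a) r ^+ k.
have Ag : g \in Aint by exact: (SA RS (ram_g_S pz _)).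
have npi : nu pi = pi * g by rewrite rmorphB rmorph1 nr ram_g.
have key : c nu * nu s * u = g ^+ i * nu u * s.
  have pG : pi ^+ i != 0 by rewrite expf_neq0.
  apply: (mulfI pG); rewrite -exprnP in e.
  have e2 : c nu * G * nu s = (pi * g) ^+ i * nu u.
    by rewrite -cG // -rmorphM e rmorphM rmorphXn /= npi.
  rewrite (_ : _ * (c nu * nu s * u) = c nu * nu s * (pi ^+ i * u)); last by ring.
  rewrite -e (_ : _ * (G * s) = c nu * G * nu s * s); last by ring.
  by rewrite e2 exprMn; ring.
have Pg : P (g ^+ i - a%:R ^+ i).
  by apply: (P_expB HP) => //; [exact: rpred_nat|exact: (ram_g_mod pl HP pz a)].
have Ps' := inertia_Zring fx Ss; have Pu' := inertia_Zring fx Su.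
have : P ((c nu - a%:R ^+ i) * (s * u)).
  have -> : (c nu - a%:R ^+ i) * (s * u) =
      (g ^+ i - a%:R ^+ i) * (s * u) + g ^+ i * (s * (nu u - u)) - c nu * (u * (nu s - s)).
    apply/eqP; rewrite -subr_eq0; apply/eqP.
    by transitivity (c nu * nu s * u - g ^+ i * nu u * s); [ring|rewrite key subrr].
  apply: (P_B HP); first (apply: (P_D HP)).
  - by apply: (P_Mr HP) => //; rewrite rpredM.
  - by apply: (P_Ml HP); [rewrite rpredX|exact: (P_Ml HP)].
  by apply: (P_Ml HP) => //; apply: (P_Ml HP).
move=> /(P_prime HP _ _)[||//|/(P_prime HP As Au)[]//].
- by rewrite rpredB ?rpredX ?rpred_nat.
- by rewrite rpredM.
Qed.

(** Powers of l are fixed by all automorphisms; they serve to make the exponent in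
    [resolvent_congruence] a natural number. *)
Lemma val_nonneg x j : hasval P (Zring z) pi x j ->
  exists k m : nat, hasval P (Zring z) pi (x * l%:R ^+ k) m%:Z.
Proof.
move=> vx; have vk k := valM HP RS pi0 vx (valXn HP RS pi0 k (ram_l pl HP pz)).
have l2 : (0 < l.-1)%N by rewrite -ltnS prednK ?prime_gt1.
exists `|j|%N; have := vk `|j|%N.
have [m ->] : exists m : nat, j + l.-1%:Z * `|j|%N = m%:Z.
  exists (absz (j + l.-1%:Z * `|j|%N)); nia.
by exists m.
Qed.
End Tame.

(** The resolvent [w] of [c] has an integral valuation i at [pi]. The twist is W^i1 with i1 = - i
    modulo l - 1; its resolvent has a valuation congruent to i1, so the product of both resolvents
    has a valuation divisible by l - 1, that is, an integral one at l. *)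
Lemma tame (PI : nat -> algC -> Prop) l n c : (forall l, prime l -> prime_ideal l (PI l)) ->
  prime l -> coprime l n -> is_char n c ->
  exists d, [/\ is_char n d, forall nu, fixU l nu -> d nu = 1 & UR PI l (fun nu => c nu * d nu)].
Proof.
move=> HPI pl co cc; have HP := HPI _ pl; set P := PI l in HP.
have n0 := coprime_gt0 pl co; have l0 := prime_gt0 pl.
have l_neq0 : l%:R != 0 :> algC by rewrite pnatr_eq0 -lt0n.
have nl0 : (0 < n * l)%N by rewrite muln_gt0 n0.
have [z pz] := C_prim_root_exists nl0; pose r := z ^+ n; pose y := z ^+ l; pose pi := 1 - r.
have pr : l.-primitive_root r by have := exp_prim_root pz n; rewrite gcdnMr mulKn.
have py : n.-primitive_root y by have := exp_prim_root pz l; rewrite gcdnMl mulnK.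
have pi0 : pi != 0 by exact: (ram_pi_neq0 pl pz).
have RS := Zring_sub nl0 (prim_expr_order pz).
have RSy := Zring_sub n0 (prim_expr_order py).
have [w w0 cw] := Hilbert90 n0 cc; have aw : attached n c w by [].
have [|j vj] := unram_val pl HP py co _ (attached_Cyc cc aw); first by rewrite expf_neq0.
have [i ei] := frobenius_val pl HP co cc aw py vj.
have [W [cW W_mod]] := teich_char pl HP pr.
have [WM Wl _] := cW; have l1 : (0 < l.-1)%N by rewrite -ltnS prednK ?prime_gt1.
have W0 nu : W nu != 0 by exact: (char_neq0 l1 cW).
pose i1 := `|((- i) %% l.-1%:Z)%Z|%N.
have Di1 : exists q, i1%:Z = q * l.-1%:Z - i.
  exists (- ((- i) %/ l.-1%:Z)%Z).
  have l1z : l.-1%:Z != 0 by rewrite eqz_nat -lt0n.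
  rewrite /i1 gez0_abs ?modz_ge0 //.
  rewrite mulNr; move: (divz_eq (- i) l.-1%:Z); move: (_ * l.-1%:Z) (_ %% _)%Z => a b; lia.
have [q1 eq1] := Di1.
pose d (nu : Aut) := W nu ^+ i1.
(* From (l - 1) j = n i, the exponent i1 n is a multiple of l - 1. *)
have dn nu : d nu ^+ n = 1.
  rewrite /d -exprM; have : (i1 * n)%:Z = (q1 * n%:Z - j) * l.-1%:Z.
    by rewrite PoszM eq1 mulrBl [i * _]mulrC -ei; ring.
  move/(congr1 absz); rewrite absz_nat abszM absz_nat => ->.
  by rewrite mulnC exprM Wl expr1n.
have cd : is_char n d.
  apply: is_char_dvd dn; exact: (is_charX i1 cW).
have W1 nu : fixU l nu -> W nu = 1.
  move=> fx; apply: (teich_uniq pl HP) => //; first exact: expr1n.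
  rewrite -opprB; apply: (P_N HP); apply: (W_mod nu 1%N).
  by rewrite expr1 fx // (prim_expr_order pr).
exists d; split=> // [nu /W1|]; first by rewrite /d => ->; rewrite expr1n.
have [G G0 dG] := Hilbert90 n0 cd; have aG : attached n d G by [].
have CG : Cyc (n * l) G.
  move=> nu fx; rewrite dG ?/d ?W1 ?expr1n ?mul1r //; apply: fixU_dvd fx; [exact: dvdn_mull|exact: dvdn_mulr].
have [i2 vG] := ram_val pl HP pz co G0 CG.
have [k [m vGk]] := val_nonneg pl HP co pz vG.
have al k' : attached n (fun=> 1) (l%:R ^+ k').
  by split=> [|nu _]; rewrite ?expf_neq0 // rmorphXn rmorph_nat mul1r.
have aGk : attached n d (G * l%:R ^+ k).
  have := attachedM aG (al k); congr attached; apply/funext => nu; exact: mulr1.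
(* d nu = W nu ^ i1 = a ^ m mod P, where a = W nu mod P *)
have dm : (l.-1 %| i1 + (l.-2 * m))%N.
  apply: (teich_order pl HP) => a ca.
  have [nu [fx nua]] := aut_crt co ca l0 n0.
  have nr : nu r = r ^+ a by apply: nua; exact: (prim_expr_order pr).
  have := resolvent_congruence pl HP co pz cd aGk vGk fx nr; rewrite -/P => Pd.
  have Pa := W_mod _ _ nr.
  have AW : W nu \in Aint by apply: (Aint_unity_root l1); apply/unity_rootP.
  have Aa : a%:R \in Aint by rewrite rpred_nat.
  have Pa1 : P (a%:R ^+ i1 - a%:R ^+ m).
    rewrite -[a%:R ^+ i1](subrK (d nu)) -addrA; apply: (P_D HP) => //.
    exact: (P_expB HP).
  have Pal : P (a%:R ^+ l.-1 - 1).
    by rewrite -[X in _ - X](Wl nu); apply: (P_expB HP).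
  have -> : a%:R ^+ (i1 + l.-2 * m) - 1 =
     (a%:R ^+ i1 - a%:R ^+ m) * a%:R ^+ (l.-2 * m) + ((a%:R ^+ l.-1) ^+ m - 1 ^+ m) :> algC.
    have D : (l.-1 * m = m + l.-2 * m)%N by rewrite -mulSn prednK.
    by rewrite expr1n -exprM D !exprD; ring.
  apply: (P_D HP); last by apply: (P_expB HP) => //; rewrite rpredX.
  by apply: (P_Mr HP) => //; rewrite rpredX.
have [q2 eq2] : exists q2, i + m%:Z = q2 * l.-1%:Z.
  move/dvdnP: dm => [q2 eq2]; exists (q1 + m%:Z - q2%:Z).
  have e1 : l.-1 = l.-2.+1 by rewrite prednK.
  move: eq1 eq2; rewrite e1 /=; nia.
have vl := val_Aint RS (ram_l pl HP pz).
have [change1 _] := val_change (w ^+ n) j 0 HP subring_Aint pi0 l_neq0 vl.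
have vw : hasval P (fun x => x \in Aint) pi w i.
  apply: (val_root HP pi0 n0); rewrite mulrC -ei; apply: change1.
  exact: val_Aint vj.
exists n, (w * (G * l%:R ^+ k)); split=> //.
  exact: attachedM.
have [_ change2] := val_change (w * (G * l%:R ^+ k)) 0 q2 HP subring_Aint pi0 l_neq0 vl.
exists q2; apply: change2; rewrite [l.-1%:Z * _]mulrC -eq2; apply: (valM HP subring_Aint pi0) => //.
exact: val_Aint vGk.
Qed.

(** * Minkowski's theorem on linear forms *)

Lemma card_dffun n (k : 'I_n -> nat) : #|{dffun forall i : 'I_n, 'I_(k i)}| = (\prod_(i < n) k i)%N.
Proof.
rewrite card_dep_ffun foldrE big_image /=.
by apply: eq_bigr => i _; rewrite card_ord.
Qed.

(** The box of sides k_i holds more integer points than there are classes modulo the image of [Z],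
    so two of its points differ by some Z m. The Smith normal form tells the classes apart, by
    remainders modulo the d_i. *)
Lemma lattice_pigeonhole n (Z : 'M[int]_n) (k : 'I_n -> nat) :
  \det Z != 0 -> (`|\det Z| < \prod_(i < n) k i)%N ->
  exists2 m : 'cV[int]_n, m != 0 & forall i, (`|(Z *m m) i ord0| < k i)%N.
Proof.
move=> Z0; have [L uL [R uR [d _ DZ]]] := int_Smith_normal_form Z.
set D := \matrix_(i, j) _ in DZ.
have Dd : D = diag_mx (\row_i d`_i).
  by apply/matrixP=> i j; rewrite !mxE.
have detD : \det D = \prod_(i < n) d`_i.
  by rewrite Dd det_diag; apply: eq_bigr => i _; rewrite mxE.
have absu M : M \in unitmx -> `|\det M|%N = 1%N :> nat.
  rewrite unitmxE => /mulrV/(congr1 absz)/eqP.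
  by rewrite abszM muln_eq1 => /andP[/eqP].
have adet : `|\det Z|%N = (\prod_(i < n) `|(d`_i)%R|)%N.
  rewrite DZ !det_mulmx !abszM (absu _ _ uL) (absu _ _ uR) mul1n muln1 detD.
  by rewrite (big_morph absz abszM (erefl _)).
have d0 (i : 'I_n) : d`_i != 0.
  apply: contraNneq Z0 => di; rewrite DZ !det_mulmx detD (bigD1 i) //= di mul0r mulr0 mul0r //.
rewrite adet -card_dffun => lt.
pose u (x : {dffun forall i : 'I_n, 'I_(k i)}) : 'cV[int]_n := \col_i (x i : nat)%:Z.
have bnd x i : (`|((invmx L *m u x) i ord0 %% d`_i)%Z| < `|(d`_i)%R|)%N.
  by rewrite -ltz_nat gez0_abs ?modz_ge0 ?d0 // ltz_mod ?d0.
pose g x : {dffun forall i : 'I_n, 'I_(`|(d`_i)%R|%N)} := [ffun i => Ordinal (bnd x i)].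
have : ~ injective g.
  by move=> /leq_card; rewrite leqNgt [X in (_ < X)%N]card_dffun lt.
move=> ninj; have [x [x' [xx' gxx']]] : exists x x', x != x' /\ g x = g x'.
  apply: contrapT => no; apply: ninj => x x' e; apply/eqP/negPn/negP => ne.
  by apply: no; exists x, x'.
have dv i : (d`_i %| (invmx L *m (u x - u x')) i ord0)%Z.
  have -> : (invmx L *m (u x - u x')) i ord0 = (invmx L *m u x) i ord0 - (invmx L *m u x') i ord0.
    by rewrite mulmxBr !mxE.
  rewrite -eqz_mod_dvd.
  have /ffunP/(_ i) := gxx'; rewrite !ffunE => /(congr1 val) /= e.
  by rewrite -[X in X == _]gez0_abs ?modz_ge0 ?d0 // -[X in _ == X]gez0_abs ?modz_ge0 ?d0 // e.
pose t : 'cV[int]_n := \col_i (((invmx L *m (u x - u x')) i ord0) %/ d`_i)%Z.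
have Dt : D *m t = invmx L *m (u x - u x').
  apply/colP=> i; rewrite Dd mul_diag_mx !mxE mulrC divzK //.
  by have := dv i; rewrite mxE.
pose m := invmx R *m t.
have Zm : Z *m m = u x - u x'.
  by rewrite DZ /m -!mulmxA mulKVmx // Dt mulKVmx.
exists m.
  apply: contraNneq xx' => m0; apply/eqP/ffunP => i; apply: val_inj.
  move: Zm; rewrite m0 mulmx0 => /esym/eqP; rewrite subr_eq0 => /eqP/colP/(_ i).
  by rewrite !mxE => -[].
move=> i; rewrite Zm !mxE.
have := ltn_ord (x i); have := ltn_ord (x' i).
by move: (nat_of_ord (x i)) (nat_of_ord (x' i)) => a b; lia.
Qed.

Section Approx.
Variable F : archiRealFieldType.

Lemma prod_diff I (r : seq I) (a b : I -> F) M e : 1 <= M -> 0 <= e ->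
  (forall i, `|a i| <= M) -> (forall i, `|b i| <= M) -> (forall i, `|a i - b i| <= e) ->
  `|\prod_(i <- r) a i - \prod_(i <- r) b i| <= (size r)%:R * M ^+ size r * e.
Proof.
move=> M1 e0 aM bM ab; have M0 : 0 <= M by apply: le_trans M1.
have pM (c : I -> F) s : (forall i, `|c i| <= M) -> `|\prod_(i <- s) c i| <= M ^+ size s.
  move=> cM; elim: s => [|i s IH]; first by rewrite big_nil normr1.
  by rewrite big_cons normrM exprS ler_pM.
elim: r => [|i r IH]; first by rewrite !big_nil subrr normr0 !mul0r.
rewrite !big_cons /=.
have -> : a i * \prod_(j <- r) a j - b i * \prod_(j <- r) b j =
   (a i - b i) * \prod_(j <- r) a j + b i * (\prod_(j <- r) a j - \prod_(j <- r) b j) by ring.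
apply: le_trans (ler_normD _ _) _; rewrite !normrM.
have h1 : `|a i - b i| * `|\prod_(j <- r) a j| <= e * M ^+ size r by rewrite ler_pM ?pM.
have h2 : `|b i| * `|\prod_(j <- r) a j - \prod_(j <- r) b j| <= M * ((size r)%:R * M ^+ size r * e).
  by rewrite ler_pM.
apply: le_trans (lerD h1 h2) _; rewrite -natr1 exprS.
have h3 : e * M ^+ size r <= e * (M * M ^+ size r).
  by rewrite ler_wpM2l // ler_peMl ?exprn_ge0.
apply: le_trans (lerD h3 (lexx _)) _; rewrite le_eqVlt; apply/orP; left; apply/eqP; ring.
Qed.

(** The constant is crude; only the linear dependence on [e] matters. *)
Lemma det_diff n (A B : 'M[F]_n) M e : 1 <= M -> 0 <= e ->
  (forall i j, `|A i j| <= M) -> (forall i j, `|B i j| <= M) -> (forall i j, `|A i j - B i j| <= e) ->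
  `|\det A - \det B| <= #|{perm 'I_n}|%:R * (n%:R * M ^+ n) * e.
Proof.
move=> M1 e0 AM BM AB; rewrite /determinant -sumrB.
apply: le_trans (ler_norm_sum _ _ _) _.
apply: le_trans (_ : \sum_(s : {perm 'I_n}) (n%:R * M ^+ n) * e <= _).
  apply: ler_sum => s _; rewrite -mulrBr normrM normrX normrN1 expr1n mul1r.
  have := @prod_diff _ (index_enum 'I_n) (fun i => A i (s i)) (fun i => B i (s i)) M e M1 e0.
  by rewrite [size _](_ : _ = n) ?/index_enum ?size_enum_ord -?enumT ?size_enum_ord //; apply.
by rewrite sumr_const -[leRHS]mulrA -[leLHS]mulr_natl.
Qed.

Lemma finite_gap (X : finType) (Q : pred X) (g : X -> F) :
  (forall x, Q x -> 1 < g x) -> exists2 e, 0 < e & forall x, Q x -> 1 + e <= g x.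
Proof.
move=> H; exists (\big[Num.min/1]_(x | Q x) (g x - 1)).
  by elim/big_ind: _ => // [x y x0 y0|x /H]; rewrite ?lt_min ?x0 ?subr_gt0.
by move=> x Qx; rewrite -lerBrDl; apply: bigmin_le_cond.
Qed.

Variables (n : nat) (A : 'M[F]_n).
Hypothesis detA : `|\det A| = 1.
Let Am (m : 'cV[int]_n) (i : 'I_n) : F := \sum_j A i j * (m j ord0)%:~R.

(* Approximating A by the integer matrix floor (T A) and applying the pigeonhole. *)
Lemma linear_forms_approx (i0 : 'I_n) : exists B : nat, forall e, 0 < e -> e <= 1 ->
  exists m : 'cV[int]_n, [/\ m != 0, forall j, (`|m j ord0| <= B)%N, `|Am m i0| < 1 + e
     & forall i, i != i0 -> `|Am m i| < 1].
Proof.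
have n0 : (0 < n)%N by apply: leq_ltn_trans (ltn_ord i0).
pose M : F := 2 + \sum_i \sum_j `|A i j|.
have AM i j : `|A i j| <= M - 2.
  have -> : M - 2 = \sum_i \sum_j `|A i j| by rewrite /M addrAC subrr add0r.
  rewrite (bigD1 i) //= (bigD1 j) //= -addrA ler_wpDr // addr_ge0 // ?sumr_ge0 //.
  by move=> k _; apply: sumr_ge0.
pose C : F := #|{perm 'I_n}|%:R * (n%:R * M ^+ n).
pose a : F := \sum_j \sum_i `|invmx A j i|.
have a0 : 0 <= a by do 2!(apply: sumr_ge0 => ? _).
exists (Num.bound (4 * a)) => e e0 e1.
pose d := e / (4 * n%:R).
have n1 : 1 <= n%:R :> F by rewrite ler1n.
have d0 : 0 < d by rewrite divr_gt0 // mulr_gt0 // ltr0n.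
have de : 4 * n%:R * d = e by rewrite /d mulrC divfK // mulf_neq0 // pnatr_eq0 -lt0n.
have d4 : 4 * d <= e by rewrite -de mulrAC ler_peMr // mulr_ge0 // ltW.
(* The side 1 + e / 2 at [i0] outweighs the n - 1 sides 1 - d, for d = e / (4 n): the volume is at
   least 1 + d, more than the determinant of the approximating matrix. *)
pose c i := if i == i0 then 1 + e / 2 else 1 - d.
have c0 i : 0 <= c i by rewrite /c; case: ifP => _; lra.
have bern k : (k <= n)%N -> 1 - k%:R * d <= (1 - d) ^+ k.
  elim: k => [|k IH] kn; first by rewrite mul0r subr0 expr0.
  have k0 : 0 <= k%:R :> F by [].
  have /IH := ltnW kn; rewrite exprS -natr1 => IHk.
  have d1 : 0 <= 1 - d by lra.
  apply: le_trans (ler_wpM2l d1 IHk); nra.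
have prodc : 1 + d <= \prod_i c i.
  rewrite (bigD1 i0) //= {1}/c eqxx.
  rewrite (eq_bigr (fun=> 1 - d)) => [|i /negPf ii0]; last by rewrite /c ii0.
  rewrite prodr_const cardC1 card_ord.
  have := bern n.-1 (leq_pred _); set y := (1 - d) ^+ _.
  have -> : n.-1%:R = n%:R - 1 :> F by rewrite -subn1 natrB.
  nra.
(* [T] is the precision: C / T bounds the error on the determinant and 4 a / T the error on the
   forms, both less than d. *)
have [T [T0 TC Ta]] : exists T : nat, [/\ 0 < T%:R :> F, C < T%:R * d & 4 * a < T%:R * d].
  exists (Num.bound ((C + 4 * a) / d)); set T := Num.bound _.
  have M0 : 0 <= M by have := AM i0 i0; have := normr_ge0 (A i0 i0); lra.
  have C0 : 0 <= C by rewrite !mulr_ge0 // exprn_ge0.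
  have : (C + 4 * a) / d < T%:R.
    rewrite archi_boundP //; apply: divr_ge0; last exact: ltW.
    by apply: addr_ge0 => //; apply: mulr_ge0.
  rewrite ltr_pdivrMr // => h; split; [|lra|lra].
  have : 0 < T%:R * d by apply: le_lt_trans h; lra.
  by rewrite pmulr_lgt0.
have T1 : T%:R^-1 <= 1 :> F.
  rewrite invf_le1 // ler1n; case: (T) T0 => //; rewrite ltxx //.
pose Z : 'M[int]_n := \matrix_(i, j) Num.floor (T%:R * A i j).
pose Z' : 'M[F]_n := map_mx intr Z.
pose A' := T%:R^-1 *: Z'.
have AA' i j : `|A i j - A' i j| <= T%:R^-1.
  have -> : A i j - A' i j = T%:R^-1 * (T%:R * A i j - (Num.floor (T%:R * A i j))%:~R).
    by rewrite !mxE mulrBr mulKf // lt0r_neq0.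
  rewrite normrM gtr0_norm ?invr_gt0 //.
  rewrite ler_piMr ?invr_ge0 ?ltW //.
  have := floor_le (T%:R * A i j); have := floorD1_gt (T%:R * A i j).
  rewrite intrD mulr1z => h1 h2; rewrite ger0_norm; lra.
have A'M i j : `|A' i j| <= M.
  have := AA' i j; have := AM i j; have := ler_distD (A i j) (A' i j) 0; rewrite !subr0 distrC.
  lra.
have M1 : 1 <= M by have := AM i0 i0; have := normr_ge0 (A i0 i0); lra.
have dd := @det_diff _ A A' M T%:R^-1 M1 _ _ A'M AA'.
have {}dd : `|\det A - \det A'| < d.
  apply: le_lt_trans (dd _ _) _; first by rewrite invr_ge0; apply: ltW.
    by move=> i j; have := AM i j; lra.
  by rewrite -/C ltr_pdivrMr // [d * _]mulrC.
have detZ : \det A' * T%:R ^+ n = (\det Z)%:~R.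
  by rewrite detZ mulrAC -exprMn mulVf ?lt0r_neq0 // expr1n mul1r det_map_mx.
have hA' : `|\det A'| < 1 + d /\ 0 < `|\det A'|.
  have := ler_distD (\det A') (\det A) 0; have := ler_distD (\det A) (\det A') 0.
  rewrite !subr0 detA (distrC (\det A')) => h1 h2; lra.
pose k i := (absz (Num.floor (T%:R * c i))).+1.
have kE i : (absz (Num.floor (T%:R * c i)))%:R = (Num.floor (T%:R * c i))%:~R :> F.
  by rewrite pmulrn gez0_abs // floor_ge0; apply: mulr_ge0 => //; apply: ltW.
have [||m m0 mk] := @lattice_pigeonhole n Z k.
- rewrite -(intr_eq0 F) -detZ; apply: mulf_neq0; first by rewrite -normr_gt0; case: hA'.
  by rewrite expf_neq0 // lt0r_neq0.
- rewrite -(ltr_nat F) natr_prod -[_%:R]/((_ %:Z)%:~R) abszE intr_norm -detZ normrM.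
  rewrite (@ger0_norm _ (_ ^+ n)) ?exprn_ge0 ?ltW //.
  apply: lt_le_trans (_ : (1 + d) * T%:R ^+ n <= _).
    by rewrite ltr_pM2r ?exprn_gt0 //; case: hA'.
  apply: le_trans (_ : \prod_i (c i * T%:R) <= _).
    by rewrite big_split /= prodr_const card_ord ler_wpM2r ?exprn_ge0 // ltW.
  apply: ler_prod => i _; apply/andP; split; first by apply: mulr_ge0 => //; apply: ltW.
  rewrite /k -natr1 kE; have := floorD1_gt (T%:R * c i); rewrite intrD mulr1z mulrC; lra.
pose s : F := \sum_j `|m j ord0|%:~R.
have s0 : 0 <= s by apply: sumr_ge0 => j _; rewrite ler0z.
have mi i : `|Am m i| <= c i + s / T%:R.
  have -> : Am m i = ((Z *m m) i ord0)%:~R / T%:R + \sum_j (A i j - A' i j) * (m j ord0)%:~R.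
    rewrite mxE rmorph_sum mulr_suml -big_split /=; apply: eq_bigr => j _.
    by rewrite rmorphM !mxE; field; rewrite lt0r_neq0.
  apply: le_trans (ler_normD _ _) _; apply: lerD.
    rewrite normrM normfV (gtr0_norm T0) ler_pdivrMr // -intr_norm -abszE.
    have := mk i; rewrite /k ltnS -(ler_nat F) kE => h; apply: le_trans (h) _.
    by rewrite mulrC floor_le.
  rewrite /s mulr_suml; apply: le_trans (ler_norm_sum _ _ _) _.
  by apply: ler_sum => j _; rewrite normrM mulrC -intr_norm ler_wpM2l // ler0z.
have c2 i : c i <= 2 by rewrite /c; case: ifP => _; lra.
(* Inverting [A] bounds [m] by 4 a whatever [e] is; the limit taken in [linear_forms] rests on
   this. *)
have sb : s <= 4 * a.
  have uA : A \in unitmx by rewrite unitmxE unitfE -normr_eq0 detA oner_eq0.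
  have : s <= a * (2 + s / T%:R).
    rewrite /s /a mulr_suml; apply: ler_sum => j _.
    have -> : (`|m j ord0|%:~R : F) = `|\sum_i invmx A j i * Am m i|.
      rewrite intr_norm; congr `|_|.
      have := mulKmx uA (map_mx intr m) => /matrixP/(_ j ord0); rewrite !mxE => <-.
      apply: eq_bigr => i _; rewrite !mxE; congr (_ * _).
      by apply: eq_bigr => i' _; rewrite mxE.
    apply: le_trans (ler_norm_sum _ _ _) _; rewrite mulr_suml; apply: ler_sum => i _.
    rewrite normrM ler_wpM2l //; apply: le_trans (mi i) _; by rewrite lerD2r.
  have d1 : d <= 1 by lra.
  have sT : s / T%:R * T%:R = s by rewrite divfK // lt0r_neq0.
  have x0 : 0 <= s / T%:R by rewrite divr_ge0 // ltW.
  have T4 : 4 * a <= T%:R.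
    apply: le_trans (ltW Ta) _; rewrite ler_piMr //; exact: ltW.
  have := ler_wpM2r x0 T4; rewrite [T%:R * _]mulrC sT; lra.
have sTd : s / T%:R < d by rewrite ltr_pdivrMr // mulrC; lra.
exists m; split=> //.
- move=> j; rewrite -(ler_nat F).
  have mjs : (absz (m j ord0))%:R <= s.
    rewrite /s (bigD1 j) //= pmulrn abszE ler_wpDr //.
    by apply: sumr_ge0 => i _; rewrite ?ler0z.
  apply: le_trans mjs _; apply: le_trans sb _; apply: ltW.
  by rewrite archi_boundP // mulr_ge0.
- by have := mi i0; rewrite {1}/c eqxx => h; lra.
by move=> i /negPf ii0; have := mi i; rewrite {1}/c ii0 => h; lra.
Qed.

(** As [B] does not depend on [e], finitely many [m] compete. If all those within the strict bounds
    had a form at [i0] greater than 1, these forms would be at least 1 + e for a common e > 0,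
    against the approximate version. *)
Lemma linear_forms (i0 : 'I_n) : exists m : 'cV[int]_n,
  [/\ m != 0, `|Am m i0| <= 1 & forall i, i != i0 -> `|Am m i| < 1].
Proof.
have [B HB] := linear_forms_approx i0; apply: contrapT => no.
(* The shift by [B] enumerates the vectors with entries between - B and B. *)
pose dec (f : {ffun 'I_n -> 'I_(B.*2).+1}) : 'cV[int]_n := \col_i ((f i : nat)%:Z - B%:Z).
pose Q (f : {ffun 'I_n -> 'I_(B.*2).+1}) :=
  (dec f != 0) && [forall i, (i != i0) ==> (`|Am (dec f) i| < 1)].
have [f /andP[f0 /forallP fQ]|e e0 He] := @finite_gap _ Q (fun f => `|Am (dec f) i0|).
  rewrite ltNge; apply/negP => f1; apply: no; exists (dec f); split=> // i i0'.
  by have := fQ i; rewrite i0'.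
have [||m [m0 mB mi0 mi]] := HB (Num.min e 1).
- by rewrite lt_min e0 ltr01.
- by rewrite ge_min lexx orbT.
pose f : {ffun 'I_n -> 'I_(B.*2).+1} := [ffun i => inord (absz (m i ord0 + B%:Z))].
have Df : dec f = m.
  by apply/colP=> i; rewrite mxE ffunE inordK; have := mB i; rewrite !ord1; lia.
have /He : Q f by rewrite /Q Df m0; apply/forallP => i; apply/implyP; exact: mi.
by rewrite Df leNgt => /negP; apply; apply: lt_le_trans mi0 _; rewrite lerD2l ge_min lexx.
Qed.
End Approx.

Lemma linear_forms_algC n (M : 'M[algC]_n) (i0 : 'I_n) :
  (forall i j, M i j \is Num.real) -> \det M ^+ 2 = 1 ->
  exists m : 'cV[int]_n, [/\ m != 0, `|\sum_j M i0 j * (m j ord0)%:~R| <= 1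
    & forall i, i != i0 -> `|\sum_j M i j * (m j ord0)%:~R| < 1].
Proof.
move=> Mreal d2.
pose A : 'M[algR]_n := \matrix_(i, j) in_algR (Mreal i j).
have MA : M = map_mx (@algRval) A by apply/matrixP=> i j; rewrite !mxE.
have e : \det A ^+ 2 = 1.
  by apply: (fmorph_inj algRval); rewrite rmorphXn /= -det_map_mx -MA d2.
have detA : `|\det A| = 1.
  by apply/eqP; rewrite -sqrp_eq1 // real_normK ?num_real // e.
have [m [m0 m1 m2]] := linear_forms detA i0; exists m.
have E i : `|\sum_j M i j * (m j ord0)%:~R| = algRval `|\sum_j A i j * (m j ord0)%:~R|.
  congr `|_|; rewrite rmorph_sum; apply: eq_bigr => j _.
  by rewrite rmorphM rmorph_int !mxE.
by split=> // [|i /m2]; rewrite E.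
Qed.

(** * Independence of embeddings modulo a prime, and discriminants *)

Section Dedekind.
Variables (l : nat) (P : algC -> Prop).
Hypotheses (pl : prime l) (HP : prime_ideal l P).
Variables (O : algC -> Prop) (n : nat) (F : 'I_n -> Aut).
Hypotheses (RO : subringP O).
Hypothesis Fneq : forall i j, i != j -> exists2 x, O x & ~ P (F i x - F j x).

(** Dedekind's proof of the independence of characters, modulo P: a relation taken at x y minus F(y)
    times the relation at x has one term fewer. *)
Lemma dedekind_mod r (e : 'I_r -> 'I_n) (c : 'I_r -> algC) : injective e ->
  (forall i, c i \in Aint) -> (forall x, O x -> P (\sum_i c i * F (e i) x)) -> forall i, P (c i).
Proof.
elim: r e c => [|r IH] e c inj Ac Pc; first by case.
have AF i x : O x -> F i x \in Aint by move=> Ox; rewrite Aint_aut; exact: (SA RO).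
have Plift i : P (c (lift ord0 i)).
  have ne : e (lift ord0 i) != e ord0 by rewrite (inj_eq inj) eq_sym neq_lift.
  have [y Oy nPy] := Fneq ne.
  pose c' (k : 'I_r) := c (lift ord0 k) * (F (e (lift ord0 k)) y - F (e ord0) y).
  have inj' : injective (e \o lift ord0) by move=> a b /= /inj/lift_inj.
  have Ac' k : c' k \in Aint by rewrite rpredM ?rpredB ?AF.
  have Pc' x : O x -> P (\sum_k c' k * F ((e \o lift ord0) k) x).
    move=> Ox; have h1 := Pc _ (SM RO Ox Oy); have h2 := P_Mr HP (AF (e ord0) _ Oy) (Pc _ Ox).
    have := P_B HP h1 h2; rewrite !big_ord_recl mulrDl opprD addrACA.
    rewrite rmorphM /= mulrA subrr add0r mulr_suml -sumrB; congr P.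
    by apply: eq_bigr => j _ /=; rewrite /c' rmorphM /=; ring.
  have := P_prime HP _ _ (IH _ _ inj' Ac' Pc' i) => -[||//|//] //.
  by rewrite rpredB ?AF.
move=> i; case: (unliftP ord0 i) => [j ->//|->].
have := Pc 1 (S1 RO); rewrite big_ord_recl rmorph1 mulr1 => h.
have h2 : P (\sum_(j < r) c (lift ord0 j) * F (e (lift ord0 j)) 1).
  by apply: (P_sum HP) => j _; rewrite rmorph1 mulr1.
by rewrite -[c ord0](addrK (\sum_(j < r) c (lift ord0 j) * F (e (lift ord0 j)) 1)); apply: (P_B HP).
Qed.

Lemma det_Aint r (M : 'M[algC]_r) : (forall i j, M i j \in Aint) -> \det M \in Aint.
Proof.
move=> AM; rewrite rpred_sum // => s _; rewrite rpredM ?rpredX ?rpredN ?rpred1 //.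
by rewrite rpred_prod.
Qed.

(** Expansion along the first column, left free, gives a relation between the embeddings whose
    coefficients are cofactors; the inductive hypothesis keeps one of them out of P. *)
Lemma dedekind_det r (e : 'I_r -> 'I_n) : injective e ->
  exists x : 'I_r -> algC, (forall j, O (x j)) /\ ~ P (\det (\matrix_(i, j) F (e i) (x j))).
Proof.
elim: r e => [|r IH] e inj; first by exists (fun=> 0); split; [case|rewrite det_mx00; exact: P_1 HP].
have AF i x : O x -> F i x \in Aint by move=> Ox; rewrite Aint_aut; exact: (SA RO).
have [|x' [Ox' nP]] := IH (e \o lift ord0); first by move=> a b /= /inj/lift_inj.
pose X x (j : 'I_r.+1) := oapp x' x (unlift ord0 j).
pose M x := \matrix_(i < r.+1, j < r.+1) F (e i) (X x j).
have cof x i : cofactor (M x) i ord0 = cofactor (M 0) i ord0.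
  rewrite /cofactor; congr (_ * \det _); apply/matrixP=> a b; rewrite !mxE.
  by rewrite /X liftK.
apply: contrapT => no.
have PM x : O x -> P (\sum_i cofactor (M 0) i ord0 * F (e i) x).
  move=> Ox; apply: contrapT => nPM; apply: no; exists (X x); split.
    by move=> j; rewrite /X; case: unliftP => [k _|_] /=.
  move: nPM; rewrite (expand_det_col _ ord0); apply: contra_not; congr P.
  apply: eq_bigr => i _; rewrite -/(M x) cof mxE /X unlift_none /= mulrC //.
have Ac i : cofactor (M 0) i ord0 \in Aint.
  rewrite /cofactor rpredM ?rpredX ?rpredN ?rpred1 // det_Aint // => a b.
  by rewrite !mxE /X liftK /= AF.
have := dedekind_mod inj Ac PM ord0; rewrite /cofactor expr0 mul1r; apply: contra_not nP.
by congr P; congr (\det _); apply/matrixP=> a b; rewrite !mxE /X liftK.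
Qed.
End Dedekind.

Section Minkowski.
Variables (n : nat) (O : algC -> Prop) (F : 'I_n -> Aut).
Hypotheses (n_gt1 : (1 < n)%N) (RO : subringP O).
Hypothesis Fperm : forall nu : Aut, exists s : {perm 'I_n}, forall i x, O x -> nu (F i x) = F (s i) x.
Hypothesis Freal : forall i x, O x -> F i x \is Num.real.
Hypothesis Funr : forall l, prime l -> exists P, prime_ideal l P /\
  forall i j, i != j -> exists2 x, O x & ~ P (F i x - F j x).

Let M (w : 'I_n -> algC) : 'M[algC]_n := \matrix_(i, j) F i (w j).

Let M_Aint w : (forall j, O (w j)) -> \det (M w) \in Aint.
Proof. by move=> Ow; apply: det_Aint => i j; rewrite mxE Aint_aut; exact: (SA RO). Qed.

Let M_aut (nu : Aut) w : (forall j, O (w j)) -> exists s : {perm 'I_n}, map_mx nu (M w) = row_perm s (M w).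
Proof.
move=> Ow; have [s Ds] := Fperm nu; exists s.
by apply/matrixP=> i j; rewrite !mxE Ds.
Qed.

(** An automorphism permutes the rows, and the square forgets the sign; real embeddings make the
    square nonnegative. *)
Lemma disc_nat w : (forall j, O (w j)) -> exists d : nat, \det (M w) ^+ 2 = d%:R.
Proof.
move=> Ow; have : \det (M w) ^+ 2 \in Num.nat.
  rewrite natrEint; apply/andP; split.
    apply: Cint_rat_Aint; last by rewrite rpredX ?M_Aint.
    apply: Crat_fixed => nu; rewrite rmorphXn /= -det_map_mx.
    have [s ->] := M_aut nu Ow; rewrite row_permE det_mulmx det_perm exprMn -exprM mulnC exprM.
    by rewrite sqrrN expr1n expr1n mul1r.
  rewrite -realEsqr; rewrite rpred_sum // => s _; rewrite rpredM ?rpredX ?rpredN ?rpred1 //.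
  by rewrite rpred_prod // => i _; rewrite mxE Freal.
by move/natrP=> [d ->]; exists d.
Qed.

Definition is_disc d := exists w, [/\ forall j, O (w j), \det (M w) ^+ 2 = d%:R & d != 0%N].

(** An automorphism permutes the rows of the linear system and its right-hand side alike, hence
    fixes its solution. *)
Lemma Q_coords w x : (forall j, O (w j)) -> \det (M w) != 0 -> O x ->
  exists c : 'I_n -> algC, (forall j, c j \in Crat) /\ forall i, F i x = \sum_j F i (w j) * c j.
Proof.
move=> Ow d0 Ox; have uM : M w \in unitmx by rewrite unitmxE unitfE.
pose v : 'cV[algC]_n := \col_i F i x.
pose c := invmx (M w) *m v.
have Mc : M w *m c = v by rewrite mulKVmx.
exists (fun j => c j 0); split=> [j|i]; last first.
  by have /colP/(_ i) := Mc; rewrite !mxE => <-; apply: eq_bigr => j _; rewrite mxE.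
apply: Crat_fixed => nu.
have [s' [Ms' vs']] : exists s' : {perm 'I_n}, map_mx nu (M w) = row_perm s' (M w) /\ map_mx nu v = row_perm s' v.
  have [s' Ds'] := Fperm nu; exists s'.
  by split; apply/matrixP=> a b; rewrite !mxE Ds'.
have e : row_perm s' (M w) *m map_mx nu c = row_perm s' v by rewrite -Ms' -vs' -map_mxM Mc.
have {}e : M w *m map_mx nu c = v.
  by apply: (can_inj (mulKmx (unitmx_perm algC s'))); rewrite mulmxA -!row_permE.
by have /colP/(_ j) : map_mx nu c = c by [rewrite /c -{2}e mulKmx|]; rewrite mxE.
Qed.

(* A basis of minimal nonzero discriminant generates the whole ring of integers. *)
Lemma min_disc_span w d x : (forall j, O (w j)) -> \det (M w) ^+ 2 = d%:R -> d != 0%N ->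
  (forall d', is_disc d' -> (d <= d')%N) -> O x ->
  exists c : 'I_n -> int, x = \sum_j (c j)%:~R * w j.
Proof.
move=> Ow Dw d0 mind Ox.
have Mw0 : \det (M w) != 0 by rewrite -sqrf_eq0 Dw pnatr_eq0.
have [c [cQ cE]] := Q_coords Ow Mw0 Ox.
have cR j : c j \is Num.real by exact: Creal_Crat.
suff cZ j : c j \in Num.int.
  exists (fun j => Num.floor (c j)).
  have i0 : 'I_n by exact: (Ordinal (ltnW n_gt1)).
  apply: (fmorph_inj (F i0)); rewrite cE rmorph_sum; apply: eq_bigr => j _.
  by rewrite rmorphM rmorph_int /= floorK // mulrC.
apply: contraT => nZ; pose y := x - \sum_k (Num.floor (c k))%:~R * w k.
have Oy : O y.
  by apply: (SB RO) => //; apply: (Ssum RO) => k _; apply: (SM RO) => //; exact: (Sint RO).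
pose f k := c k - (Num.floor (c k))%:~R.
have yE i : F i y = \sum_k F i (w k) * f k.
  rewrite rmorphB cE rmorph_sum -sumrB; apply: eq_bigr => k _.
  by rewrite rmorphM rmorph_int mulrBr [F i (w k) * _%:~R]mulrC.
(* Replacing w_j by [y] multiplies the discriminant by the square of the fractional part of c_j,
   strictly between 0 and 1. *)
pose w' k := if k == j then y else w k.
pose E : 'M[algC]_n := \matrix_(a, b) if b == j then f a else (a == b)%:R.
have ME : M w' = M w *m E.
  apply/matrixP=> a b; rewrite !mxE /w'; case: (eqVneq b j) => [->|bj].
    by rewrite yE; apply: eq_bigr => k _; rewrite !mxE eqxx.
  rewrite (bigD1 b) //= !mxE (negPf bj) eqxx mulr1 big1 ?addr0 // => k kb.
  by rewrite !mxE (negPf bj) (negPf kb) mulr0.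
have detE : \det E = f j.
  rewrite (expand_det_row _ j) (bigD1 j) //= big1 ?addr0 => [|k kj]; last first.
    by rewrite mxE (negPf kj) eq_sym (negPf kj) mul0r.
  rewrite mxE eqxx /cofactor -signr_odd addnn odd_double expr0 mul1r.
  rewrite [X in \det X](_ : _ = 1%:M) ?det1 ?mulr1 //.
  apply/matrixP=> a b; rewrite !mxE eq_sym (negPf (neq_lift _ _)) /=.
  by rewrite (inj_eq (@lift_inj _ _)).
have Ow' k : O (w' k) by rewrite /w'; case: ifP.
have [d' Dd'] := disc_nat Ow'.
have dd' : d'%:R = d%:R * f j ^+ 2 :> algC by rewrite -Dd' ME det_mulmx exprMn Dw detE.
have fj0 : 0 < f j.
  rewrite /f subr_gt0 lt_neqAle real_floor_le // andbT; apply: contraNneq nZ => <-.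
  exact: rpred_int.
have fj1 : f j < 1 by rewrite /f ltrBlDl -[1]mulr1z -intrD real_floorD1_gt.
have d1 : d'%:R < d%:R :> algC.
  rewrite dd' gtr_pMr ?ltr0n ?lt0n // expr_lt1 // ltW //.
have : is_disc d'.
  exists w'; split=> //; rewrite -(pnatr_eq0 algC) dd' mulf_neq0 ?pnatr_eq0 // expf_neq0 //.
  by rewrite gt_eqF.
by move=> /mind; rewrite leqNgt -(ltr_nat algC) d1.
Qed.

(** At each prime l some determinant is nonzero modulo a prime above l, so l does not divide the
    minimal discriminant, which is thus 1. Linear forms then give a nonzero [x] in [O] whose norm is
    an integer of absolute value less than 1. *)
Lemma no_unramified_extension : False.
Proof.
have ex l (pl : prime l) : exists P w, [/\ prime_ideal l P, forall j, O (w j) & ~ P (\det (M w))].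
  have [P [HP ne]] := Funr pl.
  have [w [Ow nP]] := dedekind_det HP RO ne (@inj_id 'I_n).
  by exists P, w.
have dex : exists d, `[< is_disc d >].
  have [P [w [HP Ow nP]]] := ex 2 isT; have [d Dd] := disc_nat Ow; exists d.
  apply/asboolP; exists w; split=> //; rewrite -(pnatr_eq0 algC) -Dd sqrf_eq0.
  exact: (nP_neq0 HP).
case: (ex_minnP dex) => d /asboolP[w [Ow Dw d0]] mind.
have {}mind d' : is_disc d' -> (d <= d')%N by move=> /asboolP/mind.
have span x : O x -> exists c : 'I_n -> int, x = \sum_j (c j)%:~R * w j.
  exact: min_disc_span Ow Dw d0 mind.
have d1 : d = 1%N.
  have [//|ld] := eqVneq d 1%N; have pl : prime (pdiv d).
    by apply: pdiv_prime; case: d d0 ld {Dw mind} => [|[]].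
  have [P [v [HP Ov nP]]] := ex _ pl; case: nP.
  have [C DC] := choice (fun j => span _ (Ov j)).
  have -> : M v = M w *m map_mx intr (\matrix_(k, j) C j k).
    apply/matrixP=> a b; rewrite !mxE DC rmorph_sum; apply: eq_bigr => k _.
    by rewrite !mxE rmorphM rmorph_int mulrC.
  rewrite det_mulmx det_map_mx; apply: (P_Mr HP); first exact: Aint_int.
  apply: (P_Xinv HP (k := 2)); first exact: M_Aint.
  by rewrite Dw; apply/(P_nat pl HP); exact: pdiv_dvd.
have i0 : 'I_n by exact: (Ordinal (ltnW n_gt1)).
have [] := @linear_forms_algC n (M w) i0.
- by move=> i j; rewrite mxE Freal.
- by rewrite Dw d1.
move=> m [m0 m1 m2].
pose x := \sum_j (m j ord0)%:~R * w j.
have Ox : O x by apply: (Ssum RO) => j _; apply: (SM RO) => //; exact: (Sint RO).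
have Fx i : F i x = \sum_j M w i j * (m j ord0)%:~R.
  by rewrite rmorph_sum; apply: eq_bigr => j _; rewrite rmorphM rmorph_int mxE mulrC.
have {}m1 : `|F i0 x| <= 1 by rewrite Fx.
have {}m2 i : i != i0 -> `|F i x| < 1 by rewrite Fx; exact: m2.
pose N := \prod_i F i x.
have N_int : N \in Num.int.
  apply: Cint_rat_Aint; last by rewrite rpred_prod // => i _; rewrite Aint_aut; exact: (SA RO).
  apply: Crat_fixed => nu; rewrite rmorph_prod; have [s Ds] := Fperm nu.
  rewrite [RHS](reindex_inj (@perm_inj _ s)) /=.
  by apply: eq_bigr => i _; rewrite Ds.
(* The bound at [i0] is not strict; a second embedding brings the norm below 1. *)
have [i1 i10] : exists i1 : 'I_n, i1 != i0.
  have [e|e] := eqVneq (i0 : nat) 0%N.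
    by exists (Ordinal n_gt1); rewrite -val_eqE /= e.
  by exists (Ordinal (ltnW n_gt1)); rewrite -val_eqE /= eq_sym.
have N1 : `|N| < 1.
  rewrite normr_prod (bigD1 i0) //= (bigD1 i1) //=.
  have m2' : `|F i1 x| < 1 by exact: m2.
  set p := \prod_(i | _) _.
  have /andP[p0 p1] : 0 <= p <= 1.
    rewrite /p; elim/big_ind: _ => [|a b /andP[a0 a1] /andP[b0 b1]|i /andP[ii0 _]].
    - by rewrite ler01 lexx.
    - by rewrite mulr_ge0 ?mulr_ile1.
    by rewrite normr_ge0 /=; exact/ltW/m2.
  apply: le_lt_trans (_ : 1 * (`|F i1 x| * 1) < _); last by rewrite mul1r mulr1.
  by rewrite ler_pM // ?mulr_ge0 // ler_pM.
have N0 : N = 0.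
  have [z Dz] := intrP N_int; move: N1; rewrite Dz -intr_norm -[1]/(1%:~R) ltr_int => z1.
  by have -> : z = 0 by lia.
have x0 : x = 0.
  by move/eqP: N0; rewrite prodf_seq_eq0 => /hasP[i _]; rewrite fmorph_eq0 => /eqP.
move/eqP: m0; apply; apply/colP=> j; rewrite [RHS]mxE.
have uM : M w \in unitmx by rewrite unitmxE unitfE -sqrf_eq0 Dw d1 oner_eq0.
have e : M w *m map_mx intr m = 0.
  apply/colP=> i; rewrite mxE [RHS]mxE.
  transitivity (\sum_j M w i j * (m j ord0)%:~R); last by rewrite -Fx x0 rmorph0.
  by apply: eq_bigr => k _; congr (_ * _); rewrite mxE ord1.
have : map_mx intr m = 0 :> 'cV[algC]_n by rewrite -(mulKmx uM (map_mx intr m)) e mulmx0.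
by move/colP/(_ j); rewrite !mxE => /eqP; rewrite intr_eq0 => /eqP.
Qed.
End Minkowski.

(** * Wild ramification at an odd prime *)

Section Wild.
Variables (p : nat) (P : algC -> Prop).
Hypotheses (pp : prime p) (p_odd : odd p) (HP : prime_ideal p P).
Variable z : algC.
Hypothesis pz : p.-primitive_root z.
Let lam := 1 - z.
Let S := Zring z.

Let p0 : (0 < p)%N. Proof. exact: prime_gt0. Qed.
Let p1 : (1 < p)%N. Proof. exact: prime_gt1. Qed.
Let zp : z ^+ p = 1. Proof. exact: prim_expr_order pz. Qed.
Let RS : subringP S. Proof. exact: Zring_sub p0 zp. Qed.
Let Sz : S z. Proof. exact: Zring_gen. Qed.
Let pz1 : (1 * p).-primitive_root z. Proof. by rewrite mul1n. Qed.
Let A_S x : S x -> x \in Aint. Proof. exact: (SA RS). Qed.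

Lemma wild_lamS : S lam. Proof. by apply: (SB RS) => //; apply: (S1 RS). Qed.
Let lamS := wild_lamS.
Lemma wild_lam0 : lam != 0. Proof. by have := ram_pi_neq0 pp pz1; rewrite expr1. Qed.
Let lam0 := wild_lam0.
Lemma wild_Plam : P lam. Proof. by have := ram_P_pi pp HP pz1; rewrite expr1. Qed.
Let Plam := wild_Plam.
Let g k := \sum_(i < k) z ^+ i.
Lemma wild_gE k : 1 - z ^+ k = lam * g k.
Proof. by have := ram_g 1 z k; rewrite expr1. Qed.
Lemma wild_gS k : S (g k).
Proof. by have := ram_g_S pz1 k; rewrite expr1. Qed.
Lemma wild_g_mod k : P (g k - k%:R).
Proof. by have := ram_g_mod pp HP pz1 k; rewrite expr1. Qed.
Lemma wild_g_unit k : coprime k p -> ~ P (g k).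
Proof. by move=> ck; have := ram_g_unit pp HP pz1 ck; rewrite expr1. Qed.

Lemma wild_p_div : exists2 t, S t & p%:R = lam * t.
Proof.
rewrite (prod_one_sub_root pz p1) big_ltn // expr1.
exists (\prod_(2 <= k < p) (1 - z ^+ k)) => //; apply: (Sprod RS) => k _.
by apply: (SB RS); [exact: (S1 RS)|exact: (SX RS)].
Qed.

(** Here [lam] divides in [S] itself, without the denominator of [ram_loc]: modulo [lam] a
    polynomial in [z] is its value at 1, an integer divisible by p, and p is a multiple of [lam]. *)
Lemma wild_P_div x : S x -> P x -> exists2 t, S t & x = lam * t.
Proof.
move=> [q ->] Pq; have [t St e] := horner_diff q RS Sz (S1 RS).
have e1 : (pZtoC q).[1] = (q.[1])%:~R by rewrite -[X in _.[X]](rmorph1 (intr : int -> algC)) horner_map.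
have : P (q.[1])%:~R.
  rewrite -e1 -[X in P X](addrK ((z - 1) * t)) -e; apply: (P_B HP) => //.
  by rewrite -opprB mulNr; apply: (P_N HP); apply: (P_Mr HP) => //; apply: A_S.
move=> /(P_int pp HP) d; have [t' St' et'] := wild_p_div.
have /dvdzP[m' Dm'] : (p%:Z %| q.[1])%Z by [].
exists (m'%:~R * t' - t).
  by apply: (SB RS) => //; apply: (SM RS) => //; exact: (Sint RS).
by rewrite e e1 Dm' intrM -pmulrn et' /lam; ring.
Qed.

Lemma wild_mod_int x : S x -> exists (b : int) t, S t /\ x = b%:~R + lam * t.
Proof.
move=> [q ->]; have [t St e] := horner_diff q RS Sz (S1 RS).
have e1 : (pZtoC q).[1] = (q.[1])%:~R by rewrite -[X in _.[X]](rmorph1 (intr : int -> algC)) horner_map.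
exists q.[1], (- t); split; first exact: (SN RS).
by rewrite e e1 /lam; ring.
Qed.

(** As p is totally ramified in Q(z), the whole Galois group is inertia. *)
Lemma wild_aut (nu : Aut) x : S x -> S (nu x) /\ P (nu x - x).
Proof.
move=> Sx; have [k _ Dk] := aut_root nu p0; have nz := Dk _ zp.
have [q [-> ->]] := aut_Zring nz Sx; split; first by apply: (Shorner RS); apply: (SX RS).
have [t St ->] := horner_diff q RS (SX RS k Sz) Sz.
rewrite addrC addKr; apply: (P_Mr HP); first exact: A_S.
have -> : z ^+ k - z = lam * (1 - g k) by rewrite mulrBr -wild_gE /lam; ring.
apply: (P_Mr HP) => //; apply: A_S; apply: (SB RS); [exact: (S1 RS)|exact: wild_gS].
Qed.

Lemma wild_aut_unit (nu : Aut) x : S x /\ ~ P x -> S (nu x) /\ ~ P (nu x).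
Proof. by move=> [Sx nPx]; have [Snx Pnx] := wild_aut nu Sx; split=> //; apply: (P_eqMod HP) nPx. Qed.

Lemma wild_val_aut (nu : Aut) x j : hasval P S lam x j -> hasval P S lam (nu x) j.
Proof.
move=> [s [u [Ss Su e]]]; have [k ck Dk] := aut_root nu p0.
have nl : nu lam = lam * g k by rewrite rmorphB rmorph1 Dk // wild_gE.
have g0 : g k != 0 by apply: (nP_neq0 HP); exact: wild_g_unit.
have v1 : hasval P S lam (nu lam ^ j) j.
  rewrite nl expfzMl; apply: (val_ext_unit HP RS lam0); first exact: (val_pi HP).
  by rewrite -[0](mul0r j); apply: (valz HP RS lam0); apply: (val_unit HP _ RS); [exact: wild_gS|exact: wild_g_unit].
have Dnx : nu x = nu lam ^ j * (nu u / nu s).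
  have ns0 : nu s != 0 by rewrite fmorph_eq0; apply: (nP_neq0 HP); case: Ss.
  by rewrite mulrA -fmorphXz -rmorphM -e rmorphM mulfK.
rewrite Dnx; apply: (val_ext_unit HP RS lam0) => //.
have [Snu nPnu] := wild_aut_unit nu Su; have [Sns nPns] := wild_aut_unit nu Ss.
rewrite -[0]addr0 -[X in _ + X]oppr0; apply: (valM HP RS lam0); first exact: (val_unit HP _ RS).
by apply: (valV HP lam0); exact: (val_unit HP _ RS).
Qed.

Let Cyc_lam : Cyc p lam.
Proof. by move=> nu fx; rewrite rmorphB rmorph1 fx. Qed.

Let Cyc_S x : S x -> Cyc p x.
Proof.
move=> Sx nu fx; have nz : nu z = z ^+ 1 by rewrite expr1 fx.
by have [q [-> ->]] := aut_Zring nz Sx; rewrite expr1.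
Qed.

Lemma wild_val x : x != 0 -> Cyc p x -> exists j, hasval P S lam x j.
Proof.
move=> x0 cx; have := ram_val pp HP pz1 (coprimen1 p) x0; rewrite mul1n expr1; exact.
Qed.

(* Every character of order p has a resolvent with p-th power close to 1. *)
Lemma wild_normal_form c : is_char p c -> exists (w : algC) (e : int) t,
  [/\ attached p (fun nu => c nu ^+ p.-1) w, S t & w ^+ p = 1 + e%:~R * lam + lam ^+ 2 * t].
Proof.
move=> cc; have [w0 w00 cw0] := Hilbert90 p0 cc.
have aw0 : attached p c w0 by [].
have w0p : w0 ^+ p != 0 by rewrite expf_neq0.
have [j vj] := wild_val w0p (attached_Cyc cc aw0).
(* Take [nu] squaring the p-th roots of unity, as p is odd. Then nu(w0^p) is gam^p times the square
   of w0^p and has the valuation j of w0^p, so j = k p + 2 j, and p divides j. *)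
have c2 : coprime 2 p by rewrite coprime2n.
have [nu Dnu] := Qn_aut_exists c2.
have cg := attached_pow cc p0 aw0 Dnu; set gam := nu w0 / _ in cg.
have gam0 : gam != 0 by rewrite mulf_neq0 ?invr_neq0 ?expf_neq0 ?fmorph_eq0.
have [k vk] := wild_val gam0 cg.
have jk : j = - k * p%:Z.
  have v2 : hasval P S lam (nu (w0 ^+ p)) (k * p%:Z + j * 2%:Z).
    have -> : nu (w0 ^+ p) = gam ^+ p * (w0 ^+ p) ^+ 2.
      by rewrite /gam expr_div_n -[_ ^+ 2 ^+ p]exprM mulnC exprM rmorphXn divfK // !expf_neq0.
    by apply: (valM HP RS lam0); apply: (valXn HP RS lam0).
  have := val_uniq HP RS lam0 Plam (wild_val_aut nu vj) v2; lia.
have al : attached p (fun=> 1) (lam ^ k).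
  by split=> [|mu fx]; rewrite ?expfz_neq0 // fmorphXz Cyc_lam // mul1r.
have aw1 : attached p c (w0 * lam ^ k).
  by have := attachedM aw0 al; congr attached; apply/funext => mu; exact: mulr1.
have [s [u [[Ss nPs] [Su nPu] e]]] : hasval P S lam ((w0 * lam ^ k) ^+ p) 0.
  have -> : (w0 * lam ^ k) ^+ p = w0 ^+ p * (lam ^ k) ^+ p by rewrite exprMn.
  have -> : 0 = j + k * p%:Z by rewrite jk; ring.
  apply: (valM HP RS lam0) => //; apply: (valXn HP RS lam0); exact: (val_pi HP).
rewrite expr0z mul1r in e.
pose w2 := w0 * lam ^ k * s.
have s0 : s != 0 by apply: (nP_neq0 HP).
have aw2 : attached p c w2.
  have as' : attached p (fun=> 1) s by split=> // mu fx; rewrite Cyc_S // mul1r.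
  by have := attachedM aw1 as'; congr attached; apply/funext => mu; exact: mulr1.
pose x := s ^+ p.-1 * u.
have w2p : w2 ^+ p = x.
  rewrite /w2 exprMn /x -e [RHS]mulrC -mulrA; congr (_ * _).
  by rewrite -exprS prednK.
have Sx : S x by apply: (SM RS) => //; apply: (SX RS).
have nPx : ~ P x by apply: (nP_M HP); rewrite ?rpredX ?A_S //; apply: (nP_X HP) => //; exact: A_S.
(* Modulo P, elements of [S] are integers, so Fermat's little theorem applies; the power p - 1 is
   why c^(p-1) replaces [c]. *)
have Px1 : P (x ^+ p.-1 - 1).
  have [b [t [St Dx]]] := wild_mod_int Sx.
  have Pxb : P (x - b%:~R) by rewrite Dx addrC addKr; apply: (P_Mr HP) => //; exact: A_S.
  have Ab : b%:~R \in Aint by exact: Aint_int.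
  have nPb : ~ P b%:~R.
    by move=> Pb; apply: nPx; apply: (P_trans HP) Pxb Pb.
  rewrite -[x ^+ _](subrK (b%:~R ^+ p.-1)) -addrA; apply: (P_D HP).
    by apply: (P_expB HP) => //; exact: A_S.
  have [t' At' et'] := Frob_int pp subring_Aint b.
  have : P (b%:~R * (b%:~R ^+ p.-1 - 1)).
    rewrite mulrBr mulr1 -exprS prednK // et' addrC addKr.
    by apply: (P_Mr HP) => //; exact: P_l HP.
  move=> /(P_prime HP Ab _)[||//] //; by rewrite rpredB ?rpredX ?rpred1.
have Sx1 : S (x ^+ p.-1 - 1) by apply: (SB RS); [exact: (SX RS)|exact: (S1 RS)].
have [y Sy Dy] := wild_P_div Sx1 Px1.
have [e' [t [St Dt]]] := wild_mod_int Sy.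
exists (w2 ^+ p.-1), e', t; split=> //.
  have [w20 cw2] := aw2; split=> [|mu fx]; first by rewrite expf_neq0.
  by rewrite rmorphXn cw2 // exprMn.
rewrite -exprM mulnC exprM w2p; apply/eqP; rewrite -addrA addrC -subr_eq Dy Dt; apply/eqP; ring.
Qed.
End Wild.

Section Improve.
Variables (p : nat) (P : algC -> Prop).
Hypotheses (pp : prime p) (p_odd : odd p) (HP : prime_ideal p P).
Variable z : algC.
Hypothesis pz : p.-primitive_root z.
Let lam := 1 - z.
Let S := Zring z.
Let p0 : (0 < p)%N. Proof. exact: prime_gt0. Qed.
Let p1 : (1 < p)%N. Proof. exact: prime_gt1. Qed.
Let zp : z ^+ p = 1. Proof. exact: prim_expr_order pz. Qed.
Let RS : subringP S. Proof. exact: Zring_sub p0 zp. Qed.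
Let A_S x : S x -> x \in Aint. Proof. exact: (SA RS). Qed.
Let lamS : S lam. Proof. exact: (wild_lamS pp pz). Qed.
Let lam0 : lam != 0. Proof. exact: (wild_lam0 pp pz). Qed.
Let Plam : P lam. Proof. exact: (wild_Plam pp HP pz). Qed.

(** Otherwise p - 1 would divide k - 1, by [teich_order]. *)
Lemma exists_generator_power k : (1 < k < p)%N ->
  exists2 a, coprime a p & ~ P (a%:R ^+ k - a%:R).
Proof.
move=> /andP[k1 kp]; apply: contrapT => no.
have H a : coprime a p -> P (a%:R ^+ k.-1 - 1).
  move=> ca; have Pa : P (a%:R * (a%:R ^+ k.-1 - 1)).
    rewrite mulrBr mulr1 -exprS prednK ?(ltnW k1) //.
    by apply: contrapT => nP; apply: no; exists a.
  have [||/(P_nat pp HP) pa|//] := P_prime HP _ _ Pa; rewrite ?rpredB ?rpredX ?rpred_nat //.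
  by move: ca; rewrite coprime_sym prime_coprime // pa.
have := teich_order pp HP H => d; have k2 : (0 < k.-1)%N by rewrite -ltnS prednK // ltnW.
by have := dvdn_leq k2 d; rewrite leqNgt -ltnS !prednK // ?kp // ltnW.
Qed.

Lemma subr_p_prod (x y : algC) : y != 0 -> x ^+ p - y ^+ p = \prod_(0 <= i < p) (x - z ^+ i * y).
Proof.
move=> y0; have := congr1 (fun q => q.[x / y]) (factor_Xn_sub_1 pz).
rewrite horner_prod hornerD hornerN hornerXn hornerC.
under eq_bigr do rewrite hornerXsubC.
move=> e; have yp : y ^+ p != 0 by rewrite expf_neq0.
apply: (mulIf (invr_neq0 yp)); rewrite mulrBl divff // -expr_div_n -e.
have -> : (y ^+ p)^-1 = \prod_(0 <= i < p) y^-1 by rewrite big_const_nat subn0 iter_mulr_1 exprVn.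
by rewrite -big_split /=; apply: eq_bigr => i _; rewrite mulrBl mulfK.
Qed.

(** Each of the p factors s - z^i u is divisible by [lam]. *)
Lemma wild_pth_power s u : S s -> S u -> u != 0 -> P (s - u) ->
  exists2 t, S t & s ^+ p - u ^+ p = lam ^+ p * t.
Proof.
move=> Ss Su u0 Psu; have [d Sd Dd] := wild_P_div pp HP pz (SB RS Ss Su) Psu.
exists (\prod_(0 <= i < p) (d + (\sum_(k < i) z ^+ k) * u)).
  apply: (Sprod RS) => i _; apply: (SD RS) => //; apply: (SM RS) => //; exact: (wild_gS pz).
rewrite (subr_p_prod _ u0); have -> : lam ^+ p = \prod_(0 <= i < p) lam.
  by rewrite big_const_nat subn0 iter_mulr_1.
rewrite -big_split /=; apply: eq_bigr => i _.
by rewrite mulrDr mulrA -(wild_gE z) -Dd; ring.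
Qed.

Variables (c : Aut -> algC) (v : algC).
Hypotheses (cc : is_char p c) (av : attached p c v) (Sv : S (v ^+ p)).

(** Let [nu] raise [z] to the power a. It multiplies the leading term lam^k f by a^k, up to higher
    terms; on the other hand [nu mu] is mu^a, of leading term a lam^k f, times a p-th power that is
    1 modulo lam^p up to units at P. As k < p, comparison puts (a^k - a) f in P, and a suitable a
    puts f there. *)
Lemma wild_improve k : (1 < k < p)%N -> (exists2 f, S f & v ^+ p = 1 + lam ^+ k * f) ->
  exists2 f, S f & v ^+ p = 1 + lam ^+ k.+1 * f.
Proof.
move=> kp [f Sf Df]; have [k1 kp'] := andP kp; have k0 := ltnW k1.
have [a ca nPa] := exists_generator_power kp.
set mu := v ^+ p in Df *.
have Pmu : P (mu - 1) by rewrite Df addrC addKr; apply: (P_Mr HP) (P_X HP k0 Plam); exact: A_S.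
have nPmu : ~ P mu by apply: (P_eqMod HP) Pmu (P_1 HP).
have [nu Dnu] := Qn_aut_exists ca.
have cg := attached_pow cc p0 av Dnu; set gam := nu v / _ in cg.
have [v0 _] := av.
have gam0 : gam != 0 by rewrite mulf_neq0 ?invr_neq0 ?expf_neq0 ?fmorph_eq0.
have [i vi] := wild_val pp HP pz gam0 cg.
have gE : nu mu = mu ^+ a * gam ^+ p.
  by rewrite /gam expr_div_n -[_ ^+ a ^+ p]exprM mulnC exprM mulrC rmorphXn divfK // !expf_neq0.
have i0 : i = 0.
  have vmu : hasval P S lam mu 0 by apply: (val_unit HP _ RS).
  have v1 := wild_val_aut pp HP pz nu vmu.
  have v2 : hasval P S lam (nu mu) (0 * a%:Z + i * p%:Z).
    by rewrite gE; apply: (valM HP RS lam0); apply: (valXn HP RS lam0).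
  have := val_uniq HP RS lam0 Plam v1 v2; rewrite mul0r add0r => /esym/eqP.
  by rewrite mulf_eq0 eqz_nat (gtn_eqF p0) orbF => /eqP.
move: vi; rewrite i0 => -[s [u [[Ss nPs] [Su nPu]]]]; rewrite expr0z mul1r => e.
have s0 : s != 0 by exact: (nP_neq0 HP).
have u0 : u != 0 by exact: (nP_neq0 HP).
have [Snmu _] := wild_aut pp HP pz nu Sv.
have key : nu mu * s ^+ p = mu ^+ a * u ^+ p by rewrite gE -mulrA -exprMn e.
have Pnmu : P (nu mu - 1).
  have [_ h] := wild_aut pp HP pz nu Sv; rewrite -[nu mu](subrK mu) -addrA; exact: (P_D HP).
have Pmua : P (mu ^+ a - 1) by have := P_expB HP a (A_S Sv) Aint1 Pmu; rewrite expr1n.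
have Psu : P (s - u).
  apply: (P_Xinv HP (k := p)); first by rewrite rpredB ?A_S.
  have [t St ->] := Frob_add pp RS Ss (SN RS Su).
  apply: (P_D HP); last by apply: (P_Mr HP); [exact: A_S|exact: P_l HP].
  rewrite exprNn -signr_odd p_odd expr1 mulN1r.
  have -> : s ^+ p - u ^+ p = (mu ^+ a - 1) * u ^+ p - (nu mu - 1) * s ^+ p.
    rewrite !mulrBl key; ring.
  by apply: (P_B HP); apply: (P_Mr HP); rewrite ?rpredX ?A_S.
have [t St et] := wild_pth_power Ss Su u0 Psu.
(* X * lam ^ k = nu mu - mu ^ a *)
pose X := (\sum_(j < a) z ^+ j) ^+ k * nu f - f * \sum_(j < a) mu ^+ j.
have [Snf Pnf] := wild_aut pp HP pz nu Sf.
have nlam : nu lam = lam * \sum_(j < a) z ^+ j.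
  by rewrite rmorphB rmorph1 Dnu // (wild_gE z).
have XE : lam ^+ k * X = nu mu - mu ^+ a.
  have h1 : nu mu = 1 + lam ^+ k * ((\sum_(j < a) z ^+ j) ^+ k * nu f).
    by rewrite Df rmorphD rmorph1 rmorphM rmorphXn /= nlam exprMn mulrA.
  have h2 : mu ^+ a = 1 + (mu - 1) * \sum_(j < a) mu ^+ j by rewrite -subrX1; ring.
  have h3 : mu - 1 = lam ^+ k * f by rewrite Df addrC addKr.
  by rewrite h1 h2 h3 /X; ring.
have AX : X \in Aint.
  apply: A_S; apply: (SB RS); apply: (SM RS) => //; last by apply: (Ssum RS) => j _; apply: (SX RS).
  by apply: (SX RS); exact: (wild_gS pz).
have PX : P X.
  have : P (X * u ^+ p).
    have -> : X * u ^+ p = lam * (lam ^+ (p - k).-1 * - (nu mu * t)).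
      apply: (mulfI (expf_neq0 k lam0)); rewrite [LHS]mulrA XE mulrBl -key.
      have -> : u ^+ p = s ^+ p - lam ^+ p * t by rewrite -et; ring.
      have -> : lam ^+ p = lam ^+ k * (lam * lam ^+ (p - k).-1).
        by rewrite -exprS -exprD prednK ?subn_gt0 // subnKC // ltnW.
      ring.
    by apply: (P_Mr HP) => //; apply: A_S; apply: (SM RS); [exact: (SX RS)|apply: (SN RS); exact: (SM RS)].
  by move=> /(P_prime HP AX _)[|//|/(P_Xinv HP (A_S Su))//]; rewrite rpredX ?A_S.
have Pf : P f.
  have : P ((a%:R ^+ k - a%:R) * f).
    have -> : (a%:R ^+ k - a%:R) * f = X - ((\sum_(j < a) z ^+ j) ^+ k * nu f - a%:R ^+ k * f)
       + f * (\sum_(j < a) mu ^+ j - a%:R) by rewrite /X; ring.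
    apply: (P_D HP); first (apply: (P_B HP) => //).
      apply: (P_mulB HP) => //; rewrite ?A_S //.
        by apply: (SX RS); exact: (wild_gS pz).
      apply: (P_expB HP); rewrite ?rpred_nat //; first by apply: A_S; exact: (wild_gS pz).
      exact: (wild_g_mod pp HP pz).
    apply: (P_Ml HP); first exact: A_S.
    have -> : a%:R = \sum_(j < a) 1 :> algC by rewrite sumr_const card_ord.
    rewrite -sumrB; apply: (P_sum HP) => j _.
    by have := P_expB HP j (A_S Sv) Aint1 Pmu; rewrite expr1n.
  by move=> /(P_prime HP _ (A_S Sf))[|//|//]; rewrite ?rpredB ?rpredX ?rpred_nat.
have [f' Sf' Df'] := wild_P_div pp HP pz Sf Pf.
by exists f' => //; rewrite Df Df' exprSr mulrA.
Qed.

Lemma wild_improve_p : (exists2 f, S f & v ^+ p = 1 + lam ^+ 2 * f) ->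
  exists2 f, S f & v ^+ p = 1 + lam ^+ p * f.
Proof.
move=> h; have p2 : (2 < p)%N by rewrite odd_prime_gt2.
suff H k : (2 <= k <= p)%N -> exists2 f, S f & v ^+ p = 1 + lam ^+ k * f.
  by apply: H; rewrite leqnn p1.
elim: k => // k IH /andP[]; rewrite leq_eqVlt => /orP[/eqP <- //|k2 kp].
have k2' : (1 < k)%N by [].
by apply: wild_improve; [rewrite k2'|apply: IH; rewrite k2' ltnW].
Qed.

(* z := (v - 1) / lam is a root of prod (X + (1 - zeta^i) / lam) - f. *)
Lemma wild_artin_schreier f : S f -> v ^+ p = 1 + lam ^+ p * f -> (v - 1) / lam \in Aint.
Proof.
move=> Sf e.
pose q : {poly algC} := \prod_(0 <= i < p) ('X + (\sum_(k < i) z ^+ k)%:P) - f%:P.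
have size_prod : size (\prod_(0 <= i < p) ('X + (\sum_(k < i) z ^+ k)%:P) : {poly algC}) = p.+1.
  rewrite (eq_bigr (fun i : nat => 'X - (- \sum_(k < i) z ^+ k)%:P)); last by move=> i _; rewrite polyCN opprK.
  by rewrite size_prod_XsubC size_iota subn0.
have mq : q \is monic.
  rewrite monicE lead_coefDl ?size_prod; last by rewrite size_polyN size_polyC; case: eqP => //; rewrite ltnS.
  by rewrite -monicE rpred_prod // => i _; rewrite monicXaddC.
apply: (Aint_integral mq).
  rewrite rpredB ?polyOverC ?A_S // rpred_prod // => i _.
  by rewrite rpredD ?polyOverX // polyOverC A_S //; exact: (wild_gS pz).
rewrite rootE /q hornerD hornerN hornerC horner_prod subr_eq0; apply/eqP.
have lp : lam ^+ p != 0 by rewrite expf_neq0.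
apply: (mulfI lp); have -> : lam ^+ p * f = v ^+ p - 1 ^+ p by rewrite e expr1n; ring.
rewrite (subr_p_prod _ (oner_neq0 _)); have -> : lam ^+ p = \prod_(0 <= i < p) lam.
  by rewrite big_const_nat subn0 iter_mulr_1.
rewrite -big_split /=; apply: eq_bigr => i _.
rewrite hornerD hornerX hornerC mulrDr -(wild_gE z) mulrCA divff // !mulr1; ring.
Qed.
End Improve.

(** * Characters of order p unramified everywhere do not exist *)

Fixpoint iaut (s : Aut) k : Aut := if k is k'.+1 then s \o iaut s k' else idfun.

Lemma iautE s k x : iaut s k x = iter k s x.
Proof. by elim: k => //= k ->. Qed.

Lemma char_iaut n c s k : (0 < n)%N -> is_char n c -> c (iaut s k) = c s ^+ k.
Proof. by move=> n0 cc; apply: (charX n0 cc) => x; rewrite iautE. Qed.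

Lemma fixU_iaut n s k : fixU n s -> fixU n (iaut s k).
Proof. by move=> fx; elim: k => //= k IH y yn /=; rewrite IH // fx. Qed.

Lemma char_eq_fix n c (nu mu : Aut) y : (0 < n)%N -> is_char n c -> c nu = c mu ->
  (forall ka : Aut, c ka = 1 -> ka y = y) -> nu y = mu y.
Proof.
move=> n0 cc e fy; pose ka : Aut := algC_invaut mu \o nu.
have <- : mu (ka y) = nu y by rewrite /= algC_invautK.
rewrite fy //; apply: (mulfI (char_neq0 n0 cc mu)); rewrite mulr1 -(charM cc).
by rewrite -e; apply: (char_ext n0 cc) => x /=; rewrite algC_invautK.
Qed.

Section Unramified.
Variables (PI : nat -> algC -> Prop) (p : nat).
Hypotheses (HPI : forall l, prime l -> prime_ideal l (PI l)) (pp : prime p) (p_odd : odd p).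
Variable z : algC.
Hypothesis pz : p.-primitive_root z.
Let p0 : (0 < p)%N. Proof. exact: prime_gt0. Qed.
Let p1 : (1 < p)%N. Proof. exact: prime_gt1. Qed.
Let zp : z ^+ p = 1. Proof. exact: prim_expr_order pz. Qed.

Variables (c : Aut -> algC) (s : Aut) (v f : algC).
Hypotheses (cc : is_char p c) (cs : c s != 1) (fs : fixU p s).
Hypothesis ur : forall l, prime l -> l != p -> UR PI l c.
Hypotheses (av : attached p c v) (Sf : Zring z f) (Df : v ^+ p = 1 + (1 - z) ^+ p * f).

Let cM : forall nu mu ka : Aut, ka =1 nu \o mu -> c ka = c nu * c mu. Proof. by case: cc. Qed.
Let cp nu : c nu ^+ p = 1. Proof. by case: cc. Qed.
Let c0 nu : c nu != 0. Proof. exact: (char_neq0 p0 cc). Qed.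

Let xi := c s.
Let pxi : p.-primitive_root xi.
Proof.
have /(prim_rootP pz)[[m mp] /= Dm] : xi ^+ p = 1 by exact: cp.
have m0 : (0 < m)%N by rewrite lt0n; apply: contraNneq cs => m0; rewrite -/xi Dm m0.
rewrite Dm prim_root_exp_coprime // coprime_sym prime_coprime // gtnNdvd //.
Qed.

Let O x := x \in Aint /\ forall nu, c nu = 1 -> nu x = x.

Let RO : subringP O.
Proof.
split.
- by move=> x [].
- by split=> [|nu _]; rewrite ?Aint1 ?rmorph1.
- by move=> x y [Ax fx] [Ay fy]; split=> [|nu nu1]; rewrite ?rpredB // rmorphB fx ?fy.
by move=> x y [Ax fx] [Ay fy]; split=> [|nu nu1]; rewrite ?rpredM // rmorphM fx ?fy.
Qed.

Let F (i : 'I_p) : Aut := iaut s i.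

Let cF i : c (F i) = xi ^+ i. Proof. exact: (char_iaut s i p0 cc). Qed.

Let Ofix (nu mu : Aut) x : c nu = c mu -> O x -> nu x = mu x.
Proof. by move=> e [_ fx]; exact: (char_eq_fix p0 cc e fx). Qed.

Let Fperm (nu : Aut) : exists t : {perm 'I_p}, forall i x, O x -> nu (F i x) = F (t i) x.
Proof.
have /(prim_rootP pxi)[b Db] : c nu ^+ p = 1 by exact: cp.
pose h (i : 'I_p) : 'I_p := Ordinal (ltn_pmod (i + b) p0).
have h_inj : injective h.
  move=> i j /(congr1 val) /= /eqP; rewrite eqn_modDr !modn_small // => /eqP; exact: val_inj.
exists (perm h_inj) => i x Ox; rewrite permE.
apply: (Ofix (nu := nu \o F i)) => //.
by rewrite (charM cc) cF cF Db -exprD addnC /= prim_expr_mod.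
Qed.

Let Freal i x : O x -> F i x \is Num.real.
Proof.
move=> Ox; pose cj : Aut := @Num.conj algC; apply/CrealP.
(* Conjugation has order 2 and [c] odd order p. *)
have cj1 : c cj = 1.
  have c2 : c cj ^+ 2 = 1.
    rewrite expr2 -(charM cc) -(char1 p0 cc); apply: (char_ext p0 cc) => y /=; exact: conjCK.
  by have := cp cj; rewrite -(odd_double_half p) p_odd exprD expr1 -muln2 mulnC exprM c2 expr1n mulr1.
by apply: (Ofix (nu := cj \o F i)) => //; rewrite (charM cc) cj1 mul1r.
Qed.

(* The trace from the field Q(z, v) down to the fixed field of c. *)
Let D y := forall nu, fixU p nu -> c nu = 1 -> nu y = y.

(** Lifts of z -> z^a to the kernel of [c], corrected by a power of [s]; index 0 gets a dummy
    value. *)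
Let tau_ex (a : 'I_p) : exists nu : Aut, (a != 0%N :> nat) -> nu z = z ^+ a /\ c nu = 1.
Proof.
have [a0|a0] := eqVneq (a : nat) 0%N; first by exists idfun.
have ca : coprime a p by rewrite coprime_sym prime_coprime // gtnNdvd // lt0n.
have [nu Dnu] := Qn_aut_exists ca.
have /(prim_rootP pxi)[b Db] : (c nu)^-1 ^+ p = 1 by rewrite exprVn cp invr1.
exists (nu \o iaut s b) => _; split.
  by rewrite /= (fixU_iaut b fs zp) Dnu.
by rewrite (charM cc) (char_iaut _ _ p0 cc) -/xi -Db divff.
Qed.

(** The integers of the field of degree p cut out by [c] would contradict [no_unramified_extension].
    That its embeddings stay distinct modulo a prime is first seen on an integer [y] of Q(z, v),
    which is (v - 1) / (1 - z) at p and a multiple of [v] by a number of Q(z) at the other primes;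
    the trace [tr] then brings it down to [O]. *)
Lemma unramified_absurd : False.
Proof.
have [tau Dtau] := choice tau_ex.
have tauz (a : 'I_p) : (a != 0%N :> nat) -> tau a z = z ^+ a by move=> /Dtau[].
have ctau (a : 'I_p) : (a != 0%N :> nat) -> c (tau a) = 1 by move=> /Dtau[].
have Dext (nu mu : Aut) y : D y -> nu z = mu z -> c nu = c mu -> nu y = mu y.
  move=> Dy e ec; pose ka : Aut := algC_invaut mu \o nu.
  have <- : mu (ka y) = nu y by rewrite /= algC_invautK.
  rewrite Dy //.
    by apply: (fixU_prim pz); rewrite /= e algC_autK.
  apply: (mulfI (c0 mu)); rewrite mulr1 -(charM cc) -ec.
  by apply: (char_ext p0 cc) => x /=; rewrite algC_invautK.
have DM y y' : D y -> D y' -> D (y * y') by move=> Dy Dy' nu fx c1; rewrite rmorphM Dy ?Dy'.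
have DB y y' : D y -> D y' -> D (y - y') by move=> Dy Dy' nu fx c1; rewrite rmorphB Dy ?Dy'.
have DS x : Zring z x -> D x.
  move=> Sx nu fx _; have nz : nu z = z ^+ 1 by rewrite expr1 fx.
  by have [q [-> ->]] := aut_Zring nz Sx; rewrite expr1.
pose tr y := \sum_(a < p | a != 0%N :> nat) tau a y.
have trO y : y \in Aint -> D y -> O (tr y).
  move=> Ay Dy; split; first by rewrite rpred_sum // => a _; rewrite Aint_aut.
  move=> nu c1; have [b cb Db] := aut_root nu p0.
  rewrite /tr rmorph_sum.
  have nb : ~~ (p %| b)%N by rewrite -prime_coprime // coprime_sym.
  pose h (i : 'I_p) : 'I_p := Ordinal (ltn_pmod (i * b) p0).
  have h_inj : injective h.
    have pzb : p.-primitive_root (z ^+ b) by rewrite prim_root_exp_coprime.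
    move=> i j /(congr1 val) /= /eqP; rewrite -(eq_prim_root_expr pz) ![(_ * b)%N]mulnC !exprM.
    by rewrite (eq_prim_root_expr pzb) !modn_small // => /eqP; exact: val_inj.
  have h0 (a : 'I_p) : (h a != 0%N :> nat) = (a != 0%N :> nat).
    rewrite /h /= -/(dvdn p (a * b)) Euclid_dvdM // (negPf nb) orbF.
    by case: (posnP a) => [->|a0]; [rewrite dvdn0|rewrite gtnNdvd // -lt0n a0].
  rewrite [RHS](reindex_inj h_inj) /=; apply: eq_big => [a|a a0]; first by rewrite -h0.
  apply: (Dext (nu \o tau a)) => //.
    by rewrite /= tauz // rmorphXn Db // -exprM tauz ?h0 // /h /= prim_expr_mod // mulnC.
  by rewrite (charM cc) c1 ctau // mulr1 ctau // h0.
have Fz i : F i z = z by exact: (fixU_iaut i fs zp).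
have DF i y : D y -> D (F i y).
  move=> Dy nu fx c1; apply: (Dext (nu \o F i)) => //; first by rewrite /= Fz fx.
  by rewrite (charM cc) c1 mul1r.
have trF i y : D y -> F i (tr y) = tr (F i y).
  move=> Dy; rewrite /tr rmorph_sum; apply: eq_bigr => a a0.
  apply: (Dext (F i \o tau a) (tau a \o F i)) => //.
    by rewrite /= Fz tauz // rmorphXn Fz.
  by rewrite !(charM cc) mulrC.
have trFB i j y : D y -> F i (tr y) - F j (tr y) = tr (F i y - F j y).
  by move=> Dy; rewrite !trF // /tr -sumrB; apply: eq_bigr => a _; rewrite rmorphB.
have [v0 cv] := av.
have Fv i : F i v = xi ^+ i * v by rewrite cv ?cF //; exact: fixU_iaut.
have RS := Zring_sub p0 zp.
have Dv : D v by move=> nu fx c1; rewrite cv // c1 mul1r.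
have [m Dm] : exists m, xi = z ^+ m by have /(prim_rootP pz)[m ->] : xi ^+ p = 1 := cp _; exists m.
have Sxi : Zring z xi by rewrite Dm; apply: (SX RS); exact: Zring_gen.
apply: (no_unramified_extension p1 RO Fperm Freal) => l pl.
have HP := HPI pl; exists (PI l); split=> // i j ij.
have [lp|lp] := eqVneq l p.
- move: HP; rewrite lp => HP {l pl lp}.
  have Ay : (v - 1) / (1 - z) \in Aint := wild_artin_schreier pp pz Sf Df.
  set y := (v - 1) / (1 - z) in Ay.
  have lam0 := wild_lam0 pp pz; have Plam := wild_Plam pp HP pz; have Slam := wild_lamS pp pz.
  have Dy : D y.
    by move=> nu fx c1; rewrite /y fmorph_div (DS _ Slam) // rmorphB Dv // rmorph1.
  have vE : v = 1 + (1 - z) * y by rewrite /y mulrC divfK // addrC subrK.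
  (* The quotient of xi^i - xi^j by 1 - z is a unit at P, and B v is the difference of the
     conjugates of [y]. *)
  have [B [SB nPB BE]] : exists B, [/\ Zring z B, ~ PI p B & (1 - z) * B = xi ^+ i - xi ^+ j].
    have H (a b : 'I_p) : (b < a)%N ->
        exists B, [/\ Zring z B, ~ PI p B & (1 - z) * B = xi ^+ a - xi ^+ b].
      move=> ba; have Sg := wild_gS pz (m * (a - b)).
      exists (- (xi ^+ b * \sum_(k < m * (a - b)) z ^+ k)); split.
      - by apply: (SN RS); apply: (SM RS) => //; exact: (SX RS).
      - move/(P_N HP); rewrite opprK; apply: (nP_M HP); rewrite ?rpredX ?(SA RS) //.
          move/(P_Xinv HP (SA RS Sxi)) => Pxi; apply: (P_1 HP); rewrite -(cp s); exact: (P_X HP).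
        apply: (wild_g_unit pp HP pz); rewrite coprimeMl.
        have -> : coprime m p by move: pxi; rewrite Dm prim_root_exp_coprime.
        rewrite coprime_sym prime_coprime // gtnNdvd ?subn_gt0 //.
        by apply: leq_ltn_trans (leq_subr _ _) (ltn_ord a).
      rewrite mulrN mulrCA -(wild_gE z) Dm -exprM mulrBr mulr1 -exprD opprB.
      by rewrite -mulnDr subnKC ?exprM // ltnW.
    case: (ltngtP i j) => [ij'|/H//|/val_inj e]; last by rewrite e eqxx in ij.
    have [B [SB nPB BE]] := H _ _ ij'; exists (- B); split; first exact: (SN RS).
      by move/(P_N HP); rewrite opprK.
    by rewrite mulrN BE opprB.
  exists (tr y); first exact: trO.
  rewrite trFB //.
  have FyB : F i y - F j y = B * v.
    have FyE i' : F i' y = (xi ^+ i' * v - 1) / (1 - z).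
      by rewrite /y fmorph_div !rmorphB !rmorph1 Fv Fz.
    by rewrite !FyE -mulrBl -[RHS](mulfK lam0) [_ * (1 - z)]mulrC mulrA BE; congr (_ / _); ring.
  have Av : v \in Aint by rewrite vE rpredD ?rpred1 // rpredM // (SA RS).
  have Ptau a : PI p (tau a (B * v) - B).
    have -> : tau a (B * v) - B = tau a (1 - z) * tau a (B * y) + (tau a B - B).
      rewrite {1}vE (_ : B * (1 + (1 - z) * y) = B + (1 - z) * (B * y)); last by ring.
      by rewrite rmorphD rmorphM /=; ring.
    apply: (P_D HP); last by have [] := wild_aut pp HP pz (tau a) SB.
    apply: (P_Mr HP); first by rewrite Aint_aut rpredM // (SA RS).
    have [_ h] := wild_aut pp HP pz (tau a) Slam; exact: (P_trans HP h Plam).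
  rewrite FyB => Ptr; apply: nPB.
  (* All p - 1 terms of the trace are congruent to [B], so the trace is - B modulo P. *)
  have : PI p (p%:R * B - (tr (B * v) - \sum_(a < p | a != 0%N :> nat) (tau a (B * v) - B))).
    apply: (P_B HP); first by apply: (P_Mr HP); [exact: (SA RS)|exact: P_l HP].
    by apply: (P_B HP) => //; apply: (P_sum HP).
  congr (PI p).
  rewrite /tr sumrB subKr.
  rewrite mulr_natl -[X in B *+ X](card_ord p) -sumr_const (bigD1 (Ordinal p0)) //=.
  by rewrite [X in B + X](eq_bigl (fun a : 'I_p => a != 0%N :> nat)) ?addrK.
pose HPl := HPI pl.
have lp' : coprime l p by rewrite prime_coprime // dvdn_prime2.
have l0 : l%:R != 0 :> algC by rewrite pnatr_eq0 -lt0n prime_gt0.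
have [k vk] := UR_any HPI pl cc p0 (ur pl lp) lp' av.
have vp0 : v ^+ p != 0 by rewrite expf_neq0.
have [k' vk'] := unram_val pl HP pz lp' vp0 (attached_Cyc cc av).
(* [c] is unramified at l, so the valuation of v^p is a multiple of p; it can be divided out of [v],
   leaving a unit [y] at l. *)
have kk' : k' = k * p%:Z.
  apply: (val_uniq HP subring_Aint l0 (P_l HP) (val_Aint RS vk')).
  exact: (valXn HP subring_Aint l0).
move: vk'; rewrite kk' => -[a [u [[Sa nPa] [Su nPu] e]]].
pose y := v * a / l%:R ^ k.
have lk0 : l%:R ^ k != 0 :> algC by rewrite expfz_neq0.
have yp : y ^+ p = a ^+ p.-1 * u.
  apply: (mulIf (expf_neq0 p lk0)); rewrite /y expr_div_n divfK ?expf_neq0 //.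
  rewrite exprMn; have -> : a ^+ p = a * a ^+ p.-1 by rewrite -exprS prednK.
  by rewrite mulrA e -exprz_exp -exprnP -mulrA mulrC (mulrC u).
have Aa := SA RS Sa; have Au := SA RS Su.
have Ay : y \in Aint by apply: (Aint_root p0); rewrite yp rpredM ?rpredX.
have nPy : ~ PI l y.
  move=> Py; have : PI l (y ^+ p) by apply: (P_X HP).
  by rewrite yp; apply: (nP_M HP); rewrite ?rpredX //; apply: (nP_X HP).
have Dy : D y.
  by move=> nu fx c1; rewrite /y fmorph_div rmorphM fmorphXz rmorph_nat Dv // (DS a).
have Fy i' : F i' y = xi ^+ i' * y.
  have Fa : F i' a = a.
    have nz : F i' z = z ^+ 1 by rewrite expr1.
    by have [q [-> ->]] := aut_Zring nz Sa; rewrite expr1.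
  by rewrite /y fmorph_div rmorphM fmorphXz rmorph_nat Fv Fa !mulrA.
pose C (a : 'I_p) := tau a ((xi ^+ i - xi ^+ j) * y).
have Azk k1 : z ^+ k1 \in Aint by rewrite rpredX // (Aint_prim_root pz).
apply: contrapT => no.
have PC (b : 'I_p) : PI l (\sum_(a < p | a != 0%N :> nat) (z ^+ a) ^+ b * C a).
  apply: contrapT => nP; apply: no; exists (tr (z ^+ b * y)).
    apply: trO; first by rewrite rpredM.
    by apply: DM => //; apply: DS; apply: (SX RS); exact: Zring_gen.
  move: nP; apply: contra_not; congr (PI l).
  rewrite trFB; last by apply: DM => //; apply: DS; apply: (SX RS); exact: Zring_gen.
  apply: eq_bigr => a' a0; rewrite /C.
  have -> : F i (z ^+ b * y) - F j (z ^+ b * y) = z ^+ b * ((xi ^+ i - xi ^+ j) * y).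
    rewrite [F i _]rmorphM [F j _]rmorphM [F i (z ^+ b)]rmorphXn [F j (z ^+ b)]rmorphXn.
    by rewrite (Fz i) (Fz j) Fy Fy; ring.
  by rewrite rmorphM rmorphXn tauz.
have i1 : 'I_p by exact: (Ordinal p1).
(* Fourier inversion over the p-th roots of unity isolates the term a = 1 from the traces of the z^b
   y. *)
have PC1 : PI l (p%:R * C (Ordinal p1)).
  have : PI l (\sum_(b < p) z ^+ (p.-1 * b) * (\sum_(a < p | a != 0%N :> nat) (z ^+ a) ^+ b * C a)).
    by apply: (P_sum HP) => b _; apply: (P_Ml HP).
  congr (PI l); under eq_bigr do rewrite mulr_sumr.
  rewrite exchange_big /= (bigD1 (Ordinal p1)) //= [X in _ + X]big1 ?addr0.
    rewrite (eq_bigr (fun=> C (Ordinal p1))); last first.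
      by move=> b _; rewrite expr1 mulrA -exprD -mulSnr prednK // exprM zp expr1n mul1r.
    by rewrite sumr_const card_ord mulr_natl.
  move=> a' /andP[a0 a1].
  have az : z ^+ (p.-1 + a') != 1.
    rewrite -(prim_order_dvd pz).
    have a2 : (1 < a')%N by rewrite ltn_neqAle lt0n a0 andbT eq_sym; apply: contraNneq a1 => e1; apply/eqP/val_inj.
    have -> : (p.-1 + a' = p + a'.-1)%N by rewrite -{1}(prednK (ltnW a2)) -addSnnS prednK.
    have a3 : (0 < a'.-1)%N by rewrite -ltnS prednK // ltnW.
    rewrite dvdn_addr // gtnNdvd //.
    by apply: leq_ltn_trans (leq_pred _) (ltn_ord a').
  transitivity ((\sum_(b < p) (z ^+ (p.-1 + a')) ^+ b) * C a').
    rewrite mulr_suml; apply: eq_bigr => b _.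
    by rewrite mulrA -!exprM -exprD mulnDl.
  have := subrX1 (z ^+ (p.-1 + a')) p; rewrite exprAC zp expr1n subrr => /esym/eqP.
  by rewrite mulf_eq0 subr_eq0 (negPf az) /= => /eqP ->; rewrite mul0r.
have Ax : (xi ^+ i - xi ^+ j) \in Aint by rewrite rpredB ?rpredX // (SA RS).
have C1 : C (Ordinal p1) = (xi ^+ i - xi ^+ j) * y.
  apply: (Dext (tau (Ordinal p1)) idfun); rewrite ?tauz ?ctau ?expr1 ?(char1 p0 cc) //.
  by apply: DM => //; apply: DB; apply: DS; exact: (SX RS).
move: PC1; rewrite C1 => /(P_prime HP _ _)[||/(P_nat pl HP)|].
- exact: rpred_nat.
- by rewrite rpredM.
- by apply/negP; rewrite -prime_coprime.
move=> /(P_prime HP Ax Ay)[|//] Pij; move/eqP: ij; apply; apply: val_inj.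
have : xi ^+ i = xi ^+ j.
  by apply: (root_uniq pl HP lp' p0 _ _ Pij); rewrite exprAC cp expr1n.
by move/eqP; rewrite (eq_prim_root_expr pxi) !modn_small // => /eqP.
Qed.
End Unramified.

(** * Kronecker-Weber for characters of odd order *)

Section KroneckerWeber.
Variables (PI : nat -> algC -> Prop) (p : nat).
Hypotheses (HPI : forall l, prime l -> prime_ideal l (PI l)) (pp : prime p) (p_odd : odd p).
Let p0 : (0 < p)%N. Proof. exact: prime_gt0. Qed.
Let p1 : (1 < p)%N. Proof. exact: prime_gt1. Qed.
Let HP := HPI pp.

Let URout c := forall l, prime l -> l != p -> UR PI l c.

(** A p-th power that is 1 modulo (1 - z)^2 is so modulo (1 - z)^p by [wild_improve_p], which is
    non-ramification at p. If c(nu) is not 1, the power nu^(p-1) fixes the p-th roots of unity and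
    is still outside the kernel, as [unramified_absurd] wants. *)
Lemma wild_trivial z c v t : p.-primitive_root z -> is_char p c -> URout c -> attached p c v ->
  Zring z t -> v ^+ p = 1 + (1 - z) ^+ 2 * t -> forall nu, c nu = 1.
Proof.
move=> pz cc ur av St Dv nu; apply/eqP/negPn/negP => c1.
have zp := prim_expr_order pz; have RS := Zring_sub p0 zp.
have Slam := wild_lamS pp pz.
have Sv : Zring z (v ^+ p).
  by rewrite Dv; apply: (SD RS); [exact: (S1 RS)|apply: (SM RS) => //; exact: (SX RS)].
have [f Sf Df] := wild_improve_p pp p_odd HP pz cc av Sv (ex_intro2 _ _ t St Dv).
have [a ca Da] := aut_root nu p0.
pose s := iaut nu p.-1.
have fs : fixU p s.
  move=> y yp; have [i ->] := prim_rootP pz yp; rewrite rmorphXn; congr (_ ^+ _).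
  have E k : iaut nu k z = z ^+ (a ^ k).
    elim: k => [|k IH]; first by rewrite expn0 expr1.
    by rewrite /= IH rmorphXn Da // -exprM -expnS.
  rewrite E; apply/eqP; rewrite -[X in _ == X]expr1 (eq_prim_root_expr pz).
  by have /eqP := Euler_exp_totient ca; rewrite totient_prime.
have cs : c s != 1.
  rewrite (char_iaut _ _ p0 cc); apply: contra c1 => /eqP c1.
  by have [_ cp _] := cc; rewrite -(cp nu) -(prednK p0) exprS c1 mulr1.
exact: (unramified_absurd HPI pp p_odd pz cc cs fs ur av Sf Df).
Qed.

Lemma URoutM c d : URout c -> URout d -> URout (fun nu => c nu * d nu).
Proof. by move=> uc ud l pl lp; apply: (UR_M HPI pl); [exact: uc|exact: ud]. Qed.

Lemma URoutX c k : URout c -> URout (fun nu => c nu ^+ k).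
Proof. by move=> uc l pl lp; apply: (UR_X HPI _ pl); exact: uc. Qed.

Lemma attachedX n c w k : attached n c w -> attached n (fun nu => c nu ^+ k) (w ^+ k).
Proof. by move=> [w0 cw]; split=> [|nu fx]; rewrite ?expf_neq0 // rmorphXn cw // exprMn. Qed.

(** By [wild_normal_form] each character carries an integer e, additive in products. As p is a
    multiple of [lam], only e modulo p counts, and a product with e + b e' divisible by p falls
    under [wild_trivial]. The powers p - 1 are harmless, the order being p. *)
Lemma wild_dependent c k nu0 : is_char p c -> is_char p k -> URout c -> URout k -> k nu0 != 1 ->
  exists t, forall nu, c nu * k nu ^+ t = 1.
Proof.
move=> cc ck uc uk k1; have [z pz] := C_prim_root_exists p0.
have zp := prim_expr_order pz; have RS := Zring_sub p0 zp.
have Slam := wild_lamS pp pz; set lam := 1 - z in Slam.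
have [w [e [t [aw St Dw]]]] := wild_normal_form pp p_odd HP pz cc.
have [v [e' [t' [av St' Dv]]]] := wild_normal_form pp p_odd HP pz ck.
have [t0 St0 Dp] := wild_p_div pp pz.
rewrite -/lam in Dw Dv Dp.
have Si := Sint RS.
have pred_trivial (d : Aut -> algC) : is_char p d -> (forall nu, d nu ^+ p.-1 = 1) -> forall nu, d nu = 1.
  by move=> [_ dp _] d1 nu; rewrite -[RHS](dp nu) -[in RHS](prednK p0) exprS d1 mulr1.
(* Otherwise [k] would itself be trivial. *)
have e'p : ~~ (p %| absz e')%N.
  apply/negP => d; move/eqP: k1; apply; apply: (pred_trivial k ck) => nu.
  have /dvdzP[q Dq] : (p%:Z %| e')%Z by [].
  apply: (wild_trivial (t := q%:~R * t0 + t') pz (is_charX _ ck) (URoutX _ uk) av).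
    by apply: (SD RS) => //; apply: (SM RS).
  by rewrite Dv Dq intrM -pmulrn Dp -/lam; ring.
have [b Hb] : exists b : nat, exists q : int, e + b%:Z * e' = q * p%:Z.
  have cop : coprimez e' p%:Z by rewrite coprimezE /= coprime_sym prime_coprime.
  have [[u1 u2] /= Du] := coprimezP _ _ cop.
  have [b [q Db]] : exists b : nat, exists q : int, - (e * u1) = q * p%:Z + b%:Z.
    exists (absz (- (e * u1) %% p%:Z)%Z), (- (e * u1) %/ p%:Z)%Z.
    by rewrite gez0_abs ?modz_ge0 ?eqz_nat -?lt0n // -divz_eq.
  exists b; have -> : b%:Z = - (e * u1) - q * p%:Z by rewrite Db; ring.
  exists (e * u2 - q * e').
  have -> : e + (- (e * u1) - q * p%:Z) * e' = e - e * (u1 * e') - q * e' * p%:Z by ring.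
  by have -> : u1 * e' = 1 - u2 * p%:Z by [rewrite -Du; ring|]; ring.
have [q Dq] := Hb.
exists b; pose d (nu : Aut) := c nu * k nu ^+ b.
have cd : is_char p d by apply: is_charM => //; exact: is_charX.
have ud : URout d by apply: URoutM => //; exact: URoutX.
apply: (pred_trivial d cd) => nu.
have adv : attached p (fun nu => d nu ^+ p.-1) (w * v ^+ b).
  have := attachedM aw (attachedX b av); congr attached; apply/funext => mu.
  by rewrite /d exprMn exprAC.
have [t1 St1 D1] : exists2 t1, Zring z t1 & (v ^+ b) ^+ p = 1 + (b%:Z * e')%:~R * lam + lam ^+ 2 * t1.
  rewrite exprAC Dv; elim: (b) => [|j [t1 St1 IH]].
    by exists 0; rewrite ?expr0 ?mul0r ?mulr0 ?addr0 //; exact: (S0 RS).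
  exists (t1 + t' + (j%:Z * e')%:~R * e'%:~R + (j%:Z * e')%:~R * lam * t' + e'%:~R * lam * t1 + lam ^+ 2 * t' * t1).
    by do ?[assumption|apply: Si|apply: (SD RS)|apply: (SM RS)|apply: (SX RS)].
  have -> : j.+1%:Z * e' = e' + j%:Z * e' by rewrite intS; ring.
  by rewrite exprS IH intrD; ring.
have Snu : is_char p (fun nu => d nu ^+ p.-1) by exact: is_charX.
apply: (wild_trivial (t := q%:~R * t0 + t + t1 + e%:~R * (b%:Z * e')%:~R + lam * (e%:~R * t1 + (b%:Z * e')%:~R * t) + lam ^+ 2 * t * t1) pz Snu (URoutX _ ud) adv).
  by do ?[assumption|apply: Si|apply: (SD RS)|apply: (SM RS)|apply: (SX RS)].
have eq0 : e%:~R * lam + (b%:Z * e')%:~R * lam = lam ^+ 2 * (q%:~R * t0) :> algC.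
  by rewrite -mulrDl -intrD Dq intrM -pmulrn Dp -/lam; ring.
rewrite exprMn Dw D1 -/lam.
transitivity (1 + (e%:~R * lam + (b%:Z * e')%:~R * lam) + lam ^+ 2 * (t + t1 + e%:~R * (b%:Z * e')%:~R + lam * (e%:~R * t1 + (b%:Z * e')%:~R * t) + lam ^+ 2 * t * t1)).
  ring.
rewrite eq0; ring.
Qed.

(** A discrete logarithm: the units modulo p^(m+2) form a cyclic group of order (p - 1) p^(m+1), and
    exponents of a generator make sense modulo p^(m+1). *)
Lemma kappa_exists m : exists k : Aut -> algC, [/\ is_char (p ^ m.+1) k,
  forall nu, fixU (p ^ m.+2) nu -> k nu = 1 & exists nu, k nu ^+ (p ^ m) != 1].
Proof.
pose q := (p ^ m.+2)%N.
have q0 : (0 < q)%N by rewrite expn_gt0 p0.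
have q1 : (1 < q)%N by rewrite -{1}(expn0 p) ltn_exp2l.
(* Cyclicity is read off the automorphism group of a cyclic p-group, p being odd. *)
have cyc : cyclic (units_Zp q).
  pose a := (Zp1 : 'I_(q.-1.+1)); have oa : #[a]%g = q by rewrite order_Zp1 prednK.
  have ca : #|<[a]>%g| = q by exact: oa.
  have pG : (p.-group <[a]>)%g by rewrite /pgroup ca pnatX pnat_id.
  have nt : (<[a]> :!=: 1)%g by rewrite -cardG_gt1 ca.
  have := cyclic_pgroup_Aut_structure pG (cycle_cyclic a) nt.
  rewrite /= ca pfactorK //= p_odd => -[_ [_ _ [_ [_ _ _ [[cA _] _ _]]]]].
  have := isog_cyclic (Zp_unit_isog a); rewrite cA.
  by rewrite oa => ->.
have /cyclicP[u Du] := cyc.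
have ou : #[u]%g = totient q by rewrite /order -Du card_units_Zp.
have [y py] := C_prim_root_exists q0.
have [z pz] : exists z : algC, (p ^ m.+1).-primitive_root z.
  by have [|z pz] := @C_prim_root_exists (p ^ m.+1); [rewrite expn_gt0 p0|exists z].
have dvd_q : (p ^ m.+1 %| totient q)%N by rewrite totient_pfactor // dvdn_mull.
have ex (nu : Aut) : exists k : nat, nu y = y ^+ (val (val (u ^+ k)%g)).
  have [a ca Da] := aut_root nu q0.
  have ua : (a%:R : 'Z_q) \is a GRing.unit by rewrite unitZpE // coprime_sym.
  have : FinRing.unit 'Z_q ua \in <[u]>%g by rewrite -Du inE.
  move=> /cycleP[k Dk]; exists k; rewrite -Dk /= Da ?(prim_expr_order py) //.
  by rewrite val_Zp_nat // (prim_expr_mod py).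
have [K DK] := choice ex.
have q2 : (Zp_trunc q).+2 = q by rewrite Zp_cast.
have pow_eq (i j : nat) : y ^+ val (val (u ^+ i)%g) = y ^+ val (val (u ^+ j)%g) -> i = j %[mod p ^ m.+1].
  have lt k : (val (val (u ^+ k)%g) < q)%N by rewrite -[X in (_ < X)%N]q2; apply: ltn_ord.
  move=> /eqP; rewrite (eq_prim_root_expr py) (modn_small (lt i)) (modn_small (lt j)) => /eqP e.
  have {e} : (u ^+ i == u ^+ j)%g by apply/eqP/val_inj/val_inj.
  rewrite eq_expg_mod_order ou => /eqP e.
  have e2 k : ((k %% totient q) %% p ^ m.+1 = k %% p ^ m.+1)%N by apply: modn_dvdm.
  by rewrite -(e2 i) e e2.
have powM (i j : nat) : y ^+ val (val (u ^+ (i + j))%g) = y ^+ (val (val (u ^+ i)%g) * val (val (u ^+ j)%g)).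
  by rewrite expgD /= -(prim_expr_mod py (_ * _)); congr (_ ^+ modn _ _).
have zq := prim_expr_order pz.
pose ka nu := z ^+ K nu.
have ka_eq (nu : Aut) j : nu y = y ^+ val (val (u ^+ j)%g) -> ka nu = z ^+ j.
  by rewrite DK => /pow_eq e; apply/eqP; rewrite (eq_prim_root_expr pz) e.
exists ka; split.
- split=> [nu mu k e|nu|].
  + rewrite /ka -exprD; apply: ka_eq; rewrite e /= DK rmorphXn DK -exprM.
    by rewrite addnC powM mulnC.
  + by rewrite /ka exprAC zq expr1n.
  exists y => nu ny; rewrite -[RHS](expr0 z); apply: ka_eq.
  by rewrite ny expg0 /= expr1.
- move=> nu fx; rewrite -[RHS](expr0 z); apply: ka_eq.
  by rewrite fx ?(prim_expr_order py) // expg0 /= expr1.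
have cu : coprime (val (val u)) q.
  have h : FinRing.uval u \is a GRing.unit by exact: (valP u).
  by rewrite -[FinRing.uval u]natr_Zp unitZpE // coprime_sym in h.
have [nu Dnu] := Qn_aut_exists cu.
exists nu; rewrite (ka_eq nu 1%N); last by rewrite Dnu ?(prim_expr_order py).
rewrite expr1 -(prim_order_dvd pz) dvdn_Pexp2l // ltnn //.
Qed.
End KroneckerWeber.

Lemma ideals_exist : exists PI : nat -> algC -> Prop, forall l, prime l -> prime_ideal l (PI l).
Proof.
have ex l : exists P : algC -> Prop, prime l -> prime_ideal l P.
  have [pl|npl] := boolP (prime l); last by exists (fun=> False).
  by have [P HP] := prime_ideal_exists pl; exists P.
by have [PI HPI] := choice ex; exists PI.
Qed.

Lemma dirichlet_ext c d : (forall nu, c nu = d nu) -> dirichlet c -> dirichlet d.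
Proof. by move=> e [M M0 cM]; exists M => // nu /cM; rewrite e. Qed.

Section KW.
Variables (PI : nat -> algC -> Prop) (p : nat).
Hypotheses (HPI : forall l, prime l -> prime_ideal l (PI l)) (pp : prime p) (p_odd : odd p).

(** Dependence is applied to the p^m-th powers, which have order dividing p; the twist by k^t then
    has order dividing p^m. *)
Lemma dirichlet_of_UR m c : is_char (p ^ m) c -> (forall l, prime l -> l != p -> UR PI l c) ->
  dirichlet c.
Proof.
elim: m c => [|m IH] c cc uc.
  by exists 1%N => // nu _; have [_ c1 _] := cc; have := c1 nu; rewrite expn0 expr1.
have [k [ck kl [nu0 k1]]] := kappa_exists pp p_odd m.
have uk l : prime l -> l != p -> UR PI l k.
  move=> pl lp; apply: (UR_dirichlet HPI pl ck _ _ kl); rewrite coprimeXr // prime_coprime // dvdn_prime2 //.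
have cp d : is_char (p ^ m.+1) d -> is_char p (fun nu => d nu ^+ (p ^ m)).
  move=> cd; apply: is_char_dvd (is_charX _ cd) _ => nu.
  by rewrite -exprM -expnSr; case: cd.
have [t Ht] := wild_dependent HPI pp p_odd (cp _ cc) (cp _ ck)
   (URoutX HPI _ uc) (URoutX HPI (p ^ m) uk) k1.
have cck : is_char (p ^ m.+1) (fun nu => c nu * k nu ^+ t) by apply: is_charM => //; exact: is_charX.
have dck : dirichlet (fun nu => c nu * k nu ^+ t).
  apply: IH.
    by apply: is_char_dvd cck _ => nu; rewrite exprMn [_ ^+ t ^+ _]exprAC Ht.
  exact: (URoutM HPI uc (URoutX HPI t uk)).
have dk : dirichlet k by exists (p ^ m.+2)%N; rewrite ?expn_gt0 ?prime_gt0.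
apply: dirichlet_ext (dirichletM dck (dirichletX (t * (p ^ m.+1).-1) dk)) => nu.
have [_ kp _] := ck; have n0 : (0 < p ^ m.+1)%N by rewrite expn_gt0 prime_gt0.
by rewrite -mulrA -exprD -mulnS prednK // mulnC exprM kp expr1n mulr1.
Qed.

(** The twist that removes ramification at l factors through Q(zeta_l), hence creates none at the
    primes other than l and p. *)
Lemma tame_reduction m c (s : seq nat) : is_char (p ^ m) c -> {in s, forall l, prime l /\ l != p} ->
  exists d, [/\ is_char (p ^ m) d, dirichlet d, {in s, forall l, UR PI l (fun nu => c nu * d nu)}
    & forall l, prime l -> l != p -> UR PI l c -> UR PI l (fun nu => c nu * d nu)].
Proof.
move=> cc; elim: s => [|l s IH] sl.
  exists (fun=> 1); split=> //.
  - split=> [nu mu ka _|nu|]; rewrite ?mulr1 ?expr1n //.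
    by exists 0.
  - by exists 1%N.
  - by move=> l pl lp; under eq_fun do rewrite mulr1.
have [|d [cd dd ds dl]] := IH; first by move=> l' ls; apply: sl; rewrite inE ls orbT.
have [pl lp] := sl l (mem_head _ _).
have co l' : prime l' -> l' != p -> coprime l' (p ^ m) by move=> pl' lp'; rewrite coprimeXr // prime_coprime // dvdn_prime2 //.
have cdc : is_char (p ^ m) (fun nu => c nu * d nu) by exact: is_charM.
have [e [ce el eu]] := tame HPI pl (co _ pl lp) cdc.
have ue l' : prime l' -> l' != p -> l' != l -> UR PI l' e.
  move=> pl' lp' ll'; apply: (UR_dirichlet HPI pl' ce (co _ pl' lp') _ el).
  by rewrite prime_coprime // dvdn_prime2 //.
have step l' : prime l' -> l' != p -> UR PI l' (fun nu => c nu * d nu) -> UR PI l' (fun nu => c nu * (d nu * e nu)).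
  move=> pl' lp' ul'; have -> : (fun nu => c nu * (d nu * e nu)) = (fun nu => c nu * d nu * e nu).
    by apply/funext => nu; rewrite mulrA.
  have [->//|ll'] := eqVneq l' l.
  by apply: (UR_M HPI pl') => //; exact: ue.
exists (fun nu => d nu * e nu); split; first exact: is_charM.
- apply: dirichletM => //; exists l => //; exact: prime_gt0.
- move=> l'; rewrite inE => /predU1P[->|l's].
    have -> : (fun nu => c nu * (d nu * e nu)) = (fun nu => c nu * d nu * e nu).
      by apply/funext => nu; rewrite mulrA.
    exact: eu.
  have [pl' lp'] : prime l' /\ l' != p by apply: sl; rewrite inE l's orbT.
  by apply: step => //; exact: ds.
by move=> l' pl' lp' ul'; apply: step => //; exact: dl.
Qed.

Lemma kronecker_weber_p m c : is_char (p ^ m) c -> dirichlet c.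
Proof.
move=> cc; have n0 : (0 < p ^ m)%N by rewrite expn_gt0 prime_gt0.
have [B B0 HB] := UR_finite HPI cc n0.
have [|d [cd dd ds dl]] := @tame_reduction m c [seq l <- primes B | l != p] cc.
  by move=> l; rewrite mem_filter mem_primes => /andP[lp /andP[pl _]].
have dcd : dirichlet (fun nu => c nu * d nu).
  apply: (dirichlet_of_UR (m := m)); first exact: is_charM.
  move=> l pl lp; have [lB|lB] := boolP (l %| B)%N.
    by apply: ds; rewrite mem_filter lp mem_primes pl B0.
  apply: dl => //; apply: HB => //; by rewrite coprimeXr // prime_coprime // dvdn_prime2 //.
apply: dirichlet_ext (dirichletM dcd (dirichletX (p ^ m).-1 dd)) => nu.
have [_ dn _] := cd; by rewrite -mulrA -exprS prednK // dn mulr1.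
Qed.
End KW.

(** Split off the power of the least prime p of n: by Bezout [c] is a combination of c^m and c^k,
    whose exponents are coprime. *)
Lemma kronecker_weber_odd n c : odd n -> is_char n c -> dirichlet c.
Proof.
have [PI HPI] := ideals_exist.
elim/ltn_ind: n c => n IH c on cc.
have n0 : (0 < n)%N by case: (n) on.
have [n1|n1] := eqVneq n 1%N.
  by exists 1%N => // nu _; have [_ c1 _] := cc; have := c1 nu; rewrite n1 expr1.
have pp : prime (pdiv n) by rewrite pdiv_prime // ltn_neqAle eq_sym n1.
set p := pdiv n in pp; pose k := (p ^ logn p n)%N.
have [m co Dn] := pfactor_coprime pp n0.
have podd : odd p by apply: contraLR on => ep; rewrite -dvdn2; apply: dvdn_trans (pdiv_dvd n); rewrite dvdn2.
have [_ cn _] := cc.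
have c1 : dirichlet (fun nu => c nu ^+ m).
  apply: (kronecker_weber_p HPI pp podd (m := logn p n)); apply: is_char_dvd (is_charX m cc) _ => nu.
  by rewrite -exprM -Dn cn.
have mn : (m < n)%N.
  rewrite [X in (_ < X)%N]Dn -[X in (X < _)%N]muln1 ltn_mul2l; apply/andP; split.
    by case: (m) Dn => // Dn; rewrite Dn mul0n in n0.
  rewrite -{1}(expn0 p) ltn_exp2l ?prime_gt1 // logn_gt0 mem_primes pp n0; exact: pdiv_dvd.
have c2 : dirichlet (fun nu => c nu ^+ k).
  apply: (IH m mn); first by move: on; rewrite {1}Dn oddM => /andP[].
  apply: is_char_dvd (is_charX k cc) _ => nu; by rewrite -exprM mulnC -Dn cn.
have k0 : (0 < k)%N by rewrite expn_gt0 prime_gt0.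
have m0 : (0 < m)%N by case: (m) Dn => // Dn; rewrite Dn mul0n in n0.
have co' : coprime m k by rewrite coprime_sym coprimeXl.
have [[u v] /= e] := coprimeP k m0 co'.
(* The factor n - 1 acts as -1 on exponents modulo n. *)
apply: dirichlet_ext (dirichletM (dirichletX u c1) (dirichletX (v * n.-1) c2)) => nu.
have e2 : (m * u = 1 + k * v)%N by rewrite mulnC [(k * v)%N]mulnC -e subnK // ltnW // -subn_gt0 e.
have e3 : (m * u + k * (v * n.-1) = 1 + n * (k * v))%N.
  by rewrite e2 mulnA -addnA -mulnS prednK // [(n * _)%N]mulnC.
by rewrite -!exprM -exprD e3 exprD expr1 exprM cn expr1n mulr1.
Qed.

(** A primitive element goes to any root in [C] of its minimal polynomial. *)
Lemma num_field_embedding (L : fieldExtType rat) (C : numClosedFieldType) :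
  exists phi : {rmorphism L -> C}, True.
Proof.
have pcL : [pchar L] =i pred0 by move=> p; rewrite pchar_lalg pchar_num.
have [w Dw] : exists w : L, {:L}%VS = <<1; w>>%VS.
  exists (separable_generator 1 {:L}); apply: eq_adjoin_separable_generator (sub1v _).
  by apply/separableP => y _; apply: pcharf0_separable.
have /polyOver1P[m Dm] := minPolyOver 1 w.
have [a ra] : exists a : C, root (map_poly ratr m) a.
  apply: closed_rootP; rewrite size_map_poly -(size_map_poly (in_alg L)) -Dm.
  by rewrite size_minPoly.
have /choice[q Dq] (x : L) : exists p : {poly rat}, x = (map_poly (in_alg L) p).[w].
  have : x \in <<1; w>>%VS by rewrite -Dw memvf.
  by case/Fadjoin1_polyP => p ->; exists p.
pose f x : C := (map_poly ratr (q x)).[a].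
have f0 (p : {poly rat}) : (map_poly (in_alg L) p).[w] = 0 -> (map_poly ratr p).[a] = 0 :> C.
  move=> /rootP rp; apply/rootP; have : (minPoly 1 w) %| map_poly (in_alg L) p.
    by apply: minPoly_dvdp rp; apply/polyOver1P; exists p.
  rewrite Dm dvdp_map -(dvdp_map (@ratr C)) => mp.
  by rewrite -dvdp_XsubCl; apply: dvdp_trans mp; rewrite dvdp_XsubCl.
have fE (x : L) (p : {poly rat}) : x = (map_poly (in_alg L) p).[w] -> f x = (map_poly ratr p).[a].
  move=> e; apply/eqP; rewrite -subr_eq0 -hornerN -hornerD -rmorphN -rmorphD; apply/eqP/f0.
  by rewrite rmorphD rmorphN hornerD hornerN -e -Dq subrr.
have fB : zmod_morphism f.
  move=> x y; rewrite (fE (x - y) (q x - q y)); first by rewrite rmorphB hornerD hornerN.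
  by rewrite rmorphB hornerD hornerN -!Dq.
have fM : monoid_morphism f.
  split=> [|x y]; first by rewrite (fE 1 1) rmorph1 hornerC.
  rewrite (fE (x * y) (q x * q y)); first by rewrite rmorphM hornerM.
  by rewrite rmorphM hornerM -!Dq.
pose aM := GRing.isZmodMorphism.Build L C f fB.
pose mM := GRing.isMonoidMorphism.Build L C f fM.
by exists (HB.pack_for {rmorphism L -> C} f aM mM).
Qed.

(** * The Kronecker-Weber theorem, up to square roots *)

Section SqrtClosed.
Variable S : algC -> Prop.
Hypotheses (SB : forall x y, S x -> S y -> S (x - y)).
Hypotheses (SM : forall x y, S x -> S y -> S (x * y)).
Hypotheses (SV : forall x, S x -> S x^-1).
Hypotheses (S_root : forall n x, (0 < n)%N -> x ^+ n = 1 -> S x).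
Hypotheses (S_sqrt : forall x, S (x ^+ 2) -> S x).

Let S1 : S 1. Proof. by apply: (S_root (n := 1)); rewrite ?expr1n. Qed.
Let S0 : S 0. Proof. by rewrite -(subrr 1); apply: SB. Qed.
Let SD x y : S x -> S y -> S (x + y).
Proof. by move=> Sx Sy; rewrite -[y]opprK; apply: SB => //; rewrite -sub0r; apply: SB. Qed.
Let S_sum (I : Type) (r : seq I) (F : I -> algC) : (forall i, S (F i)) -> S (\sum_(i <- r) F i).
Proof. by move=> SF; apply: big_ind. Qed.
Let S_nat n : S n%:R.
Proof. by elim: n => // n IH; rewrite mulrSr; apply: SD. Qed.
Let S_rat q : S (ratr q).
Proof.
have SZ (m : int) : S m%:~R.
  by case: m => n; rewrite ?NegzE ?rmorphN /=; [|rewrite -sub0r; apply: SB => //]; exact: S_nat.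
by rewrite /ratr; apply: SM => //; apply: SV.
Qed.

Lemma sqrt_closed_Cyc n x : (0 < n)%N -> Cyc n x -> S x.
Proof.
move=> n0 cx; have [z pz] := C_prim_root_exists n0.
have Sz : S z by apply: (S_root n0); apply: prim_expr_order.
have [p ->] := Cyc_poly pz cx; rewrite horner_coef; apply: S_sum => i.
apply: SM; first by rewrite coef_map; apply: S_rat.
by elim: (i : nat) => [|k IH]; rewrite ?expr0 // exprS; apply: SM.
Qed.

Lemma sqrt_closed_resolvent n c w : (0 < n)%N -> is_char n c ->
  (forall nu, fixU n nu -> nu w = c nu * w) -> S w.
Proof.
move=> n0 cc cw; have [m m2 Dn] := pfactor_coprime (isT : prime 2) n0.
have [_ cn _] := cc.
set k := logn 2 n in Dn.
have [M M0 cM] : dirichlet (fun nu => c nu ^+ (2 ^ k)).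
  apply: (@kronecker_weber_odd m); first by rewrite -coprime2n.
  by apply: is_char_dvd (is_charX _ cc) _ => nu; rewrite -exprM mulnC -Dn cn.
have : S (w ^+ (2 ^ k)).
  apply: (@sqrt_closed_Cyc (n * M)); first by rewrite muln_gt0 n0.
  move=> nu fx; rewrite rmorphXn cw ?exprMn ?cM ?mul1r //; apply: fixU_dvd fx.
    exact: dvdn_mull.
  exact: dvdn_mulr.
elim: k {Dn cM} => [|k IH]; first by rewrite expr1.
by rewrite expnSr exprM => /S_sqrt.
Qed.

Lemma sqrt_closed_abelian (L : splittingFieldType rat) (iota : {rmorphism L -> algC}) z :
  abelian 'Gal({:L} / 1) -> S (iota z).
Proof.
move=> abG; set G := 'Gal({:L} / 1)%G.
have [g Dg] : exists g : Aut -> gal_of {:L}, forall nu : Aut, g nu \in G /\ forall y, iota (g nu y) = nu (iota y).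
  suff /choice[g Dg] : forall nu : Aut, exists h : gal_of {:L}, h \in G /\ forall y, iota (h y) = nu (iota y) by exists g.
  by move=> nu; have [h Gh Dh] := gal_of_aut iota nu; exists h.
have gG nu : g nu \in G by case: (Dg nu).
have {Dg} gE nu y : iota (g nu y) = nu (iota y) by case: (Dg nu).
have gP (nu : Aut) (h : gal_of {:L}) : (forall y, iota (h y) = nu (iota y)) -> g nu = h.
  move=> Dh; apply/eqP/gal_eqP => y _; apply: (fmorph_inj iota).
  by rewrite Dh gE.
have G0 : (0 < #|G|)%N by exact: cardG_gt0.
have lin (i : Iirr G) : 'chi_i \is a linear_char by apply/char_abelianP.
pose w (i : Iirr G) := \sum_(h in G) 'chi_i (h^-1)%g * iota (h z).
have Sw i : S (w i).
  have chiN h : h \in G -> 'chi_i h ^+ #|G| = 1.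
    by move=> Gh; rewrite -lin_charX // expg_cardG // lin_char1.
  apply: (@sqrt_closed_resolvent #|G| (fun nu => 'chi_i (g nu))) => //.
    split=> [nu mu ka e|nu|].
    - rewrite mulrC -lin_charM //; congr ('chi_i _); apply: gP => y.
      by rewrite galM ?memvf // !gE e.
    - exact: chiN.
    have [t _ [ps Dps]] := algC_PET [seq iota b | b <- vbasis {:L}].
    exists t => nu nt; rewrite (_ : g nu = 1%g) ?lin_char1 //; apply: gP => y.
    rewrite gal_id (coord_vbasis (memvf y)) !rmorph_sum; apply: eq_bigr => j _.
    rewrite !rmorphZ_num rmorphM fmorph_rat; congr (_ * _).
    have : iota (vbasis {:L})`_j \in [seq iota b | b <- vbasis {:L}].
      by apply/map_f/mem_nth; rewrite size_tuple.
    rewrite Dps => /mapP[r _ ->].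
    by rewrite -horner_map nt -map_poly_comp (eq_map_poly (fmorph_rat nu)).
  move=> nu fx; rewrite rmorph_sum mulr_sumr.
  rewrite [RHS](reindex_inj (mulIg (g nu))) /=; apply: eq_big => [h|h Gh]; first by rewrite groupMr.
  rewrite rmorphM fx; last by rewrite chiN ?groupV.
  rewrite galM ?memvf // -gE mulrA; congr (_ * _).
  by rewrite !invMg !lin_charM ?groupV // mulrA (lin_charV (lin i) (gG nu)) divff ?lin_char_neq0 ?mul1r.
have : \sum_i w i = #|G|%:R * iota z.
  rewrite exchange_big /= (bigD1 1%g) //= -mulr_suml.
  (* The linear characters of an Abelian group add up to the regular character, so only h = 1
     contributes. *)
  have reg h : \sum_(i : Iirr G) 'chi_i h = #|G|%:R *+ (h == 1%g).
    rewrite -cfRegE cfReg_sum sum_cfunE; apply: eq_bigr => i _.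
    by rewrite cfunE lin_char1 ?mul1r.
  rewrite reg invg1 eqxx gal_id big1 ?addr0 // => h /andP[_ h1].
  by rewrite -mulr_suml reg invg_eq1 (negPf h1) mul0r.
have nz : #|G|%:R != 0 :> algC by rewrite pnatr_eq0 -lt0n.
move/(congr1 (fun x => #|G|%:R^-1 * x)); rewrite mulKf // => <-.
by apply: SM; [apply: SV|apply: S_sum].
Qed.
End SqrtClosed.

(** [K] is in [C] and the resolvents are in [algC]; number fields [Q] embedded in both carry
    membership across. As embeddings into [C] are unrelated to [iota], all conjugates of [z] are
    treated at once. *)
Lemma abelian_sqrt_closed (C : numClosedFieldType) (K : C -> Prop)
    (L : splittingFieldType rat) (iota : {rmorphism L -> C}) (z : L) :
  (forall x y, K x -> K y -> K (x - y)) -> (forall x y, K x -> K y -> K (x * y)) ->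
  (forall x, K x -> K x^-1) -> (forall n x, (0 < n)%N -> x ^+ n = 1 -> K x) ->
  (forall x, K (x ^+ 2) -> K x) -> abelian 'Gal({:L} / 1) -> K (iota z).
Proof.
move=> KB KM KV K_root K_sqrt abL.
(* The list [s] collects the numbers met in producing [x] by the closure operations: once [Q]
   contains them, any embedding into [C] sends the copy of [x] into [K]. *)
pose S (x : algC) := exists s : seq algC, forall (Q : fieldExtType rat)
  (QC : {rmorphism Q -> algC}) (phi : {rmorphism Q -> C}),
  (forall t, t \in s -> exists y, QC y = t) -> forall y, QC y = x -> K (phi y).
have [kappa _] := num_field_embedding L algC.
have SL y : S (kappa y).
  apply: sqrt_closed_abelian abL.
  - move=> x1 x2 [s1 H1] [s2 H2]; exists ([:: x1; x2] ++ s1 ++ s2) => Q QC phi Qs y' Dy.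
    have [y1 D1] := Qs x1 (mem_head _ _).
    have [y2 D2] : exists y, QC y = x2 by apply: Qs; rewrite !inE eqxx orbT.
    have -> : y' = y1 - y2 by apply: (fmorph_inj QC); rewrite rmorphB Dy D1 D2.
    rewrite rmorphB; apply: KB; [apply: (H1 Q QC) D1|apply: (H2 Q QC) D2] => t ts; apply: Qs.
      by rewrite !mem_cat ts orbT.
    by rewrite !mem_cat ts !orbT.
  - move=> x1 x2 [s1 H1] [s2 H2]; exists ([:: x1; x2] ++ s1 ++ s2) => Q QC phi Qs y' Dy.
    have [y1 D1] := Qs x1 (mem_head _ _).
    have [y2 D2] : exists y, QC y = x2 by apply: Qs; rewrite !inE eqxx orbT.
    have -> : y' = y1 * y2 by apply: (fmorph_inj QC); rewrite rmorphM Dy D1 D2.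
    rewrite rmorphM; apply: KM; [apply: (H1 Q QC) D1|apply: (H2 Q QC) D2] => t ts; apply: Qs.
      by rewrite !mem_cat ts orbT.
    by rewrite !mem_cat ts !orbT.
  - move=> x [s H]; exists s => Q QC phi Qs y' Dy.
    rewrite -[y']invrK fmorphV; apply: KV; apply: (H Q QC) => //.
    by rewrite fmorphV Dy invrK.
  - move=> n x n0 xn; exists [::] => Q QC phi _ y' Dy; apply: (K_root n) => //.
    by rewrite -rmorphXn; apply: (etrans _ (rmorph1 phi)); congr (phi _); apply: (fmorph_inj QC); rewrite rmorphXn Dy xn rmorph1.
  move=> x [s H]; exists s => Q QC phi Qs y' Dy; apply: K_sqrt; rewrite -rmorphXn.
  by apply: (H Q QC) => //; rewrite rmorphXn Dy.
have [r /eqP Dr] := splitting_field_normal 1 z.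
have /polyOver1P[m Dm] := minPolyOver 1 z.
have /choice[s Ds] := SL.
have [Q [QC [_ QCs]]] := galois_num_field ([seq kappa y | y <- r] ++ flatten [seq s y | y <- r]).
have [phi _] := num_field_embedding Q C.
have inQ y : y \in r -> exists x, QC x = kappa y.
  by move=> ry; apply: QCs; rewrite mem_cat map_f.
have [r' Dr'] : exists r', map QC r' = map kappa r.
  have : forall y, y \in r -> y \in r by [].
  elim: {-2}r => [|y r1 IH] r1r; first by exists [::].
  have [|r2 Dr2] := IH; first by move=> t tr; apply: r1r; rewrite inE tr orbT.
  have [x Dx] := inQ y (r1r _ (mem_head _ _)); by exists (x :: r2); rewrite /= Dx Dr2.
have inalg (A : fieldType) (E : fieldExtType rat) (f : {rmorphism E -> A}) (p : {poly rat}) :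
    map_poly f (map_poly (in_alg E) p) = map_poly ratr p.
  by rewrite -map_poly_comp; apply: eq_map_poly => a /=; rewrite rmorphZ_num rmorph1 mulr1.
have mQ : map_poly (in_alg Q) m = \prod_(y <- r') ('X - y%:P).
  apply: (map_poly_inj QC).
  rewrite inalg -(inalg _ _ kappa) -Dm Dr !rmorph_prod /=.
  transitivity (\prod_(x <- map kappa r) ('X - x%:P)).
    by rewrite big_map; apply: eq_bigr => y _; rewrite rmorphB /= map_polyX map_polyC.
  by rewrite -Dr' big_map; apply: eq_bigr => y _; rewrite rmorphB /= map_polyX map_polyC.
(* Thus [iota z] is the image under [phi] of some root in [Q] of the same minimal polynomial. *)
have : root (map_poly iota (minPoly 1 z)) (iota z) by rewrite fmorph_root root_minPoly.
rewrite Dm inalg -(inalg _ _ phi) mQ rmorph_prod /=.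
rewrite (eq_bigr (fun y => 'X - (phi y)%:P)); last by move=> y _; rewrite rmorphB /= map_polyX map_polyC.
rewrite -(big_map phi predT (fun x => 'X - x%:P)) root_prod_XsubC => /mapP[x r'x ->].
have : QC x \in map kappa r by rewrite -Dr' map_f.
case/mapP => y ry Dy; apply: (Ds y Q QC) => // t ts; apply: QCs.
by rewrite mem_cat; apply/orP; right; apply/flatten_mapP; exists y.
Qed.

(** * Lines as pairs of complex numbers *)

Section Axis.
Variable R : realType.
Local Notation C := R[i].
Implicit Types (u v c d z p q : C).

(* The reflection across a line is z |-> u * z^* + c for a unique pair (u, c);
   the line is its set of fixed points. *)
Definition axis u c : set C := [set z | z = u * z^* + c].

(** The first equation makes z -> u z^* + c an isometry, the second makes it an involution, which
    excludes glide reflections. *)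
Definition is_axis u c := u * u^* = 1 /\ u * c^* + c = 0.

Lemma conj_real z : z^* = z -> exists t : R, z = real_complex R t.
Proof. by move/CrealP/complex_realP. Qed.

Lemma conj_real_complex (t : R) : (real_complex R t)^* = real_complex R t.
Proof. by apply/CrealP/complex_realP; exists t. Qed.

Lemma conjcD (x y : C) : (x + y)^* = x^* + y^*. Proof. exact: rmorphD. Qed.
Lemma conjcN (x : C) : (- x)^* = - x^*. Proof. exact: rmorphN. Qed.
Lemma conjcM (x y : C) : (x * y)^* = x^* * y^*. Proof. exact: rmorphM. Qed.
Lemma conjcV (x : C) : (x^-1)^* = (x^*)^-1. Proof. exact: fmorphV. Qed.
Lemma conjcX (x : C) n : (x ^+ n)^* = x^* ^+ n. Proof. exact: rmorphXn. Qed.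
Lemma conjc_natr n : (n%:R : C)^* = n%:R. Proof. exact: rmorph_nat. Qed.
Lemma conjc_zero : (0 : C)^* = 0. Proof. exact: rmorph0. Qed.
Lemma conjc_one : (1 : C)^* = 1. Proof. exact: rmorph1. Qed.
Definition conjE := (conjcD, conjcN, conjcM, conjcV, conjcX, conjc_natr, conjc_zero, conjc_one,
  @conjCK C, conj_real_complex).

Lemma unit_sqrt u : u * u^* = 1 -> exists v, [/\ v ^+ 2 = u, v * v^* = 1 & v != 0].
Proof.
move=> u1; exists (sqrtC u); have e : sqrtC u ^+ 2 = u by rewrite sqrtCK.
have e1 : sqrtC u * (sqrtC u)^* = 1.
  apply/eqP; rewrite -(@pexpr_eq1 _ _ 2) ?mul_conjC_ge0 // exprMn -rmorphXn e u1 //.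
split=> //; apply/eqP => v0; move: e1; rewrite v0 mul0r => /esym/eqP; by rewrite oner_eq0.
Qed.

Lemma is_axis_neq0 u c : is_axis u c -> u != 0.
Proof. by move=> [u1 _]; apply/eqP => u0; move: u1; rewrite u0 mul0r => /esym/eqP; rewrite oner_eq0. Qed.

Lemma is_axis_conj u c : is_axis u c -> u^* = u^-1 /\ c^* = - c / u.
Proof.
move=> ax; have u0 := is_axis_neq0 ax; case: ax => u1 c1; split.
  by apply: (mulfI u0); rewrite u1 divff.
by apply: (mulfI u0); rewrite mulrCA divff // mulr1; apply/eqP; rewrite -addr_eq0 c1.
Qed.

Lemma is_axis_through u p : u * u^* = 1 -> is_axis u (p - u * p^*).
Proof. by move=> u1; split=> //; rewrite !conjE; ring: u1. Qed.

Lemma axis_line p q (u := (q - p) / (q - p)^*) (c := p - u * p^*) : p != q ->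
  [/\ is_axis u c, line p q = axis u c & reflect_across p q = fun z => u * z^* + c].
Proof.
move=> pq; have qp0 : q - p != 0 by rewrite subr_eq0 eq_sym.
have qp1 : (q - p)^* != 0 by rewrite conjC_eq0.
have qp2 : q^* - p^* != 0 by rewrite -rmorphB.
have u1 : u * u^* = 1 by rewrite /u !conjE; field; exact/andP.
split; first exact: is_axis_through.
- apply/seteqP; split=> z.
    by move=> [t ->]; rewrite /axis /= /c /u !conjE; field.
  rewrite /axis /= => Dz; have [|t Dt] := @conj_real ((z - p) / (q - p)).
    by rewrite {2}Dz /c /u !conjE; field; exact/andP.
  by exists t; rewrite -Dt divfK // addrC subrK.
by apply/funext => z; rewrite /reflect_across /c /u !conjE; field.
Qed.

(** The point c / 2, midpoint of 0 and its image, is fixed; a square root of [u] directs the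
    line. *)
Lemma line_of_axis u c : is_axis u c ->
  exists p q, [/\ p != q, line p q = axis u c, reflect_across p q = (fun z => u * z^* + c) & (q - p) / (q - p)^* = u].
Proof.
move=> ax; have [u1 c1] := ax; have [v [vu v1 v0]] := unit_sqrt u1.
have v0' : v^* != 0 by rewrite conjC_eq0.
have e : (c / 2 + v - c / 2) / (c / 2 + v - c / 2)^* = u.
  by rewrite addrAC subrr add0r; apply: (mulIf v0'); rewrite divfK // -vu expr2 -mulrA v1 mulr1.
have n0 : c / 2 != c / 2 + v by rewrite -subr_eq0 opprD addNKr oppr_eq0.
have [_ e1 e2] := axis_line n0; exists (c / 2), (c / 2 + v).
have e3 : c / 2 - u * (c / 2)^* = c.
  have -> : c / 2 - u * (c / 2)^* = c - (u * c^* + c) / 2 by rewrite !conjE; field.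
  by rewrite c1 mul0r subr0.
by split=> //; rewrite ?e1 ?e2 e e3.
Qed.

Lemma axis_inj u c v d : is_axis u c -> axis u c `<=` axis v d -> u = v /\ c = d.
Proof.
move=> /line_of_axis[p [q [pq eL _ _]]] sub.
have qp0 : (q - p)^* != 0 by rewrite conjC_eq0 subr_eq0 eq_sym.
have lp : axis u c p by rewrite -eL; exists 0; rewrite rmorph0 mul0r addr0.
have lq : axis u c q by rewrite -eL; exists 1; rewrite rmorph1 mul1r addrC subrK.
have Dp := sub _ lp; have Dq := sub _ lq; rewrite /axis /= in lp lq Dp Dq.
have uv : u = v.
  apply: (mulIf qp0); transitivity (q - p).
    by rewrite {2}lp {2}lq !conjE; ring.
  by rewrite {1}Dp {1}Dq !conjE; ring.
split=> //; apply: (addrI (u * p^*)); by rewrite -lp {1}Dp uv.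
Qed.

Lemma axis_eq u c v d : is_axis u c -> is_axis v d -> axis u c = axis v d -> u = v /\ c = d.
Proof. by move=> ax _ e; apply: axis_inj => // z; rewrite e. Qed.

Lemma line_directions p q u c r s v d :
  p != q -> r != s -> line p q = axis u c -> is_axis u c -> line r s = axis v d -> is_axis v d ->
  [/\ q - p = u * (q - p)^*, s - r = v * (s - r)^* & (q - p)^* * (s - r)^* != 0].
Proof.
move=> pq rs e1 ax1 e2 ax2.
have [ax1' e1' _] := axis_line pq; have [ax2' e2' _] := axis_line rs.
have qp0 : (q - p)^* != 0 by rewrite conjC_eq0 subr_eq0 eq_sym.
have sr0 : (s - r)^* != 0 by rewrite conjC_eq0 subr_eq0 eq_sym.
have [<- _] := axis_eq ax1' ax1 (etrans (esym e1') e1).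
have [<- _] := axis_eq ax2' ax2 (etrans (esym e2') e2).
by rewrite !divfK // mulf_neq0.
Qed.

(** [u] is the square of a unit vector directing the line, so a right angle changes its sign. *)
Lemma perpendicularP u c v d : is_axis u c -> is_axis v d ->
  perpendicular (axis u c) (axis v d) <-> u = - v.
Proof.
move=> ax1 ax2.
have key p q r s : p != q -> r != s -> axis u c = line p q -> axis v d = line r s ->
    'Re ((q - p) * (s - r)^*) = 0 <-> u = - v.
  move=> pq rs e1 e2.
  have [Du Dv n0] := line_directions pq rs (esym e1) ax1 (esym e2) ax2.
  have -> : 'Re ((q - p) * (s - r)^*) = (u + v) * ((q - p)^* * (s - r)^*) / 2.
    by rewrite ReE !conjcM conjCK {1}Du {2}Dv; ring.
  split=> [/eqP|->]; last by rewrite addNr !mul0r.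
  by rewrite mulf_eq0 invr_eq0 pnatr_eq0 orbF mulf_eq0 (negPf n0) orbF addr_eq0 => /eqP.
split=> [[p [q [r [s [pq rs e1 e2 e]]]]]|e]; first exact/(key p q r s).
have [p [q [pq e1 _ _]]] := line_of_axis ax1; have [r [s [rs e2 _ _]]] := line_of_axis ax2.
by exists p, q, r, s; split=> //; apply/(key p q r s).
Qed.

Lemma parallelP u c v d : is_axis u c -> is_axis v d ->
  parallel (axis u c) (axis v d) <-> u = v.
Proof.
move=> ax1 ax2.
have key p q r s : p != q -> r != s -> axis u c = line p q -> axis v d = line r s ->
    'Im ((q - p) * (s - r)^*) = 0 <-> u = v.
  move=> pq rs e1 e2.
  have [Du Dv n0] := line_directions pq rs (esym e1) ax1 (esym e2) ax2.
  have -> : 'Im ((q - p) * (s - r)^*) = 'i * ((v - u) * ((q - p)^* * (s - r)^*) / 2).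
    by rewrite ImE !conjcM conjCK {2}Du {1}Dv; ring.
  split=> [/eqP|->]; last by rewrite subrr !mul0r mulr0.
  rewrite mulf_eq0 (negPf (neq0Ci _)) mulf_eq0 invr_eq0 pnatr_eq0 orbF mulf_eq0 (negPf n0) orbF.
  by rewrite subr_eq0 eq_sym => /eqP.
split=> [[p [q [r [s [pq rs e1 e2 e]]]]]|e]; first exact/(key p q r s).
have [p [q [pq e1 _ _]]] := line_of_axis ax1; have [r [s [rs e2 _ _]]] := line_of_axis ax2.
by exists p, q, r, s; split=> //; apply/(key p q r s).
Qed.

Lemma reflectionP (f : set C) rho : reflection f rho <->
  exists u c, [/\ is_axis u c, f = axis u c & rho = fun z => u * z^* + c].
Proof.
split=> [[p [q [pq -> ->]]]|[u [c [ax -> ->]]]].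
  by have [ax e1 e2] := axis_line pq; do 2!eexists; split; [exact: ax|exact: e1|exact: e2].
by have [p [q [pq e1 e2 _]]] := line_of_axis ax; exists p, q; split.
Qed.
End Axis.

(** * Subfields and equations of degree at most three *)

Section Subfields.
Variable R : realType.
Local Notation C := R[i].
Implicit Types (F : set C) (u v w c d e z p q : C).

Lemma subfieldP F : subfield F <->
  [/\ F 1, forall x y, F x -> F y -> F (x - y) & forall x y, F x -> F y -> F (x / y)].
Proof.
have E x : (x \in mem F) = `[< F x >] by [].
split=> [[F1 FB FV]|[F1 FB FV]]; split.
- by move: F1; rewrite E => /asboolP.
- by move=> x y /asboolP Fx /asboolP Fy; apply/asboolP; rewrite -E; apply: FB; rewrite E.
- by move=> x y /asboolP Fx /asboolP Fy; apply/asboolP; rewrite -E; apply: FV; rewrite E.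
- by rewrite E; apply/asboolP.
- by move=> x y; rewrite !E => /asboolP Fx /asboolP Fy; apply/asboolP/FB.
- by move=> x y; rewrite !E => /asboolP Fx /asboolP Fy; apply/asboolP/FV.
Qed.

Section Ops.
Variable F : set C.
Hypothesis sF : subfield F.

Lemma subfield1 : F 1. Proof. by have /subfieldP[] := sF. Qed.
Lemma subfieldB x y : F x -> F y -> F (x - y). Proof. by have /subfieldP[_ FB _] := sF; exact: FB. Qed.
Lemma subfield_div x y : F x -> F y -> F (x / y). Proof. by have /subfieldP[_ _ FV] := sF; exact: FV. Qed.
Lemma subfield0 : F 0. Proof. by rewrite -(subrr 1); apply: subfieldB; exact: subfield1. Qed.
Lemma subfieldN x : F x -> F (- x). Proof. by rewrite -sub0r; apply: subfieldB; exact: subfield0. Qed.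
Lemma subfieldD x y : F x -> F y -> F (x + y).
Proof. by move=> Fx Fy; rewrite -[y]opprK; apply: subfieldB => //; exact: subfieldN. Qed.
Lemma subfieldV x : F x -> F x^-1. Proof. by rewrite -div1r; apply: subfield_div; exact: subfield1. Qed.
Lemma subfieldM x y : F x -> F y -> F (x * y).
Proof. by move=> Fx Fy; rewrite -[y]invrK; apply: subfield_div => //; exact: subfieldV. Qed.
Lemma subfieldX x n : F x -> F (x ^+ n).
Proof. by move=> Fx; elim: n => [|n IH]; rewrite ?expr0 ?exprS; [exact: subfield1|exact: subfieldM]. Qed.
Lemma subfield_nat n : F n%:R.
Proof. by elim: n => [|n IH]; [exact: subfield0|rewrite mulrSr; apply: subfieldD => //; exact: subfield1]. Qed.
Lemma subfield_rat a : F (ratr a).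
Proof.
have FZ (m : int) : F m%:~R.
  by case: m => n; [exact: subfield_nat|rewrite NegzE rmorphN; exact/subfieldN/subfield_nat].
by rewrite /ratr; apply: subfield_div.
Qed.
Lemma subfield_sum (I : Type) (r : seq I) (P : pred I) (f : I -> C) :
  (forall i, P i -> F (f i)) -> F (\sum_(i <- r | P i) f i).
Proof. by move=> Ff; apply: big_ind => //; [exact: subfield0|exact: subfieldD]. Qed.

Hypotheses (F2 : closed_under_roots 2 F) (F3 : closed_under_roots 3 F).

Lemma quadratic_root b c x : F b -> F c -> x ^+ 2 + b * x + c = 0 -> F x.
Proof.
move=> Fb Fc e.
have e2 : (x + b / 2) ^+ 2 = b ^+ 2 / 4 - c.
  have -> : (x + b / 2) ^+ 2 = (x ^+ 2 + b * x + c) + (b ^+ 2 / 4 - c) by field.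
  by rewrite e add0r.
rewrite -[x](addrK (b / 2)); apply: subfieldB; last by apply: subfield_div => //; exact: subfield_nat.
apply: F2 e2; apply: subfieldB => //; apply: subfield_div; [exact: subfieldX|exact: subfield_nat].
Qed.

Lemma depressed_cubic_root p q y : F p -> F q -> y ^+ 3 + p * y + q = 0 -> F y.
Proof.
move=> Fp Fq e; have F3' : F 3 by exact: subfield_nat.
have [p0|p0] := eqVneq p 0.
  apply: (@F3 (- q)); first exact: subfieldN.
  by apply/eqP; rewrite -subr_eq0 opprK -e p0 mul0r addr0.
(* Vieta's substitution [y = a - p / (3 a)] *)
have [a Da] : exists a : C, a ^+ 2 = y * a + p / 3.
  have [a Da] := @solve_monicpoly C 2 (fun i => if i == 0%N then p / 3 else y) isT.
  exists a; by rewrite Da big_ord_recl big_ord_recl big_ord0 /= expr0 expr1 mulr1 addr0 addrC.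
have a0 : a != 0.
  apply: contra_eq_neq Da => ->; rewrite expr0n mulr0 add0r eq_sym.
  by rewrite mulf_neq0 // invr_eq0 pnatr_eq0.
have Dy : y = a - p / (3 * a).
  apply: (mulIf a0); have -> : y * a = a ^+ 2 - p / 3 by rewrite Da addrK.
  by field.
have Fa : F (a ^+ 3).
  apply: (@quadratic_root q (- p ^+ 3 / 27)) => //.
    apply: subfield_div; [exact/subfieldN/subfieldX|exact: subfield_nat].
  have -> : (a ^+ 3) ^+ 2 + q * a ^+ 3 + - p ^+ 3 / 27 = a ^+ 3 * (y ^+ 3 + p * y + q).
    by rewrite Dy; field.
  by rewrite e mulr0.
have {}Fa : F a by apply: F3 Fa (erefl _).
by rewrite Dy; apply: subfieldB => //; apply: subfield_div => //; exact: subfieldM.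
Qed.

(** Leading coefficients may vanish: the degree of the equation of a fold depends on the data. *)
Lemma cubic_root a b c d x : F a -> F b -> F c -> F d ->
  ~~ [&& a == 0, b == 0, c == 0 & d == 0] ->
  a * x ^+ 3 + b * x ^+ 2 + c * x + d = 0 -> F x.
Proof.
move=> Fa Fb Fc Fd nz e.
have [a0|a0] := eqVneq a 0; last first.
  have F3' : F 3 by exact: subfield_nat.
  have Fh : F (b / (3 * a)) by apply: subfield_div => //; exact: subfieldM.
  rewrite -[x](addrK (b / (3 * a))); apply: subfieldB => //.
  pose h := b / (3 * a).
  apply: (@depressed_cubic_root (c / a - 3 * h ^+ 2) (d / a + 2 * h ^+ 3 - h * c / a)).
  - by apply: subfieldB; [exact: subfield_div|apply: subfieldM => //; exact: subfieldX].
  - apply: subfieldB; last by apply: subfield_div => //; exact: subfieldM.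
    by apply: subfieldD; [exact: subfield_div|apply: subfieldM; [exact: subfield_nat|exact: subfieldX]].
  have -> : (x + h) ^+ 3 + (c / a - 3 * h ^+ 2) * (x + h) + (d / a + 2 * h ^+ 3 - h * c / a)
          = (a * x ^+ 3 + b * x ^+ 2 + c * x + d) / a by rewrite /h; field.
  by rewrite e mul0r.
move: nz e; rewrite a0 eqxx mul0r add0r /=.
have [->|b0] := eqVneq b 0; last first.
  move=> _ e; apply: (@quadratic_root (c / b) (d / b)); try exact: subfield_div.
  have -> : x ^+ 2 + c / b * x + d / b = (b * x ^+ 2 + c * x + d) / b by field.
  by rewrite e mul0r.
rewrite mul0r add0r /=; have [->|c0] := eqVneq c 0; last first.
  move=> _ e; have -> : x = - d / c by rewrite -[d](addKr (c * x)) e addr0 opprK mulrC mulKf.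
  by apply: subfield_div => //; exact: subfieldN.
by rewrite mul0r add0r => /eqP d0 /d0.
Qed.
End Ops.
End Subfields.

Scheme constructible_point_mind := Minimality for constructible_point Sort Prop
  with constructible_line_mind := Minimality for constructible_line Sort Prop.
Combined Scheme constructible_mind from constructible_point_mind, constructible_line_mind.

(** * Equations and infinite families of folds *)

Section Folds.
Variable R : realType.
Local Notation C := R[i].
Implicit Types (F : set C) (u v w c d e z p q : C).

Lemma placesP w e p (l : set C) : is_axis w e -> places (axis w e) p l <-> l (w * p^* + e).
Proof.
move=> ax; split=> [[rho /reflectionP[u [c [ax' e1 ->]]] lp]|lp].
  by have [-> ->] := axis_eq ax ax' e1.
by exists (fun z => w * z^* + e) => //; apply/reflectionP; exists w, e.
Qed.

(** For a given [w] the condition is linear in [e], with a coefficient that vanishes when the fold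
    is perpendicular to the line. *)
Lemma axis_fold u c w e p : is_axis u c -> is_axis w e ->
  axis u c (w * p^* + e) <-> e * (w + u) = c * w + u * p - w ^+ 2 * p^*.
Proof.
move=> ax1 ax2; have u0 := is_axis_neq0 ax1; have w0 := is_axis_neq0 ax2.
have [u1 c1] := is_axis_conj ax1; have [w1 e1] := is_axis_conj ax2.
rewrite /axis /= !conjE w1 e1.
have E : (w * p^* + e - (u * (w^-1 * p + - e / w) + c)) * w =
         e * (w + u) - (c * w + u * p - w ^+ 2 * p^*) by field.
split=> e2.
  by apply/eqP; rewrite -subr_eq0 -E e2 subrr mul0r.
apply/eqP; rewrite -subr_eq0 -(inj_eq (mulIf w0)) mul0r E e2 subrr //.
Qed.

Lemma is_axis_fold u c w p : is_axis u c -> w * w^* = 1 -> w + u != 0 ->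
  is_axis w ((c * w + u * p - w ^+ 2 * p^*) / (w + u)).
Proof.
move=> ax1 w1; have u0 := is_axis_neq0 ax1; have [u1 c1] := is_axis_conj ax1 => wu0; split=> //.
have ax2 : is_axis w 0 by split; rewrite ?conjE ?mulr0 ?addr0.
have w0 := is_axis_neq0 ax2; have [w2 _] := is_axis_conj ax2.
by rewrite !conjE u1 c1 w2; field; do !(apply/andP; split); rewrite // addrC.
Qed.

Lemma infinite_folds (A : set (set C)) (w e : nat -> C) :
  (forall n, is_axis (w n) (e n)) -> (forall n, A (axis (w n) (e n))) ->
  injective (fun n => (w n, e n)) -> ~ finite_set A.
Proof.
move=> ax Aw inj /finite_seqP[s As].
have : (size [seq axis (w n) (e n) | n <- iota 0 (size s).+1] <= size s)%N.
  apply: uniq_leq_size.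
    rewrite map_inj_uniq ?iota_uniq // => m n /axis_eq[]; try exact: ax.
    by move=> e1 e2; apply: inj; rewrite e1 e2.
  by move=> _ /mapP[n _ ->]; have := Aw n; rewrite As.
by rewrite size_map size_iota ltnn.
Qed.

(** Parallel folds are translates of each other, here by multiples of the normal vector i v. *)
Lemma infinite_parallel_folds (A : set (set C)) w : w * w^* = 1 ->
  (forall e, is_axis w e -> A (axis w e)) -> ~ finite_set A.
Proof.
move=> w1 Aw; have [v [vw v1 v0]] := unit_sqrt w1.
have ax n : is_axis w ('i * v * n%:R).
  split=> //; rewrite !conjE conjCi.
  by have -> : w * (- 'i * v^* * n%:R) = - ('i * v * n%:R) * (v * v^*);
    [rewrite -vw; ring|rewrite v1 mulr1 addNr].
apply: (infinite_folds (w := fun=> w) (e := fun n => 'i * v * n%:R)) => // [n|m n [] /mulfI e]; first exact: Aw.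
by apply/eqP; rewrite -(eqr_nat C); apply/eqP/e; rewrite mulf_neq0 // neq0Ci.
Qed.

Lemma infinite_unit_folds (A : set (set C)) u (e : C -> C) :
  (forall w, w * w^* = 1 -> w != u -> is_axis w (e w) /\ A (axis w (e w))) -> ~ finite_set A.
Proof.
(* The Cayley transform turns the integers into infinitely many numbers of modulus 1. *)
move=> Aw; pose w n : C := (n%:R + 'i) / (n%:R - 'i).
have n0 n : n%:R - 'i != 0 :> C.
  apply/eqP => e1; have : n%:R ^+ 2 + 1 = (n%:R - 'i) * (n%:R + 'i) :> C by rewrite -subr_sqr sqrCi opprK.
  by rewrite e1 mul0r -natrX natr1 => /eqP; rewrite pnatr_eq0.
have n1 n : n%:R + 'i != 0 :> C.
  by rewrite -conjC_eq0 !conjE conjCi.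
have w1 n : w n * (w n)^* = 1 by rewrite /w !conjE conjCi opprK; field; rewrite n0 n1.
have winj : injective w.
  move=> m n e1; apply/eqP; rewrite -(eqr_nat C) -subr_eq0.
  have : w m * ((m%:R - 'i) * (n%:R - 'i)) = w n * ((m%:R - 'i) * (n%:R - 'i)) by rewrite e1.
  have -> : w m * ((m%:R - 'i) * (n%:R - 'i)) = (m%:R + 'i) * (n%:R - 'i) by rewrite /w; field.
  have -> : w n * ((m%:R - 'i) * (n%:R - 'i)) = (n%:R + 'i) * (m%:R - 'i) by rewrite /w; field.
  move=> e2; have : (m%:R - n%:R) * (2 * 'i) = 0 :> C.
    transitivity ((n%:R + 'i) * (m%:R - 'i) - (m%:R + 'i) * (n%:R - 'i) : C); first by ring.
    by rewrite e2 subrr.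
  by move/eqP; rewrite !mulf_eq0 pnatr_eq0 (negPf (neq0Ci _)) !orbF.
have [N wN] : exists N, forall n, w (N + n)%N != u.
  have [[N DN]|H] := pselect (exists N, w N = u); last by exists 0%N => n; apply/eqP => e1; apply: H; exists n.
  exists N.+1 => n; rewrite -DN (inj_eq winj) addSn; lia.
apply: (infinite_folds (w := fun n => w (N + n)%N) (e := fun n => e (w (N + n)%N))).
- by move=> n; have [] := Aw _ (w1 (N + n)%N) (wN n).
- by move=> n; have [] := Aw _ (w1 (N + n)%N) (wN n).
by move=> m n [/winj/addnI].
Qed.
End Folds.

(** * The roots of unity zeta_n *)

Section Zeta.
Variable R : realType.
Local Notation C := R[i].

Lemma zetaX n k : zeta R n ^+ k = Complex (cos (2 * pi / n%:R * k%:R)) (sin (2 * pi / n%:R * k%:R)).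
Proof.
elim: k => [|k IH]; first by rewrite mulr0 cos0 sin0.
have -> : 2 * pi / n%:R * k.+1%:R = 2 * pi / n%:R * k%:R + 2 * pi / n%:R :> R.
  by rewrite -natr1; ring.
rewrite exprSr IH cosD sinD /zeta.
by apply/eqP; rewrite eq_complex /=; apply/andP; split; apply/eqP => //; rewrite addrC.
Qed.

Lemma zeta0 : zeta R 0 = 1.
Proof. by rewrite /zeta invr0 mulr0 cos0 sin0. Qed.

(** If the order were m < n, then x = pi m / n would satisfy cos (2 x) = 1, hence sin x = 0,
    although 0 < x < pi. *)
Lemma zeta_primitive n : (0 < n)%N -> n.-primitive_root (zeta R n).
Proof.
move=> n0; have n0' : n%:R != 0 :> R by rewrite pnatr_eq0 -lt0n.
have z1 : zeta R n ^+ n = 1.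
  by rewrite zetaX divfK // mulr_natl cos2pi sin2pi.
have [m pm mn] := prim_order_exists n0 z1.
have [e|mn'] := eqVneq m n; first by rewrite -{1}e.
have lt_mn : (m < n)%N by rewrite ltn_neqAle mn' dvdn_leq.
have m0 := prim_order_gt0 pm.
have := prim_expr_order pm; rewrite zetaX => -[e _].
have xpos : 0 < pi * (m%:R / n%:R) :> R by rewrite mulr_gt0 ?pi_gt0 // divr_gt0 ?ltr0n.
have : 0 < sin (pi * (m%:R / n%:R) : R).
  apply: sin_gt0_pi; rewrite xpos /= -[X in _ < X]mulr1 ltr_pM2l ?pi_gt0 //.
  by rewrite ltr_pdivrMr ?ltr0n // mul1r ltr_nat.
have e2 : 2 * pi / n%:R * m%:R = (pi * (m%:R / n%:R)) *+ 2 :> R by rewrite -mulr_natl; ring.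
move: e; rewrite e2 cos_mulr2n => e.
have : cos (pi * (m%:R / n%:R)) ^+ 2 + sin (pi * (m%:R / n%:R)) ^+ 2 = 1 :> R by exact: cos2Dsin2.
set c := cos _ in e *; set s := sin _ => e3 s0.
have : s ^+ 2 = 0 by rewrite -mulr_natl in e; lra.
by move/eqP; rewrite sqrf_eq0 gt_eqF.
Qed.

Lemma zeta_neq1 n : (1 < n)%N -> zeta R n != 1.
Proof.
move=> n1; rewrite -[zeta R n]expr1 -(prim_order_dvd (zeta_primitive (ltnW n1))).
by rewrite dvdn1 gtn_eqF.
Qed.

Lemma root_of_unity_zeta n x : (0 < n)%N -> x ^+ n = 1 -> exists k, x = zeta R n ^+ k.
Proof. by move=> n0 /(prim_rootP (zeta_primitive n0))[k ->]; exists k. Qed.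

Lemma conj_zeta n : Num.conj (zeta R n) = (zeta R n)^-1.
Proof.
have [->|n0] := posnP n; first by rewrite zeta0 rmorph1 invr1.
have z0 : zeta R n != 0 by rewrite (prim_root_eq0 (zeta_primitive n0)) -lt0n.
apply: (mulfI z0); rewrite divff // /zeta.
apply/eqP; rewrite eq_complex /= -!expr2 mulrN opprK -expr2 cos2Dsin2 eqxx /=.
by rewrite mulrN [cos _ * sin _]mulrC addNr.
Qed.
End Zeta.

(** * Origami numbers lie in every closed subfield *)

Section ORPsub.
Variables (R : realType) (F : set R[i]).
Local Notation C := R[i].
Hypotheses (sF : subfield F) (F2 : closed_under_roots 2 F) (F3 : closed_under_roots 3 F).
Hypotheses (Fc : closed_under_conj F) (Fz : forall n, F (zeta R n)).

Definition axis_over (f : set C) := exists u c, [/\ is_axis u c, F u, F c & f = axis u c].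

Let FB := @subfieldB _ _ sF. Let FD := @subfieldD _ _ sF. Let FM := @subfieldM _ _ sF.
Let FV := @subfield_div _ _ sF. Let FN := @subfieldN _ _ sF. Let FX := @subfieldX _ _ sF.

Lemma axis_over_line p q : F p -> F q -> p != q -> axis_over (line p q).
Proof.
move=> Fp Fq pq; have [ax e _] := axis_line pq.
exists ((q - p) / (q - p)^*), (p - (q - p) / (q - p)^* * p^*).
have Fu : F ((q - p) / (q - p)^*) by apply: FV; [exact: FB|exact/Fc/FB].
by split=> //; apply: FB => //; apply: FM => //; exact: Fc.
Qed.

(** Eliminating [e] between the two fold equations gives the cubic of coefficients k3, k2, k1, k0 in
    [w]. If it vanishes identically, every [w] of modulus 1 other than - u yields a fold; if w + u
    and w + v both vanish, every admissible [e] does. *)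
Lemma axis_over_O6 p q (l m f : set C) : F p -> F q -> axis_over l -> axis_over m ->
  finite_set (O6_folds p q l m) -> O6_folds p q l m f -> axis_over f.
Proof.
move=> Fp Fq [u [c [ax1 Fu Fc1 ->]]] [v [d [ax2 Fv Fd ->]]] fin [].
case=> rho Hrho lp; have [w [e [ax Df Drho]]] := (reflectionP f rho).1 Hrho.
rewrite Df => /(placesP _ _ ax) mq; rewrite Drho in lp.
move/(axis_fold _ ax1 ax): lp => e1; move/(axis_fold _ ax2 ax): mq => e2.
have [w1 _] := ax; have w0 := is_axis_neq0 ax.
have Fp' := Fc Fp; have Fq' := Fc Fq.
have Fe : F w -> F e.
  move=> Fw; have [wu|wu] := eqVneq (w + u) 0; last first.
    rewrite -[e](mulfK wu) e1; apply: FV; last exact: FD.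
    by apply: FB; [apply: FD; exact: FM|apply: FM => //; exact: FX].
  have [wv|wv] := eqVneq (w + v) 0; last first.
    rewrite -[e](mulfK wv) e2; apply: FV; last exact: FD.
    by apply: FB; [apply: FD; exact: FM|apply: FM => //; exact: FX].
  case: (infinite_parallel_folds w1 _ fin) => e' ax'; split.
    by apply/(placesP _ _ ax')/(axis_fold _ ax1 ax'); rewrite -e1 wu !mulr0.
  by apply/(placesP _ _ ax')/(axis_fold _ ax2 ax'); rewrite -e2 wv !mulr0.
suff Fw : F w by exists w, e; split=> //; exact: Fe.
pose k3 := q^* - p^*; pose k2 := c - v * p^* - d + u * q^*.
pose k1 := u * p + v * c - v * q - u * d; pose k0 := u * v * (p - q).
have K x : k3 * x ^+ 3 + k2 * x ^+ 2 + k1 * x + k0 =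
    (c * x + u * p - x ^+ 2 * p^*) * (x + v) - (d * x + v * q - x ^+ 2 * q^*) * (x + u).
  by rewrite /k3 /k2 /k1 /k0; ring.
have [/and4P[/eqP z3 /eqP z2 /eqP z1 /eqP z0]|nz] := boolP [&& k3 == 0, k2 == 0, k1 == 0 & k0 == 0].
  pose E x := (c * x + u * p - x ^+ 2 * p^*) / (x + u).
  case: (infinite_unit_folds (u := - u) (e := E) _ fin) => x x1; rewrite -addr_eq0 => xu.
  have ax' := is_axis_fold p ax1 x1 xu; split=> //; split.
    by apply/(placesP _ _ ax')/(axis_fold _ ax1 ax'); rewrite /E divfK.
  apply/(placesP _ _ ax')/(axis_fold _ ax2 ax').
  apply: (mulIf xu); rewrite mulrAC divfK //; apply/eqP; rewrite -subr_eq0 -K z3 z2 z1 z0.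
  by rewrite !mul0r !addr0.
apply: (@cubic_root _ F sF F2 F3 k3 k2 k1 k0) nz _.
- exact: FB.
- by apply: FD; [apply: FB => //; apply: FB => //|]; exact: FM.
- by apply: FB; [apply: FB; [apply: FD|]|]; exact: FM.
- by apply: FM; [exact: FM|exact: FB].
by rewrite K -e1 -e2; ring.
Qed.

Lemma perpendicular_axis (f l : set C) : perpendicular f l -> exists w e, is_axis w e /\ f = axis w e.
Proof.
move=> [p [q [r [s [pq _ -> _ _]]]]]; have [ax e _] := axis_line pq.
by do 2!eexists; split; first exact: ax.
Qed.

Lemma O_RP_sub : O_RP R `<=` F.
Proof.
have [P _] : (forall z, constructible_point z -> F z) /\ (forall l, constructible_line l -> axis_over l); last exact: P.
apply: constructible_mind => //.
- exact: subfield0.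
- exact: subfield1.
- move=> l m p _ [u [c [ax1 Fu Fc1 ->]]] _ [v [d [ax2 Fv Fd ->]]].
  move/(parallelP ax1 ax2)/eqP; rewrite -subr_eq0 /axis /= => uv e1 e2.
  have : p^* = (d - c) / (u - v).
    apply: (mulIf uv); rewrite divfK // mulrC mulrBl.
    by apply/eqP; rewrite subr_eq -[d - c + _]addrAC [d + _]addrC -e2 {2}e1 addrK.
  by move=> e; rewrite -[p]conjCK e; apply/Fc/FV; exact: FB.
- by move=> p q _ Fp _ Fq pq; exact: axis_over_line.
- move=> p q _ Fp _ Fq pq.
  have qp1 : (q - p)^* != 0 by rewrite conjC_eq0 subr_eq0 eq_sym.
  have qp2 : q^* - p^* != 0 by rewrite -conjcN -conjcD.
  exists (- (q - p) / (q - p)^*), ((q * q^* - p * p^*) / (q - p)^*).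
  have Fqp := Fc (FB Fq Fp); have Fq' := Fc Fq; have Fp' := Fc Fp.
  split.
  + have qp3 : q - p != 0 by rewrite subr_eq0 eq_sym.
    split; rewrite !conjE; field; rewrite ?qp3 ?andbT //; exact: qp2.
  + by apply: FV => //; apply/FN/FB.
  + by apply: FV => //; apply: FB; exact: FM.
  apply/seteqP; split=> z; rewrite /perp_bisector /axis /= => e.
    have {}e : (z - p) * (z - p)^* = (z - q) * (z - q)^* by rewrite -!normCK e.
    apply: (mulIf qp1); apply/eqP; rewrite -subr_eq0; apply/eqP.
    transitivity ((z - p) * (z - p)^* - (z - q) * (z - q)^*); last by rewrite e subrr.
    by rewrite !conjE; field.
  apply/eqP; rewrite -(@eqrXn2 _ 2) //; apply/eqP; rewrite !normCK.
  apply/eqP; rewrite -subr_eq0; apply/eqP.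
  transitivity ((z - (- (q - p) / (q - p)^* * z^* + (q * q^* - p * p^*) / (q - p)^*)) * (q - p)^*).
    by rewrite !conjE; field.
  by rewrite -e subrr mul0r.
- move=> l m f _ [u [c [ax1 Fu Fc1 ->]]] _ [v [d [ax2 Fv Fd ->]]] lm [rho Hrho im].
  have [w [e [ax Df Drho]]] := (reflectionP f rho).1 Hrho.
  have w0 := is_axis_neq0 ax; have v0 := is_axis_neq0 ax2.
  have [p [q [pq eL _ _]]] := line_of_axis ax1.
  have fold z : axis u c z -> e * (w + v) = d * w + v * c - (w ^+ 2 - u * v) * z^*.
    move=> lz; have /(axis_fold z ax2 ax) -> : axis v d (w * z^* + e).
      by rewrite -im; exists z => //; rewrite Drho.
    by rewrite {1}lz; ring.
  have lp : axis u c p by rewrite -eL; exists 0; rewrite rmorph0 mul0r addr0.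
  have lq : axis u c q by rewrite -eL; exists 1; rewrite rmorph1 mul1r addrC subrK.
  have qp1 : q^* - p^* != 0 by rewrite -conjcN -conjcD conjC_eq0 subr_eq0 eq_sym.
  (* [fold] holds at two distinct points of the line, so the coefficient of the conjugate of z is
     zero. *)
  have Dw : w ^+ 2 = u * v.
    apply/eqP; rewrite -subr_eq0 -(inj_eq (mulIf qp1)) mul0r mulrBr.
    rewrite subr_eq0; apply/eqP/oppr_inj/(addrI (d * w + v * c)).
    by rewrite -(fold _ lp) -(fold _ lq).
  have {fold} := fold _ lp; rewrite Dw subrr mul0r subr0 => e1.
  have Fw : F w by apply: F2 Dw; exact: FM.
  exists w, e; split=> //.
  (* If w + v = 0, the two lines coincide. *)
  have [wv|wv] := eqVneq (w + v) 0; last first.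
    by rewrite -[e](mulfK wv) e1; apply: FV; [apply: FD; exact: FM|exact: FD].
  case: lm; have Ew : w = - v by apply/eqP; rewrite -addr_eq0 wv.
  have <- : v = u by apply: (mulfI v0); rewrite -expr2 -sqrrN -Ew Dw mulrC.
  have <- // : d = c.
  apply/esym/eqP; rewrite -subr_eq0 -(inj_eq (mulfI v0)) mulr0; apply/eqP.
  by transitivity (d * w + v * c); [rewrite Ew; ring|rewrite -e1 wv mulr0].
- move=> p l f _ Fp _ [u [c [ax1 Fu Fc1 ->]]] fp perp.
  have [w [e [ax Df]]] := perpendicular_axis perp; rewrite {}Df in fp perp *.
  move/(perpendicularP ax ax1): perp => Dw; exists w, e; rewrite Dw; split=> //; rewrite -?Dw //.
    by rewrite Dw; exact: FN.
  have -> : e = p - w * p^* by rewrite [X in X - _]fp addrC addKr.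
  by rewrite Dw; apply: FB => //; apply: FM; [exact: FN|exact: Fc].
- move=> p q l f _ Fp _ Fq pq _ [u [c [ax1 Fu Fc1 ->]]] _ [fp [rho Hrho lq]].
  have [w [e [ax Df Drho]]] := (reflectionP f rho).1 Hrho.
  rewrite Drho in lq; rewrite Df in fp; move/(axis_fold q ax1 ax): lq => e1.
  have De : e = p - w * p^* by rewrite [X in X - _]fp addrC addKr.
  have Fp' := Fc Fp; have Fq' := Fc Fq.
  suff Fw : F w by exists w, e; split=> //; rewrite De; apply: FB => //; exact: FM.
  (* Substituting e = p - w p^* leaves an equation of degree 2, whose leading coefficient is nonzero
     as p and q differ. *)
  apply: (@cubic_root _ F sF F2 F3 0 (q^* - p^*) (p - u * p^* - c) (u * (p - q))).
  + exact: (subfield0 sF).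
  + exact: FB.
  + by apply: FB => //; apply: FB => //; exact: FM.
  + by apply: FM => //; exact: FB.
  + by rewrite -conjcN -conjcD conjC_eq0 subr_eq0 [q == p]eq_sym (negPf pq) andbF.
  transitivity (e * (w + u) - (c * w + u * q - w ^+ 2 * q^*)); first by rewrite De; ring.
  by rewrite e1 subrr.
- by move=> p q l m f _ Fp _ Fq _ Fl _ Fm; exact: axis_over_O6.
- move=> l p m f _ [u [c [ax1 Fu Fc1 ->]]] _ Fp _ [v [d [ax2 Fv Fd ->]]] fin [perp].
  have [w [e [ax Df]]] := perpendicular_axis perp; rewrite {}Df in perp *.
  move/(placesP _ _ ax)/(axis_fold p ax2 ax) => e1.
  move/(perpendicularP ax ax1): perp => Dw; have Fw : F w by rewrite Dw; exact: FN.
  exists w, e; split=> //; have [w1 _] := ax.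
  have [wv|wv] := eqVneq (w + v) 0; last first.
    rewrite -[e](mulfK wv) e1; apply: FV; last exact: FD.
    by apply: FB; [apply: FD; exact: FM|apply: FM; [exact: FX|exact: Fc]].
  case: (infinite_parallel_folds w1 _ fin) => e' ax'; split; first exact/perpendicularP.
  by apply/(placesP _ _ ax')/(axis_fold _ ax2 ax'); rewrite -e1 wv !mulr0.
move=> n A B k n3 _ [c [r [r0 DB]]] _ FA B0 B1.
have z1 : zeta R n - 1 != 0 by rewrite subr_eq0 zeta_neq1 // ltnW.
have Fr : F r.
  (* The side common to both polygons determines the n-gon, given zeta_n. *)
  have -> : r = (A 1%N - A 0%N) / (zeta R n - 1).
    by rewrite -B0 -B1 !DB expr0 expr1; field.
  by apply: FV; apply: FB; [apply: FA; lia|exact: FA|exact: Fz|exact: (subfield1 sF)].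
have FB' j : F (B j).
  rewrite DB; apply: FD; last by apply: FM => //; exact: FX.
  have -> : c = B 0%N - r by rewrite DB expr0 mulr1 addrK.
  by rewrite B0; apply: FB => //; exact: FA.
apply: axis_over_line => //; rewrite !DB (inj_eq (addrI c)) (inj_eq (mulfI r0)) exprS.
have zk : zeta R n ^+ k != 0.
  by rewrite expf_neq0 // (prim_root_eq0 (@zeta_primitive R n _)) -?lt0n; apply: leq_trans n3.
by rewrite -[X in X != _]mul1r (inj_eq (mulIf zk)) eq_sym -subr_eq0.
Qed.
End ORPsub.

(** * Constructions *)

Section Constructions.
Variable R : realType.
Local Notation C := R[i].
Implicit Types (u v w c d e z p q x y : C).
Local Notation CP := (@constructible_point R).
Local Notation CL := (@constructible_line R).

(* u is the square of a unit vector directing a constructible line. *)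
Definition direction u := exists c, is_axis u c /\ CL (axis u c).

Lemma direction_unit u : direction u -> u * u^* = 1.
Proof. by move=> [c [[]]]. Qed.

Lemma direction_points p q : CP p -> CP q -> p != q -> direction ((q - p) / (q - p)^*).
Proof.
move=> Pp Pq pq; have [ax e _] := axis_line pq; eexists; split; first exact: ax.
by rewrite -e; exact: O1.
Qed.

Lemma perp_through u c p : is_axis u c -> CL (axis u c) -> CP p -> CL (axis (- u) (p - (- u) * p^*)).
Proof.
move=> ax Lu Pp; have [u1 _] := ax.
have ax' : is_axis (- u) (p - (- u) * p^*) by apply: is_axis_through; rewrite conjcN mulrNN.
apply: (O4 Pp Lu); last exact/perpendicularP.
by rewrite /axis /=; ring.
Qed.

Lemma directionN u : direction u -> direction (- u).
Proof.
move=> [c [ax Lu]]; have [u1 _] := ax; eexists; split; last exact: (perp_through ax Lu (Given0 R)).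
by apply: is_axis_through; rewrite conjcN mulrNN.
Qed.

(** A parallel is a perpendicular to a perpendicular. *)
Lemma line_through u p : direction u -> CP p -> CL (axis u (p - u * p^*)).
Proof.
by move=> /directionN[c [ax Lu]] Pp; have := perp_through ax Lu Pp; rewrite opprK.
Qed.

Lemma intersection u v p q z : direction u -> direction v -> CP p -> CP q -> u != v ->
  z - p = u * (z - p)^* -> z - q = v * (z - q)^* -> CP z.
Proof.
move=> du dv Pp Pq uv e1 e2.
have ax1 := is_axis_through p (direction_unit du).
have ax2 := is_axis_through q (direction_unit dv).
apply: (LI (line_through du Pp) (line_through dv Pq)).
- by move/(parallelP ax1 ax2) => uv'; rewrite uv' eqxx in uv.
- by rewrite /axis /= -[LHS](subrK p) {1}e1 conjcD conjcN; ring.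
by rewrite /axis /= -[LHS](subrK q) {1}e2 conjcD conjcN; ring.
Qed.

(** Through 0, the lines of directions u and v are exchanged by z -> w z^*. *)
Lemma direction_bisector u v w : direction u -> direction v -> u != v -> w ^+ 2 = u * v -> direction w.
Proof.
move=> du dv uv Dw; have u1 := direction_unit du; have v1 := direction_unit dv.
have w1 : w * w^* = 1.
  apply/eqP; rewrite -(@pexpr_eq1 _ _ 2) ?mul_conjC_ge0 // exprMn -conjcX Dw conjcM.
  by rewrite mulrACA u1 v1 mulr1.
have ax (t : C) : t * t^* = 1 -> is_axis t 0 by move=> t1; split=> //; rewrite conjc_zero mulr0 addr0.
have L t : direction t -> CL (axis t 0).
  by move=> dt; have := line_through dt (Given0 R); rewrite conjc_zero mulr0 subr0.
have w0 := is_axis_neq0 (ax _ w1).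
have swap a b : a * a^* = 1 -> b * b^* = 1 -> w ^+ 2 = a * b -> forall z, axis a 0 z -> axis b 0 (w * z^*).
  move=> a1 b1 ab z; rewrite /axis /= !addr0 => Dz.
  rewrite conjcM conjCK {2}Dz; apply: (mulfI w0).
  have -> : w * (b * (w^* * (a * z^*))) = w * w^* * (a * b) * z^* by ring.
  by rewrite w1 mul1r -ab; ring.
exists 0; split; first exact: ax.
apply: (O3 (L _ du) (L _ dv)).
  by move=> e; case: (axis_eq (ax _ u1) (ax _ v1) e) => e' _; rewrite e' eqxx in uv.
exists (fun z => w * z^* + 0); first by apply/reflectionP; exists w, 0; split=> //; exact: ax.
apply/seteqP; split=> [_ [z Dz <-]|z Dz]; rewrite ?addr0; first exact: (swap u v).
exists (w * z^*); first by apply: (swap v u) => //; rewrite mulrC.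
by rewrite addr0 conjcM conjCK mulrA w1 mul1r.
Qed.

Lemma direction1 : direction 1.
Proof.
have := direction_points (Given0 R) (Given1 R); rewrite subr0 conjc_one divr1; apply.
by rewrite eq_sym oner_eq0.
Qed.

Let directionN1 : direction (- 1).
Proof. exact/directionN/direction1. Qed.

Let one_neq_N1 : (1 : C) != -1.
Proof. by rewrite -addr_eq0 -(natrD _ 1 1) pnatr_eq0. Qed.

Let directioni : direction 'i.
Proof. by apply: (direction_bisector direction1 directionN1) => //; rewrite sqrCi mul1r. Qed.

Let i_neq1 : ('i : C) != 1.
Proof. by apply: contraNneq one_neq_N1 => e; rewrite -(sqrCi C) e expr1n. Qed.

Let i_neqN1 : ('i : C) != -1.
Proof. by apply: contraNneq one_neq_N1 => e; rewrite -[X in _ == X](sqrCi C) e sqrrN expr1n. Qed.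

(** The directions 1, -1 and ['i] are those of horizontal, vertical and first diagonal lines;
    coordinates are moved about by intersecting these. *)
Lemma real_diag x : CP x -> x^* = x -> CP (x + 'i * x).
Proof.
move=> Px rx; apply: (intersection directionN1 directioni Px (Given0 R)).
- by rewrite eq_sym.
- by rewrite !conjE conjCi rx; ring.
by rewrite !conjE conjCi rx; ring: (sqrCi C).
Qed.

Lemma real_to_imag x : CP x -> x^* = x -> CP ('i * x).
Proof.
move=> Px rx; apply: (intersection direction1 directionN1 (real_diag Px rx) (Given0 R)) => //.
  by rewrite !conjE conjCi rx; ring.
by rewrite !conjE conjCi rx; ring.
Qed.

Lemma point_of_reals x y : CP x -> CP y -> x^* = x -> y^* = y -> CP (x + 'i * y).
Proof.
move=> Px Py rx ry; apply: (intersection directionN1 direction1 Px (real_to_imag Py ry)).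
- by rewrite eq_sym.
- by rewrite !conjE conjCi rx ry; ring.
by rewrite !conjE conjCi rx ry; ring.
Qed.

Lemma reals_of_point x y : CP (x + 'i * y) -> x^* = x -> y^* = y -> CP x /\ CP y.
Proof.
move=> P rx ry; split.
  apply: (intersection directionN1 direction1 P (Given0 R)).
  - by rewrite eq_sym.
  - by rewrite !conjE conjCi rx ry; ring.
  by rewrite !conjE rx; ring.
have Pi : CP ('i * y).
  apply: (intersection direction1 directionN1 P (Given0 R)) => //.
    by rewrite !conjE conjCi rx ry; ring.
  by rewrite !conjE conjCi ry; ring.
have Pd : CP (y + 'i * y).
  apply: (intersection direction1 directioni Pi (Given0 R)).
  - by rewrite eq_sym.
  - by rewrite !conjE conjCi ry; ring.
  by rewrite !conjE conjCi ry; ring: (sqrCi C).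
apply: (intersection directionN1 direction1 Pd (Given0 R)).
- by rewrite eq_sym.
- by rewrite !conjE conjCi ry; ring.
by rewrite !conjE ry; ring.
Qed.

(** The diagonal through x + i y meets the real axis at x - y. *)
Lemma real_sub x y : CP x -> CP y -> x^* = x -> y^* = y -> CP (x - y).
Proof.
move=> Px Py rx ry; apply: (intersection directioni direction1 (point_of_reals Px Py rx ry) (Given0 R)) => //.
  by rewrite !conjE conjCi rx ry; ring: (sqrCi C).
by rewrite !conjE rx ry; ring.
Qed.

Let i2 : ('i : C) ^+ 2 = -1. Proof. exact: sqrCi. Qed.

(** Similar triangles: the line from 0 to 1 + i y meets the vertical through x at height x y. *)
Lemma real_mul x y : CP x -> CP y -> x^* = x -> y^* = y -> CP (x * y).
Proof.
move=> Px Py rx ry; have P1 := point_of_reals (Given1 R) Py (@conjc_one R) ry.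
have n0 : 1 + 'i * y != 0.
  apply/eqP => e; have : (1 + 'i * y) + (1 + 'i * y)^* = 0 by rewrite e conjc_zero addr0.
  rewrite !conjE conjCi ry => /eqP.
  have -> : 1 + 'i * y + (1 + - 'i * y) = 2 by ring.
  by rewrite pnatr_eq0.
have n1 : 1 - 'i * y != 0 by move: n0; rewrite -conjC_eq0 !conjE conjCi ry mulNr.
have n0' : 0 != 1 + 'i * y by rewrite eq_sym.
have := direction_points (Given0 R) P1 n0'; rewrite subr0 !conjE conjCi ry mulNr => du.
have P : CP (x + 'i * (x * y)).
  apply: (intersection du directionN1 (Given0 R) Px).
  - apply/eqP => /(congr1 (fun z => z * (1 - 'i * y))); rewrite divfK // mulN1r opprB.
    move=> e; have : 2 = 0 :> C by transitivity ((1 + 'i * y) - ('i * y - 1)); [ring|rewrite e subrr].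
    by move/eqP; rewrite pnatr_eq0.
  - by rewrite !conjE conjCi rx ry; field.
  by rewrite !conjE conjCi rx ry; ring.
by have [] := reals_of_point P rx _; rewrite // conjcM rx ry.
Qed.

(** The line from 0 to x + i meets the vertical through 1 at height 1 / x. *)
Lemma real_inv x : CP x -> x^* = x -> x != 0 -> CP x^-1.
Proof.
move=> Px rx x0; have P1 := point_of_reals Px (Given1 R) rx (@conjc_one R); rewrite mulr1 in P1.
have n0 : x + 'i != 0.
  apply/eqP => e; have : (x + 'i) + (x + 'i)^* = 0 by rewrite e conjc_zero addr0.
  rewrite !conjE conjCi rx => /eqP.
  have -> : x + 'i + (x + - 'i) = 2 * x by ring.
  by rewrite mulf_eq0 pnatr_eq0 (negPf x0).
have n1 : x - 'i != 0 by move: n0; rewrite -conjC_eq0 !conjE conjCi rx.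
have n0' : 0 != x + 'i by rewrite eq_sym.
have := direction_points (Given0 R) P1 n0'; rewrite subr0 !conjE conjCi rx => du.
have P : CP (1 + 'i * x^-1).
  apply: (intersection du directionN1 (Given0 R) (Given1 R)).
  - apply/eqP => /(congr1 (fun z => z * (x - 'i))); rewrite divfK // mulN1r opprB.
    move=> e; have : 2 * x = 0 by transitivity ((x + 'i) - ('i - x)); [ring|rewrite e subrr].
    by move/eqP; rewrite mulf_eq0 pnatr_eq0 (negPf x0).
  - by rewrite !conjE conjCi rx; field; exact/andP.
  by rewrite !conjE conjCi rx; ring.
by have [] := reals_of_point P (@conjc_one R) _; rewrite // conjcV rx.
Qed.

Lemma real_opp x : CP x -> x^* = x -> CP (- x).
Proof. by move=> Px rx; rewrite -sub0r; apply: real_sub => //; [exact: Given0|exact: conjc_zero]. Qed.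

Lemma real_add x y : CP x -> CP y -> x^* = x -> y^* = y -> CP (x + y).
Proof.
by move=> Px Py rx ry; rewrite -[y]opprK; apply: real_sub => //; [exact: real_opp|rewrite conjcN ry].
Qed.

Lemma rect z : exists x y, [/\ z = x + 'i * y, x^* = x & y^* = y].
Proof. by exists ('Re z), ('Im z); split; [exact: Crect|exact/conj_Creal/Creal_Re|exact/conj_Creal/Creal_Im]. Qed.

Lemma O_RP_conj : closed_under_conj (O_RP R).
Proof.
move=> z; have [x [y [-> rx ry]]] := rect z => P; have [Px Py] := reals_of_point P rx ry.
have -> : (x + 'i * y)^* = x + 'i * (- y) by rewrite !conjE conjCi rx ry; ring.
by apply: point_of_reals => //; [exact: real_opp|rewrite conjcN ry].
Qed.

Lemma O_RP_subfield : subfield (O_RP R).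
Proof.
have B z w : CP z -> CP w -> CP (z - w).
  have [x [y [-> rx ry]]] := rect z => /reals_of_point/(_ rx ry)[Px Py].
  have [a [b [-> ra rb]]] := rect w => /reals_of_point/(_ ra rb)[Pa Pb].
  have -> : x + 'i * y - (a + 'i * b) = x - a + 'i * (y - b) by ring.
  by apply: point_of_reals; [exact: real_sub|exact: real_sub| |]; rewrite !conjE ?rx ?ra ?ry ?rb.
have M z w : CP z -> CP w -> CP (z * w).
  have [x [y [-> rx ry]]] := rect z => /reals_of_point/(_ rx ry)[Px Py].
  have [a [b [-> ra rb]]] := rect w => /reals_of_point/(_ ra rb)[Pa Pb].
  have -> : (x + 'i * y) * (a + 'i * b) = x * a - y * b + 'i * (x * b + y * a) by ring: i2.
  have H s t : CP s -> CP t -> s^* = s -> t^* = t -> CP (s * t) /\ (s * t)^* = s * t.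
    by move=> Ps Pt rs rt; rewrite conjcM rs rt; split=> //; exact: real_mul.
  have [P1 r1] := H _ _ Px Pa rx ra; have [P2 r2] := H _ _ Py Pb ry rb.
  have [P3 r3] := H _ _ Px Pb rx rb; have [P4 r4] := H _ _ Py Pa ry ra.
  apply: point_of_reals; [exact: real_sub|exact: real_add| |].
    by rewrite conjcD conjcN r1 r2.
  by rewrite conjcD r3 r4.
apply/subfieldP; split; [exact: Given1|exact: B|] => z w Pz Pw.
have [->|w0] := eqVneq w 0; first by rewrite invr0 mulr0; exact: Given0.
have w0' : w^* != 0 by rewrite conjC_eq0.
have -> : z / w = z * w^* * (w * w^*)^-1 by rewrite invfM mulrACA divff // mulr1.
have Pw' := O_RP_conj Pw.
apply: (M _ _ (M _ _ Pz Pw')); apply: real_inv; first exact: M.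
  by rewrite conjcM conjCK mulrC.
by rewrite mulf_neq0.
Qed.
End Constructions.

(** * Square roots, cube roots and roots of unity by folding *)

Section Roots.
Variable R : realType.
Local Notation C := R[i].
Implicit Types (u v w c d e z p q x y a r s : C).
Local Notation CP := (@constructible_point R).
Local Notation CL := (@constructible_line R).
Let sK := O_RP_subfield R.
Let CB x y : CP x -> CP y -> CP (x - y) := @subfieldB _ _ sK x y.
Let CD x y : CP x -> CP y -> CP (x + y) := @subfieldD _ _ sK x y.
Let CM x y : CP x -> CP y -> CP (x * y) := @subfieldM _ _ sK x y.
Let CV x y : CP x -> CP y -> CP (x / y) := @subfield_div _ _ sK x y.
Let CN x : CP x -> CP (- x) := @subfieldN _ _ sK x.
Let Cn n : CP n%:R := @subfield_nat _ _ sK n.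

Lemma O_RP_i : CP 'i.
Proof. by have := real_to_imag (Given1 R) (@conjc_one R); rewrite mulr1. Qed.
Let Ci := O_RP_i.

(** Points can be reflected, by way of the foot of the perpendicular, and the images of 0 and 1 are
    e and w + e. *)
Lemma line_coefficients w e : is_axis w e -> CL (axis w e) -> CP w /\ CP e.
Proof.
move=> ax Lw; have w0 := is_axis_neq0 ax; have [w1 e1] := is_axis_conj ax.
have refl z : CP z -> CP (w * z^* + e).
  move=> Pz; have Pm : CP ((z + (w * z^* + e)) / 2).
    have [u1 _] := ax.
    have ax' : is_axis (- w) (z - (- w) * z^*) by apply: is_axis_through; rewrite conjcN mulrNN.
    apply: (LI Lw (perp_through ax Lw Pz)).
    - move/(parallelP ax ax')/eqP; rewrite -addr_eq0 -mulr2n mulrn_eq0 /=; exact/negP.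
    - by rewrite /axis /= !conjE e1 w1; field.
    by rewrite /axis /= !conjE e1 w1; field.
  have -> : w * z^* + e = 2 * ((z + (w * z^* + e)) / 2) - z by field.
  by apply: CB => //; exact: CM.
have Pe : CP e by have := refl 0 (Given0 R); rewrite conjc_zero mulr0 add0r.
split=> //; have := refl 1 (Given1 R); rewrite conjc_one mulr1 => Pwe.
by rewrite -[w](addrK e); exact: CB.
Qed.

Lemma direction_O_RP w : direction w -> CP w.
Proof. by move=> [e [ax /(line_coefficients ax)[]]]. Qed.

(** Unless u = -1, the number 1 + u bisects the angle between 1 and u, so its line has direction
    u. *)
Lemma unit_direction u : CP u -> u * u^* = 1 -> direction u.
Proof.
move=> Pu u1; have ax : is_axis u 0 by split; rewrite ?conjE ?mulr0 ?addr0.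
have u0 := is_axis_neq0 ax; have [u2 _] := is_axis_conj ax.
have [->|uN1] := eqVneq u (-1); first exact/directionN/direction1.
have n0 : 1 + u != 0 by rewrite addrC addr_eq0.
have n0' : 0 != 1 + u by rewrite eq_sym.
have := direction_points (Given0 R) (CD (Given1 R) Pu) n0'; rewrite subr0 !conjE u2.
have -> // : (1 + u) / (1 + u^-1) = u.
by field; rewrite u0 addrC n0.
Qed.

Lemma unit_sqrt_O_RP w : CP (w ^+ 2) -> w * w^* = 1 -> CP w.
Proof.
move=> P w1; have [/eqP|w2] := eqVneq (w ^+ 2) 1.
  by rewrite sqrf_eq1 => /orP[/eqP->|/eqP->]; [exact: Given1|exact/CN/Given1].
apply: direction_O_RP; apply: (direction_bisector (u := w ^+ 2) _ (direction1 R) w2).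
  by apply: unit_direction => //; rewrite conjcX -exprMn w1 expr1n.
by rewrite mulr1.
Qed.

Lemma real_shift_neq0 r : r^* = r -> (r + 'i != 0) /\ (r - 'i != 0).
Proof.
move=> rr; have n0 : r + 'i != 0.
  apply/eqP => e; have e' : (r + 'i)^* = 0 by rewrite e conjc_zero.
  have : 2 * 'i = 0 :> C.
    by transitivity ((r + 'i) - (r + 'i)^*); [rewrite !conjE conjCi rr; ring|rewrite e' e subrr].
  by move/eqP; rewrite mulf_eq0 pnatr_eq0 (negPf (neq0Ci _)).
by split=> //; move: n0; rewrite -conjC_eq0 !conjE conjCi rr.
Qed.

Let axis_real : is_axis (1 : C) 0.
Proof. by split; rewrite ?conjE ?mulr1 ?mulr0 ?addr0. Qed.
Let i2 : ('i : C) ^+ 2 = -1. Proof. exact: sqrCi. Qed.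
Let i0 : ('i : C) != 0. Proof. exact: neq0Ci. Qed.

(** The folds of O5 are the tangents through [p] to the parabola of focus [q] and directrix the real
    axis. With q = i a and p = i (a - 1) / 2 their slopes are 1 / r and - 1 / r if r is nonzero,
    whence w = (r + i) / (r - i) and its inverse. *)
Lemma real_sqrt_O_RP r : CP (r ^+ 2) -> r^* = r -> CP r.
Proof.
move=> Pa rr; have [a Da] : exists a, a = r ^+ 2 by exists (r ^+ 2).
rewrite -Da in Pa; have [n0 n1] := real_shift_neq0 rr.
have ra : a^* = a by rewrite Da conjcX rr.
have a1 : a + 1 = (r + 'i) * (r - 'i) by rewrite Da; ring: i2.
pose p : C := 'i * (a - 1) / 2; pose q : C := 'i * a.
have Pp : CP p by apply: CV => //; apply: CM => //; apply: CB => //; exact: Given1.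
have Pq : CP q by exact: CM.
have pq : p != q.
  rewrite -subr_eq0; have -> : p - q = - 'i * (a + 1) / 2 by rewrite /p /q; field.
  by rewrite a1 !mulf_neq0 ?oppr_eq0 ?invr_eq0 ?pnatr_eq0.
have L1 : CL (axis 1 0).
  by have := line_through (direction1 R) (Given0 R); rewrite conjc_zero mulr0 subr0.
have rp : p^* = - p by rewrite /p !conjE conjCi ra; ring.
have rq : q^* = - q by rewrite /q !conjE conjCi ra; ring.
pose w1 : C := (r + 'i) / (r - 'i); pose w2 : C := (r - 'i) / (r + 'i).
have foldsE f : O5_folds p q (axis 1 0) f -> exists w, f = axis w (p - w * p^*) /\ (w - w1) * (w - w2) = 0.
  move=> [fp [rho Hrho lq]]; have [w [e [ax Df Drho]]] := (reflectionP f rho).1 Hrho.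
  rewrite Drho in lq; move/(axis_fold q axis_real ax): lq => e1.
  rewrite Df in fp; have De : e = p - w * p^* by rewrite [X in X - _]fp addrC addKr.
  exists w; rewrite -De; split=> //.
  have a10 : a + 1 != 0 by rewrite a1 mulf_neq0.
  have n2 : 'i * (a + 1) != 0 by rewrite mulf_neq0.
  apply: (mulfI n2); rewrite mulr0.
  transitivity (2 * (q - w ^+ 2 * q^* - e * (w + 1))); last by rewrite e1 mul0r add0r mul1r subrr mulr0.
  have -> : (w - w1) * (w - w2) = w ^+ 2 - 2 * (a - 1) / (a + 1) * w + 1.
    have -> : a - 1 = ((r + 'i) ^+ 2 + (r - 'i) ^+ 2) / 2 by rewrite Da; field: i2.
    by rewrite a1 /w1 /w2; field; rewrite n0 n1.
  by rewrite De rp rq /p /q; field.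
have w11 : w1 * w1^* = 1 by rewrite /w1 !conjE conjCi rr opprK; field; rewrite n0 n1.
pose e := p - w1 * p^*.
have ax : is_axis w1 e by exact: is_axis_through.
have fin : finite_set (O5_folds p q (axis 1 0)).
  apply: (@sub_finite_set _ _ [set axis w1 (p - w1 * p^*); axis w2 (p - w2 * p^*)]); last exact: finite_set2.
  move=> f /foldsE[w [-> /eqP]]; rewrite mulf_eq0 !subr_eq0 => /orP[/eqP->|/eqP->]; by [left|right].
have L : CL (axis w1 e).
  apply: (O5 Pp Pq pq L1 fin); split; first by rewrite /axis /e /=; ring.
  apply/(placesP _ _ ax)/(axis_fold _ axis_real ax); rewrite /e rp rq /p /q /w1 Da.
  by field: i2.
have [Pw _] := line_coefficients ax L.
have w1N1 : w1 - 1 != 0.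
  have -> : w1 - 1 = 2 * 'i / (r - 'i) by rewrite /w1; field.
  by rewrite !mulf_neq0 ?invr_eq0 ?pnatr_eq0.
have -> : r = 'i * (w1 + 1) / (w1 - 1).
  by apply: (mulIf w1N1); rewrite divfK // /w1; field.
by apply: CV; [apply: CM => //; apply: CD|apply: CB] => //; exact: Given1.
Qed.
Lemma finite_cubic_roots s : finite_set [set w : C | w ^+ 3 = s].
Proof.
have [rs Drs] := closed_field_poly_normal ('X^3 - s%:P : {poly C}).
apply: (@sub_finite_set _ _ [set` rs]); last exact: finite_seq.
move=> w /= Dw; have : root ('X^3 - s%:P) w by rewrite rootE !hornerE Dw subrr.
rewrite Drs rootZ ?root_prod_XsubC //.
by rewrite lead_coef_eq0 -size_poly_eq0 size_XnsubC.
Qed.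

(** The points -1 and 1 go onto the perpendicular lines through 0 of directions - v and v, with v^2
    = - s. Half the sum of the two fold equations reads e u = v and half their difference e v = -
    u^2, hence u^3 = s. *)
Lemma unit_cbrt_O_RP w : CP (w ^+ 3) -> w * w^* = 1 -> CP w.
Proof.
move=> P w1; pose s := w ^+ 3.
have s1 : s * s^* = 1 by rewrite /s conjcX -exprMn w1 expr1n.
have Ns1 : (- s) * (- s)^* = 1 by rewrite conjcN mulrNN.
have [v [Dv v1 v0]] := unit_sqrt Ns1.
have dv : direction v.
  by apply: unit_direction => //; apply: unit_sqrt_O_RP => //; rewrite Dv; exact: CN.
have ax0 u : u * u^* = 1 -> is_axis u 0 by move=> u1; split; rewrite ?conjE ?mulr0 ?addr0.
have L u : direction u -> CL (axis u 0).
  by move=> du; have := line_through du (Given0 R); rewrite conjc_zero mulr0 subr0.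
have Nv1 : (- v) * (- v)^* = 1 by rewrite conjcN mulrNN.
have foldsE u e : is_axis u e -> e * (u + - v) = v + u ^+ 2 -> e * (u + v) = v - u ^+ 2 ->
    u ^+ 3 = s /\ e = v / u.
  move=> ax e1 e2; have u0 := is_axis_neq0 ax.
  have n2 : (2 : C) != 0 by rewrite pnatr_eq0.
  have De : e = v / u.
    apply: (mulIf u0); rewrite divfK //; apply: (mulfI n2).
    by transitivity (e * (u + - v) + e * (u + v)); [ring|rewrite e1 e2; ring].
  split=> //; have : e * v = - u ^+ 2.
    by apply: (mulfI n2); transitivity (e * (u + v) - e * (u + - v)); [ring|rewrite e1 e2; ring].
  rewrite De => /(congr1 (fun z => z * u)); have -> : v / u * v * u = v ^+ 2 by field.
  by rewrite Dv mulNr => /oppr_inj ->; ring.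
have fin : finite_set (O6_folds (-1) 1 (axis (- v) 0) (axis v 0)).
  apply: (@sub_finite_set _ _ ((fun u => axis u (v / u)) @` [set u : C | u ^+ 3 = s])).
    move=> f [[rho Hrho lp] mq]; have [u [e [ax Df Drho]]] := (reflectionP f rho).1 Hrho.
    rewrite Drho in lp; rewrite Df in mq *; move/(placesP _ _ ax): mq => mq.
    move/(axis_fold _ (ax0 _ Nv1) ax): lp; move/(axis_fold _ (ax0 _ v1) ax): mq.
    rewrite conjcN conjc_one !mul0r !add0r !mulr1 => e2 e1.
    have e1' : e * (u + - v) = v + u ^+ 2 by rewrite e1; ring.
    by have [Du ->] := foldsE u e ax e1' e2; exists u.
  exact/finite_image/finite_cubic_roots.
have w0 := is_axis_neq0 (ax0 _ w1); have [w2 _] := is_axis_conj (ax0 _ w1).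
have [v2 _] := is_axis_conj (ax0 _ v1).
have v2s : v ^+ 2 = - w ^+ 3 by rewrite Dv.
have ax : is_axis w (v / w).
  split=> //; rewrite !conjE v2 w2.
  have -> : w * (v^-1 / w^-1) + v / w = (w ^+ 3 + v ^+ 2) / (v * w) by field; rewrite v0 w0.
  by rewrite v2s addrN mul0r.
have Lw : CL (axis w (v / w)).
  apply: (O6 (CN (Given1 R)) (Given1 R) (L _ (directionN dv)) (L _ dv) fin); split.
    apply/(placesP _ _ ax)/(axis_fold _ (ax0 _ Nv1) ax).
    by apply: (mulIf w0); rewrite conjcN conjc_one mulrAC divfK //; ring: v2s.
  apply/(placesP _ _ ax)/(axis_fold _ (ax0 _ v1) ax).
  by apply: (mulIf w0); rewrite conjc_one mulrAC divfK //; ring: v2s.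
by have [] := line_coefficients ax Lw.
Qed.

(** Beloch's construction: the folds are common tangents to the parabolas of focus i and directrix
    Im z = -1, and of focus - a and directrix Re z = a. The tangents of slope m are y = m x - m^2
    and y = m x - a / m, so that m^3 = a. *)
Lemma real_cbrt_O_RP r : CP (r ^+ 3) -> r^* = r -> CP r.
Proof.
move=> Pa rr; have [a Da] : exists a, a = r ^+ 3 by exists (r ^+ 3).
rewrite -Da in Pa; have ra : a^* = a by rewrite Da conjcX rr.
have [r0|r0] := eqVneq r 0; first by rewrite r0; exact: Given0.
have a0 : a != 0 by rewrite Da expf_neq0.
have [n0 n1] := real_shift_neq0 rr.
have ax1 : is_axis (1 : C) (- 'i - 1 * (- 'i)^*) by apply: is_axis_through; rewrite conjc_one mulr1.
have ax2 : is_axis (- 1 : C) (a - (- 1) * a^*) by apply: is_axis_through; rewrite conjcN conjc_one mulrNN mulr1.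
have L1 := line_through (direction1 R) (CN Ci).
have L2 := line_through (directionN (direction1 R)) Pa.
have E1 : - 'i - 1 * (- 'i)^* = - 2 * 'i :> C by rewrite conjcN conjCi; ring.
have E2 : a - (- 1) * a^* = 2 * a by rewrite ra; ring.
rewrite E1 in ax1 L1; rewrite E2 in ax2 L2.
have Pq := CN Pa.
have n2 : (2 : C) != 0 by rewrite pnatr_eq0.
have fin : finite_set (O6_folds 'i (- a) (axis 1 (- 2 * 'i)) (axis (- 1) (2 * a))).
  pose W t : C := (1 + t) / (1 - t).
  apply: (@sub_finite_set _ _ ((fun t => axis (W t) ('i * (W t - 1) ^+ 2 / (W t + 1))) @` [set t : C | t ^+ 3 = - 'i * a])).
    move=> f [[rho Hrho lp] mq]; have [w [e [ax Df Drho]]] := (reflectionP f rho).1 Hrho.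
    rewrite Drho in lp; rewrite Df in mq *; move/(placesP _ _ ax): mq => mq.
    move/(axis_fold _ ax1 ax): lp; move/(axis_fold _ ax2 ax): mq.
    rewrite conjcN conjCi ra => e2 e1.
    have e3 : 'i * (w - 1) ^+ 3 = a * (w + 1) ^+ 3.
      transitivity (e * (w + 1) * (w - 1)); first by rewrite e1; ring.
      by transitivity (e * (w - 1) * (w + 1)); [ring|rewrite e2; ring].
    have w1 : w + 1 != 0.
      rewrite addr_eq0; apply/eqP => Dw; move: e3; rewrite Dw addNr expr0n mulr0 => /eqP.
      have -> : (- 1 - 1 : C) = - 2 by ring.
      by rewrite mulf_eq0 (negPf i0) expf_eq0 oppr_eq0 (negPf n2) andbF.
    exists ((w - 1) / (w + 1)) => /=.
      rewrite expr_div_n; apply: (mulIf (expf_neq0 3 w1)); rewrite divfK ?expf_neq0 //.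
      by rewrite -mulrA -e3; ring: i2.
    have -> : W ((w - 1) / (w + 1)) = w.
      rewrite /W; have -> : 1 - (w - 1) / (w + 1) = 2 / (w + 1) by field.
      have -> : 1 + (w - 1) / (w + 1) = 2 * w / (w + 1) by field.
      by field.
    by congr axis; apply: (mulIf w1); rewrite e1 divfK //; ring.
  exact/finite_image/finite_cubic_roots.
have m0 : 1 - 'i * r != 0.
  have -> : 1 - 'i * r = - 'i * (r + 'i) by ring: i2.
  by rewrite mulf_neq0 ?oppr_eq0.
have p0 : 1 + 'i * r != 0.
  have -> : 1 + 'i * r = 'i * (r - 'i) by ring: i2.
  by rewrite mulf_neq0.
pose w := (1 + 'i * r) / (1 - 'i * r).
have w1 : w * w^* = 1.
  rewrite /w !conjE conjCi rr; have -> : 1 - - 'i * r = 1 + 'i * r by ring.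
  have -> : 1 + - 'i * r = 1 - 'i * r by ring.
  by rewrite mulrA divfK // divff.
have ax : is_axis w (r - w * r^*) by exact: is_axis_through.
have Lw : CL (axis w (r - w * r^*)).
  apply: (O6 Ci Pq L1 L2 fin); split.
    apply/(placesP _ _ ax)/(axis_fold _ ax1 ax); rewrite conjCi rr /w.
    by field: i2.
  apply/(placesP _ _ ax)/(axis_fold _ ax2 ax); rewrite conjcN ra rr /w Da.
  by field: i2.
have [Pw _] := line_coefficients ax Lw.
have wp : w + 1 != 0.
  have -> : w + 1 = 2 / (1 - 'i * r) by rewrite /w; field.
  by rewrite mulf_neq0 ?invr_eq0.
have -> : r = - 'i * (w - 1) / (w + 1).
  by apply: (mulIf wp); rewrite divfK // /w; field: i2.
by apply: CV; [apply: CM; [exact: CN|apply: CB]|apply: CD] => //; exact: Given1.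
Qed.
Lemma norm_conj z : (`|z| : C)^* = `|z|.
Proof. exact/conj_Creal/normr_real. Qed.

Lemma norm_O_RP z : CP z -> CP `|z|.
Proof.
move=> Pz; apply: real_sqrt_O_RP (norm_conj z); rewrite normCK.
by apply: CM => //; exact: O_RP_conj.
Qed.

(** A complex root is the product of its modulus and a number of modulus 1, roots of the modulus and
    of the unit part of the given number. *)
Lemma O_RP_roots n : (0 < n)%N ->
  (forall r, CP (r ^+ n) -> r^* = r -> CP r) -> (forall w, CP (w ^+ n) -> w * w^* = 1 -> CP w) ->
  closed_under_roots n (O_RP R).
Proof.
move=> n0 real_root unit_root z w Pz Dw.
have [->|w0] := eqVneq w 0; first exact: Given0.
have m0 : (`|w| : C) != 0 by rewrite normr_eq0.
have Pm : CP `|w| by apply: real_root (norm_conj w); rewrite -normrX Dw; exact: norm_O_RP.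
rewrite -[w](divfK m0); apply: CM => //; apply: unit_root.
  by rewrite expr_div_n Dw -normrX Dw; apply: CV => //; exact: norm_O_RP.
by rewrite conjcM conjcV norm_conj mulrACA -invfM -normCK expr2 divff // mulf_neq0.
Qed.

Lemma O_RP_sqrt : closed_under_roots 2 (O_RP R).
Proof. by apply: O_RP_roots; [|exact: real_sqrt_O_RP|exact: unit_sqrt_O_RP]. Qed.

Lemma O_RP_cbrt : closed_under_roots 3 (O_RP R).
Proof. by apply: O_RP_roots; [|exact: real_cbrt_O_RP|exact: unit_cbrt_O_RP]. Qed.

(** A line gives the square of its unit direction, so two consecutive sides of the n-gon, which
    differ by a rotation by [z], give z^2; a square root remains to be taken. *)
Lemma zeta_descent n : (3 <= n)%N -> CP (zeta R n.+1) -> CP (zeta R n).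
Proof.
move=> n3 Pz; set z := zeta R n; set z' := zeta R n.+1 in Pz.
have n0 : (0 < n)%N by apply: leq_trans n3.
have z1 : z - 1 != 0 by rewrite subr_eq0 zeta_neq1 // ltnW.
have z1' : z' - 1 != 0 by rewrite subr_eq0 zeta_neq1 // ltnS.
(* Radius and center 1 - r make the n-gon start with the side from 1 to z' of the unit (n+1)-gon. *)
pose r := (z' - 1) / (z - 1); pose B k := 1 - r + r * z ^+ k.
have r0 : r != 0 by rewrite mulf_neq0 ?invr_eq0.
have z0 : z != 0 by rewrite (prim_root_eq0 (zeta_primitive R n0)) -lt0n.
have L k : CL (line (B k) (B k.+1)).
  apply: (@RPA R n (fun k => 0 + 1 * z' ^+ k) B k n3).
  - by exists 0, 1; rewrite oner_eq0.
  - by exists (1 - r), r.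
  - by move=> j _; rewrite add0r mul1r; exact: (subfieldX sK).
  - by rewrite /B !expr0; ring.
  by rewrite /B !expr1 /r; field.
have BB k : B k.+1 - B k = r * z ^+ k * (z - 1) by rewrite /B exprS; ring.
have BB0 k : B k.+1 - B k != 0 by rewrite BB; apply: mulf_neq0 z1; apply: mulf_neq0 r0 _; exact: expf_neq0.
have P k : CP ((B k.+1 - B k) / (B k.+1 - B k)^*).
  have Bk : B k != B k.+1 by rewrite eq_sym -subr_eq0.
  have [ax e _] := axis_line Bk; have := L k; rewrite e => /(line_coefficients ax)[].
  by [].
apply: (@O_RP_sqrt (z ^+ 2)) (erefl _).
have -> : z ^+ 2 = (B 2%N - B 1%N) / (B 2%N - B 1%N)^* / ((B 1%N - B 0%N) / (B 1%N - B 0%N)^*).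
  have key (x y t s a : C) : x != 0 -> y != 0 -> t != 0 -> s != 0 -> a != 0 ->
      a ^+ 2 = x * a * y / (t * a^-1 * s) / (x * y / (t * s)).
    by move=> x0 y0 t0 s0 a0; field; rewrite s0 t0 y0 x0 a0.
  clearbody r; rewrite (BB 1%N) (BB 0%N) expr0 expr1 mulr1 !conjcM conj_zeta -/z.
  by apply: key; rewrite ?conjC_eq0.
by apply: CV; exact: P.
Qed.

Lemma zeta_O_RP n : CP (zeta R n).
Proof.
have pow2 k : CP (zeta R (2 ^ k)).
  elim: k => [|k IH]; first by rewrite expn0 -[zeta R 1]expr1 (prim_expr_order (zeta_primitive R _)) //; exact: Given1.
  have n0 : (0 < 2 ^ k.+1)%N by rewrite expn_gt0.
  have pz := zeta_primitive R n0.
  have [j Dj] : exists j, zeta R (2 ^ k.+1) ^+ 2 = zeta R (2 ^ k) ^+ j.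
    apply: root_of_unity_zeta; first by rewrite expn_gt0.
    by rewrite -exprM -expnS (prim_expr_order pz).
  by apply: (@O_RP_sqrt (zeta R (2 ^ k) ^+ j)) Dj; exact: (subfieldX sK).
have down m k : (3 <= m)%N -> CP (zeta R (m + k)) -> CP (zeta R m).
  by move=> m3; elim: k => [|k IH]; rewrite ?addn0 // addnS => /zeta_descent -/(_ (leq_trans m3 (leq_addr _ _))).
case: n => [|[|[|n]]].
- by rewrite zeta0; exact: Given1.
- exact: (pow2 0%N).
- exact: (pow2 1%N).
have le : (n.+3 <= 2 ^ n.+3)%N by rewrite ltnW // ltn_expl.
by apply: (@down _ (2 ^ n.+3 - n.+3)%N) => //; rewrite subnKC.
Qed.
End Roots.

(** * Cyclotomic fields are Abelian *)

Section Cyclotomic.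
Variable R : realType.

Lemma zeta_Q_Ab n : Q_Ab R (zeta R n).
Proof.
wlog n0 : n / (0 < n)%N.
  case: n => [|n] H; last exact: H.
  have -> : zeta R 0 = zeta R 1 by rewrite zeta0 -[RHS]expr1 (prim_expr_order (zeta_primitive R _)).
  exact: H.
(* The group enters through its order n: [L] is generated by a primitive n-th root of unity.
   Automorphisms raise it to powers, hence commute. *)
have [L galL [LC _ [w [pw defL] _]]] := group_num_field_exists (Zp_group n).
rewrite /= card_Zp // in pw.
have actw (g : gal_of {:L}) (q : {poly rat}) x :
    g (map_poly (in_alg L) q).[x] = (map_poly (in_alg L) q).[g x].
  rewrite -horner_map -map_poly_comp; congr _.[_]; apply: eq_map_poly => a /=.
  by rewrite rmorphZ_num rmorph1 mulr1 alg_num_field.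
have abL : abelian 'Gal({:L} / 1).
  apply/centsP => g _ h _; apply/eqP/gal_eqP => v _.
  have /Fadjoin1_polyP[q ->] : v \in <<1; w>>%VS by rewrite defL memvf.
  rewrite !galM ?memvf // !actw; congr _.[_].
  have pow (f : gal_of {:L}) : exists i, f w = w ^+ i.
    have : f w ^+ n = 1 by rewrite -rmorphXn (prim_expr_order pw) rmorph1.
    by move/(prim_rootP pw) => [i ->]; exists i.
  have [i Di] := pow g; have [j Dj] := pow h.
  by rewrite Di Dj !rmorphXn /= Di Dj exprAC.
have [phi _] := num_field_embedding L R[i].
have [j ->] : exists j, zeta R n = phi w ^+ j.
  have pw' : n.-primitive_root (phi w) by rewrite fmorph_primitive_root.
  have /(prim_rootP pw')[j ->] : zeta R n ^+ n = 1 by rewrite (prim_expr_order (zeta_primitive R n0)).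
  by exists j.
by exists L, phi; split=> //; exists (w ^+ j) => //; rewrite rmorphXn.
Qed.
End Cyclotomic.

(** * Elements of extensions of small degree *)

Section Extensions.
Variable R : realType.
Local Notation C := R[i].
Implicit Types (F K : set C) (x y z : C).

Definition coefs_in F (p : {poly C}) := forall i, F p`_i.

Lemma coefs_in_char_poly F d (M : 'M[C]_d) : subfield F -> (forall i j, F (M i j)) ->
  coefs_in F (char_poly M).
Proof.
move=> sF FM.
have P0 : coefs_in F 0 by move=> k; rewrite coef0; exact: subfield0.
have PM p q : coefs_in F p -> coefs_in F q -> coefs_in F (p * q).
  by move=> Fp Fq k; rewrite coefM; apply: (subfield_sum sF) => i _; exact: (subfieldM sF).
have PD p q : coefs_in F p -> coefs_in F q -> coefs_in F (p + q).
  by move=> Fp Fq k; rewrite coefD; exact: (subfieldD sF).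
have PN p : coefs_in F p -> coefs_in F (- p).
  by move=> Fp k; rewrite coefN; exact: (subfieldN sF).
have P1 : coefs_in F 1.
  by move=> k; rewrite coef1; exact: (subfield_nat sF).
apply: big_ind => // s _; apply: (PM).
  by elim: (nat_of_bool _) => [|n IH]; rewrite ?expr0 // exprS; apply: (PM) => //; exact: PN.
apply: big_ind => // i _; rewrite !mxE; apply: (PD); last first.
  by apply: (PN) => k; rewrite coefC; case: eqP => _ //; exact: subfield0.
by case: (i == _); rewrite ?mulr0n // mulr1n => k; rewrite coefX; exact: (subfield_nat sF).
Qed.

(** The vector of the e_i is an eigenvector, for x, of the matrix of the c i j, so x is a root of
    the characteristic polynomial. *)
Lemma eigen_root F d (e : 'I_d -> C) (c : 'I_d -> 'I_d -> C) x : subfield F ->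
  (forall i j, F (c i j)) -> (exists i, e i != 0) -> (forall i, x * e i = \sum_j c i j * e j) ->
  exists p : {poly C}, [/\ p \is monic, size p = d.+1, coefs_in F p & root p x].
Proof.
move=> sF Fc [i0 ei0] xe; pose M : 'M[C]_d := \matrix_(i, j) c j i.
exists (char_poly M); split; [exact: char_poly_monic|exact: size_char_poly| |].
  by apply: coefs_in_char_poly => // i j; rewrite mxE.
rewrite -eigenvalue_root_char; apply/eigenvalueP; exists (\row_i e i).
  apply/rowP => j; rewrite !mxE xe; apply: eq_bigr => i _; by rewrite !mxE mulrC.
by apply/eqP => /rowP/(_ i0); rewrite !mxE; exact/eqP.
Qed.

Lemma small_poly_root K (p : {poly C}) x : subfield K -> closed_under_roots 2 K ->
  closed_under_roots 3 K -> p != 0 -> (size p <= 4)%N -> coefs_in K p -> root p x -> K x.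
Proof.
move=> sK K2 K3 p0 sp Kp /rootP.
rewrite (horner_coef_wide _ sp) !big_ord_recr big_ord0 /= add0r => e.
apply: (@cubic_root _ K sK K2 K3 p`_3 p`_2 p`_1 p`_0) => //.
  apply: contraNN p0 => /and4P[/eqP p3 /eqP p2 /eqP p1 /eqP p0].
  apply/eqP/polyP => i; rewrite coef0; case: i => [|[|[|[|i]]]] //.
  by rewrite nth_default // (leq_trans sp).
by apply: etrans e; ring.
Qed.

Lemma degree_root F K d x : subfield F -> subfield K -> degree_is F K d -> K x ->
  exists p : {poly C}, [/\ p \is monic, size p = d.+1, coefs_in F p & root p x].
Proof.
move=> sF sK [e [Ke span indep]] Kx.
have /choice[c Dc] i : exists c : 'I_d -> C, (forall j, F (c j)) /\ x * e i = \sum_j c j * e j.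
  by apply: span; exact: (subfieldM sK).
apply: (@eigen_root F d e c) => // [i j||i]; [by have [] := Dc i| |by have [] := Dc i].
have [//|n0] := pselect (exists i, e i != 0).
have e0 i : e i = 0 by apply/eqP/negP => ei; apply: n0; exists i; exact/negP.
case: d e Ke span indep c Dc n0 e0 => [|d] e Ke span indep c Dc n0 e0.
  have [c1 [_]] := span 1 (subfield1 sK).
  by rewrite big_ord0 => /eqP; rewrite oner_eq0.
have := indep (fun=> 1) (fun=> subfield1 sF) _ ord0; rewrite big1 => [/(_ erefl)/eqP|i _].
  by rewrite oner_eq0.
by rewrite e0 mulr0.
Qed.

(** * Towers *)

(** The fields at the top of an origami tower, in a form suited to induction. *)
Inductive tower_field : set C -> Prop :=
| TowerQ : tower_field (rationals R)
| TowerDegree F K d : tower_field F -> subfield K -> F `<=` K -> (2 <= d <= 3)%N ->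
    degree_is F K d -> tower_field K
| TowerZeta F k : tower_field F -> (1 <= k)%N -> tower_field (adjoin F (zeta R k)).

Lemma subfield_bigcap (I : Type) (P : set I) (F : I -> set C) :
  (forall i, P i -> subfield (F i)) -> subfield (\bigcap_(i in P) F i).
Proof.
move=> sF; apply/subfieldP; split=> [i Pi|x y Fx Fy i Pi|x y Fx Fy i Pi].
- exact: (subfield1 (sF i Pi)).
- by apply: (subfieldB (sF i Pi)); [exact: Fx|exact: Fy].
by apply: (subfield_div (sF i Pi)); [exact: Fx|exact: Fy].
Qed.

Lemma subfield_adjoin F z : subfield (adjoin F z).
Proof. by apply: subfield_bigcap => K []. Qed.

Lemma adjoin_sub F z : F `<=` adjoin F z.
Proof. by move=> x Fx K [_ FK]; apply: FK; left. Qed.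

Lemma adjoin_mem F z : adjoin F z z.
Proof. by move=> K [_ FK]; apply: FK; right. Qed.

Lemma adjoin_min F K z : subfield K -> F `<=` K -> K z -> adjoin F z `<=` K.
Proof. by move=> sK FK Kz x; apply; split=> // y [/FK|->]. Qed.

Lemma subfield_rationals : subfield (rationals R).
Proof.
apply/subfieldP; split=> [|_ _ [a _ <-] [b _ <-]|_ _ [a _ <-] [b _ <-]].
- by exists 1; rewrite ?rmorph1.
- by exists (a - b); rewrite ?rmorphB.
by exists (a / b); rewrite ?fmorph_div.
Qed.

Lemma tower_subfield F : tower_field F -> subfield F.
Proof. by case=> [|{}F K d _ sK _ _ _|{}F k _ _] //; [exact: subfield_rationals|exact: subfield_adjoin]. Qed.

Lemma tower_fieldP F : tower_field F <-> exists n G, origami_tower n G /\ G n = F.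
Proof.
split.
  elim=> [|{}F K d _ [n [G [[G0 sG GS Gstep] Gn]]] sK FK d23 deg|{}F k _ [n [G [[G0 sG GS Gstep] Gn]]] k1].
  - exists 0%N, (fun=> rationals R); split=> //; split=> // _ _; exact: subfield_rationals.
  - exists n.+1, (fun i => if (i <= n)%N then G i else K); rewrite ltnn; split=> //; split=> //.
    + by move=> i _; case: leqP => // iN; exact: sG.
    + move=> i; rewrite ltnS => iN; rewrite iN; case: (leqP i.+1 n) => [lt|]; first exact: (GS i lt).
      by move=> gt; (have -> : i = n by lia); rewrite Gn.
    move=> i; rewrite ltnS => iN; rewrite iN; case: (leqP i.+1 n) => [lt|gt]; first exact: (Gstep i lt).
    by left; exists d; split=> //; (have -> : i = n by lia); rewrite Gn.
  exists n.+1, (fun i => if (i <= n)%N then G i else adjoin F (zeta R k)); rewrite ltnn; split=> //; split=> //.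
  + by move=> i _; case: leqP => // iN; [exact: sG|exact: subfield_adjoin].
  + move=> i; rewrite ltnS => iN; rewrite iN; case: (leqP i.+1 n) => [lt|]; first exact: (GS i lt).
    by move=> gt; (have -> : i = n by lia); rewrite Gn; exact: adjoin_sub.
  move=> i; rewrite ltnS => iN; rewrite iN; case: (leqP i.+1 n) => [lt|gt]; first exact: (Gstep i lt).
  by right; exists k; split=> //; (have -> : i = n by lia); rewrite Gn.
move=> [n [G [[G0 sG GS Gstep] <-]]].
have : forall i, (i <= n)%N -> tower_field (G i); last exact.
elim=> [|i IH] lein; first by rewrite G0; exact: TowerQ.
have [[d [d23 deg]]|[k [k1 ->]]] := Gstep i lein.
  by apply: (TowerDegree (IH (ltnW lein)) (sG _ lein) (GS _ lein) d23 deg).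
by apply: TowerZeta => //; exact: IH (ltnW lein).
Qed.
End Extensions.

Section Towers.
Variable R : realType.
Local Notation C := R[i].
Implicit Types (F K G H : set C) (x y z : C).

(** From q(y) y + c = 0 with c nonzero, the inverse of y is - q(y) / c; if c = 0, the polynomial q
    of smaller degree serves. *)
Lemma root_inv F K (p : {poly C}) y : subfield F -> (forall a b, K a -> K b -> K (a + b)) ->
  (forall a b, K a -> K b -> K (a * b)) -> F `<=` K -> K y -> p != 0 ->
  coefs_in F p -> root p y -> K y^-1.
Proof.
move=> sF KD KM FK Ky.
have [->|y0] := eqVneq y 0; first by move=> *; rewrite invr0; apply/FK/(subfield0 sF).
have [n] := ubnP (size p); elim: n p => // n IH p; rewrite ltnS => pn p0 Fp.
have [q [c Dp]] : exists (q : {poly C}) c, p = q * 'X + c%:P.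
  by clear; elim/poly_ind: p => [|q c _]; [exists 0, 0; rewrite mul0r addr0|exists q, c].
have Fc : F c by have := Fp 0%N; rewrite Dp coefD coefMX coefC add0r.
have Fq : coefs_in F q by move=> i; have := Fp i.+1; rewrite Dp coefD coefMX coefC addr0.
rewrite rootE Dp !hornerE; have [c0|c0] := eqVneq c 0.
  rewrite c0 addr0 mulf_eq0 (negPf y0) orbF => rq; apply: (IH q) => //.
    apply: leq_trans pn; rewrite Dp c0 addr0 size_mulX //.
    by apply: contraNneq p0 => q0; rewrite Dp c0 q0 mul0r addr0.
  by apply: contraNneq p0 => q0; rewrite Dp c0 q0 mul0r addr0.
rewrite addr_eq0 => /eqP e.
have -> : y^-1 = q.[y] * (- c^-1).
  by apply: (mulfI y0); rewrite divff // mulrA [y * _]mulrC e mulrNN divff.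
apply: (KM); last by apply/FK/(subfieldN sF)/(subfieldV sF).
have KX k : K (y ^+ k).
  by elim: k => [|k IHk]; rewrite ?expr0 ?exprS; [apply/FK/(subfield1 sF)|exact: KM].
rewrite horner_coef; apply: big_ind => [|//|i _]; first exact/FK/(subfield0 sF).
by apply: (KM) => //; exact/FK.
Qed.

(* [F(z)] is spanned by [1, z, ..., z ^ (d - 1)] where [d] is the least degree of a polynomial over [F] with root [z]. *)
Lemma tower_root F (p : {poly C}) z : tower_field F -> p != 0 -> (size p <= 4)%N -> coefs_in F p -> root p z ->
  exists K, [/\ tower_field K, F `<=` K & K z].
Proof.
move=> tF p0 sp Fp rp; have sF := tower_subfield tF.
pose P n := `[< exists q : {poly C}, [/\ q != 0, (size q <= n.+1)%N, coefs_in F q & root q z] >].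
have exP : exists n, P n by exists 3; apply/asboolP; exists p.
case: (ex_minnP exP) => d /asboolP[q [q0 sq Fq rq]] dmin.
have indep (c : 'I_d -> C) : (forall i, F (c i)) -> \sum_(i < d) c i * z ^+ i = 0 -> forall i, c i = 0.
  case: d {dmin q q0 sq Fq rq exP} c (dmin) => [|d] c dm Fc e i; first by case: i.
  pose r := \poly_(j < d.+1) (if insub j is Some k then c k else 0).
  have rE (j : 'I_d.+1) : r`_j = c j by rewrite coef_poly ltn_ord valK.
  have [r0|r0] := eqVneq r 0; first by rewrite -rE r0 coef0.
  have : P d.
    apply/asboolP; exists r; split=> //; first exact: size_poly.
      move=> j; rewrite coef_poly; case: ltnP => [lt|_]; last exact: (subfield0 sF).
      by case: insubP => [k _ _|_]; [exact: Fc|exact: (subfield0 sF)].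
    rewrite rootE (horner_coef_wide _ (size_poly _ _)) -/r; apply/eqP; rewrite -[RHS]e.
    by apply: eq_bigr => j _; rewrite rE.
  by move/dm; rewrite ltnn.
have d3 : (d <= 3)%N by apply: dmin; apply/asboolP; exists p.
case: d => [|m] in sq dmin indep d3 *.
  by have := size1_polyC sq => Dq; move: rq q0; rewrite Dq rootC polyC_eq0 => ->.
have sqE : size q = m.+2.
  apply/eqP; rewrite eqn_leq sq ltnNge; apply/negP => sq'.
  by have : P m by [apply/asboolP; exists q]; move/dmin; rewrite ltnn.
have qm0 : q`_m.+1 != 0 by have := lead_coef_eq0 q; rewrite lead_coefE sqE (negPf q0) => /negbT.
pose b i := - q`_i / q`_m.+1.
have Fb i : F (b i) by apply: (subfield_div sF) (Fq _); exact: (subfieldN sF).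
have Dz : z ^+ m.+1 = \sum_(i < m.+1) b i * z ^+ i.
  move/rootP: rq; rewrite (horner_coef_wide _ sq) big_ord_recr /= addrC => /eqP; rewrite addr_eq0 => /eqP e.
  apply: (mulfI qm0); rewrite e mulr_sumr -sumrN; apply: eq_bigr => i _.
  by rewrite /b; field.
(* Towers have no step of degree 1; in that case [z] is already in [F]. *)
have [m0|m0] := posnP m.
  exists F; split=> //; move: Dz; rewrite m0 expr1 big_ord1 expr0 mulr1 => ->; exact: Fb.
pose K : set C := [set x | exists2 r, coefs_in F r & x = r.[z]].
have KD x y : K x -> K y -> K (x + y).
  move=> [r Fr ->] [s Fs ->]; exists (r + s); rewrite ?hornerD // => i.
  by rewrite coefD; exact: (subfieldD sF).
have KM x y : K x -> K y -> K (x * y).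
  move=> [r Fr ->] [s Fs ->]; exists (r * s); rewrite ?hornerM // => i.
  by rewrite coefM; apply: (subfield_sum sF) => j _; exact: (subfieldM sF).
have FK : F `<=` K.
  move=> x Fx; exists x%:P; rewrite ?hornerC // => i; rewrite coefC.
  by case: eqP => // _; exact: (subfield0 sF).
have Kz : K z by exists 'X; rewrite ?hornerX // => i; rewrite coefX; exact: (subfield_nat sF).
have span x : K x -> exists f : nat -> C, (forall i, F (f i)) /\ x = \sum_(i < m.+1) f i * z ^+ i.
  move=> [r Fr ->]; elim/poly_ind: r Fr => [|r c IH] Fr.
    exists (fun=> 0); split=> [_|]; first exact: (subfield0 sF).
    by rewrite horner0 big1 // => i _; rewrite mul0r.
  have Fc : F c by have := Fr 0%N; rewrite coefD coefMX coefC add0r.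
  have [i|f [Ff e]] := IH; first by have := Fr i.+1; rewrite coefD coefMX coefC addr0.
  exists (fun i => if i is k.+1 then f k + f m * b k.+1 else c + f m * b 0%N); split=> [[|k]|].
  - by apply: (subfieldD sF) => //; exact: (subfieldM sF).
  - by apply: (subfieldD sF) => //; exact: (subfieldM sF).
  rewrite hornerMXaddC e big_ord_recr /= mulrDl -mulrA -exprSr Dz !big_ord_recl /= !expr0 !mulr1.
  have -> : (\sum_(i < m) f i * z ^+ i) * z = \sum_(i < m) f i * z ^+ i.+1.
    by rewrite mulr_suml; apply: eq_bigr => i _; rewrite exprSr mulrA.
  have -> : \sum_(i < m) (f i + f m * b i.+1) * z ^+ i.+1 =
            \sum_(i < m) f i * z ^+ i.+1 + f m * \sum_(i < m) b i.+1 * z ^+ i.+1.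
    by rewrite mulr_sumr -big_split; apply: eq_bigr => i _; rewrite /=; ring.
  by ring.
have Ke i : K (z ^+ i).
  by elim: i => [|i IH]; rewrite ?expr0 ?exprS; [exact/FK/(subfield1 sF)|exact: KM].
have spanI x : K x -> exists c : 'I_m.+1 -> C, (forall i, F (c i)) /\ x = \sum_(i < m.+1) c i * z ^+ i.
  by move=> /span[f [Ff ->]]; exists (fun i => f i).
have KV y : K y -> K y^-1.
  move=> Ky; have /choice[c Dc] (i : 'I_m.+1) : exists c : 'I_m.+1 -> C, (forall j, F (c j)) /\ y * z ^+ i = \sum_j c j * z ^+ j.
    by apply: spanI; exact: KM.
  have [i j||i|r [mr _ Fr rr]] := @eigen_root _ F m.+1 (fun i => z ^+ i) c y sF.
  - by have [] := Dc i.
  - by exists ord0; rewrite expr0 oner_eq0.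
  - by have [] := Dc i.
  by apply: (root_inv sF KD KM FK Ky (monic_neq0 mr) Fr rr).
have sK : subfield K.
  apply/subfieldP; split=> [|x y Kx Ky|x y Kx Ky]; first exact/FK/(subfield1 sF).
    by apply: (KD) => //; rewrite -mulN1r; apply: (KM) => //; exact/FK/(subfieldN sF)/(subfield1 sF).
  by apply: (KM) => //; exact: KV.
exists K; split=> //; apply: (TowerDegree tF sK FK (d := m.+1)); first by rewrite ltnS m0.
by exists (fun i => z ^+ i); split=> // i; exact: Ke.
Qed.
End Towers.

(** * Composites of towers and the numbers they reach *)

Section TowerUnion.
Variable R : realType.
Local Notation C := R[i].
Implicit Types (F K G H : set C) (x y z : C).

(** The generators of the tower of [G], moved by [phi], are adjoined on top of [H] one by one. Their
    degrees may drop over the larger field, which is why [tower_root] takes any polynomial of degree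
    at most 3. The identity gives composites, conjugation gives stability under it. *)
Lemma tower_join (phi : {rmorphism C -> C}) G :
  (forall k H, subfield H -> H (zeta R k) -> H (phi (zeta R k))) -> tower_field G ->
  forall H, tower_field H ->
  exists K, [/\ tower_field K, H `<=` K & forall x, G x -> K (phi x)].
Proof.
move=> phi_zeta; elim=> [|{}G L d tG IH sL GL d23 deg|{}G k tG IH k1] H tH.
- exists H; split=> // _ [a _ <-]; rewrite fmorph_rat; exact: (subfield_rat (tower_subfield tH)).
- have [K [tK HK GK]] := IH H tH; have sG := tower_subfield tG.
  have [e [Le span _]] := deg.
  have add (s : seq 'I_d) : exists K', [/\ tower_field K', K `<=` K' & forall i, i \in s -> K' (phi (e i))].
    elim: s => [|j s [K' [tK' KK' sK']]]; first by exists K; split=> // x.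
    have [p [mp sp Gp rp]] := degree_root sG sL deg (Le j).
    have [||||K'' [tK'' K'K'' K''j]] := @tower_root _ K' (map_poly phi p) (phi (e j)) tK'.
    + by rewrite map_poly_eq0 monic_neq0.
    + by rewrite size_map_poly sp; case/andP: d23.
    + by move=> i; rewrite coef_map; apply/KK'/GK.
    + by rewrite fmorph_root.
    exists K''; split=> // [x /KK'/K'K''//|i]; rewrite inE => /predU1P[->//|/sK'/K'K''//].
  have [K' [tK' KK' eK']] := add (enum 'I_d); have sK' := tower_subfield tK'.
  exists K'; split=> // [x /HK/KK'//|x /span[c [Gc ->]]]; rewrite rmorph_sum.
  apply: (subfield_sum sK') => i _; rewrite rmorphM; apply: (subfieldM sK'); first exact/KK'/GK.
  by apply: eK'; rewrite mem_enum.
have [K [tK HK GK]] := IH H tH.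
have sA := subfield_adjoin K (zeta R k); have KA := @adjoin_sub _ K (zeta R k).
exists (adjoin K (zeta R k)); split; [exact: TowerZeta|by move=> x /HK/KA|].
have sP : subfield [set x | adjoin K (zeta R k) (phi x)].
  apply/subfieldP; split=> [|x y|x y] /=; rewrite ?rmorph1 ?rmorphB ?fmorph_div /=.
  - exact: (subfield1 sA).
  - exact: (subfieldB sA).
  - exact: (subfield_div sA).
apply: adjoin_min => // [x Gx|]; first exact: (KA _ (GK _ Gx)).
by apply: (phi_zeta k) sA _; exact: adjoin_mem.
Qed.

Definition tower_numbers : set C := [set z | exists2 F, tower_field F & F z].

Lemma tower_pair x y : tower_numbers x -> tower_numbers y ->
  exists F, [/\ tower_field F, F x & F y].
Proof.
move=> [F tF Fx] [G tG Gy].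
have [|K [tK GK FK]] := @tower_join idfun F _ tF G tG; first by [].
by exists K; split; [|exact: FK|exact: GK].
Qed.

Lemma tower_numbers_subfield : subfield tower_numbers.
Proof.
apply/subfieldP; split=> [|x y Tx Ty|x y Tx Ty].
- by exists (rationals R); [exact: TowerQ|exact: (subfield1 (subfield_rationals R))].
- have [F [tF Fx Fy]] := tower_pair Tx Ty; exists F => //; exact: (subfieldB (tower_subfield tF)).
have [F [tF Fx Fy]] := tower_pair Tx Ty; exists F => //; exact: (subfield_div (tower_subfield tF)).
Qed.

Lemma tower_numbers_zeta k : tower_numbers (zeta R k).
Proof.
case: k => [|k]; first by rewrite zeta0; exact: (subfield1 tower_numbers_subfield).
by exists (adjoin (rationals R) (zeta R k.+1)); [apply: TowerZeta => //; exact: TowerQ|exact: adjoin_mem].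
Qed.

Lemma tower_numbers_conj : closed_under_conj tower_numbers.
Proof.
move=> z [F tF Fz]; have [|K [tK _ FK]] := @tower_join (@Num.conj C) F _ tF _ (TowerQ R).
  by move=> k H sH Hz /=; rewrite conj_zeta; exact: (subfieldV sH).
by exists K => //; exact: FK.
Qed.

Lemma tower_numbers_roots n : (1 < n)%N -> (n <= 3)%N -> closed_under_roots n tower_numbers.
Proof.
move=> n1 n3 a z [F tF Fa] Dz; have sF := tower_subfield tF.
have n0 := ltnW n1.
have [||||K [tK _ Kz]] := @tower_root _ F ('X^n - a%:P) z tF; last by exists K.
- by rewrite -size_poly_eq0 size_XnsubC.
- by rewrite size_XnsubC.
- move=> i; rewrite coefB coefXn coefC; apply: (subfieldB sF); first exact: (subfield_nat sF).
  by case: eqP => // _; exact: (subfield0 sF).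
by rewrite rootE !hornerE Dz subrr.
Qed.

Lemma tower_numbers_O_RP : tower_numbers = O_RP R.
Proof.
apply/seteqP; split; last first.
  apply: O_RP_sub; [exact: tower_numbers_subfield|exact: tower_numbers_roots|exact: tower_numbers_roots|exact: tower_numbers_conj|exact: tower_numbers_zeta].
have sK := O_RP_subfield R; have K2 := @O_RP_sqrt R; have K3 := @O_RP_cbrt R.
move=> z [F tF]; move: z; elim: tF => [|{}F L d tF IH sL FL d23 deg|{}F k tF IH _].
- by move=> _ [a _ <-]; exact: subfield_rat.
- move=> x Lx; have [p [mp sp Fp rp]] := degree_root (tower_subfield tF) sL deg Lx.
  apply: (small_poly_root sK K2 K3 (monic_neq0 mp)) rp; first by rewrite sp; case/andP: d23.
  by move=> i; exact/IH.
by apply: adjoin_min => //; exact: zeta_O_RP.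
Qed.

Lemma Q_Ab_O_RP : Q_Ab R `<=` O_RP R.
Proof.
have sK := O_RP_subfield R.
move=> _ [L [iota [galL abL [z _ <-]]]]; apply: abelian_sqrt_closed abL.
- exact: (subfieldB sK).
- exact: (subfieldM sK).
- exact: (subfieldV sK).
- move=> n x n0 /(root_of_unity_zeta n0)[k ->]; apply: (subfieldX sK); exact: zeta_O_RP.
by move=> x Kx; exact: (O_RP_sqrt Kx).
Qed.
End TowerUnion.

Theorem theorem4p6 (R : realType) :
  (root_conj_closed_subfield (O_RP R) /\
   forall F : set R[i], root_conj_closed_subfield F -> O_RP R `<=` F) /\
  (forall alpha : R[i],
     O_RP R alpha <->
     exists (n : nat) (F : nat -> set R[i]), origami_tower n F /\ F n alpha).
Proof.
split=> [|alpha].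
  split=> [|F [sF QF F2 F3 Fc]].
    split; [exact: O_RP_subfield|exact: Q_Ab_O_RP|exact: O_RP_sqrt|exact: O_RP_cbrt|exact: O_RP_conj].
  by apply: O_RP_sub => // n; exact/QF/zeta_Q_Ab.
rewrite -tower_numbers_O_RP; split=> [[F /tower_fieldP[n [G [tG <-]]] Fa]|[n [F [tF Fa]]]].
  by exists n, G.
by exists (F n) => //; apply/tower_fieldP; exists n, F.
Qed.
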